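(* The left $\mathbf U^m$-action and the right $\mathbf H_d$-action on $\mathbf W^{\otimes d}$ described in the context commute. If $n\ge d$ they have the double centralizer property: $\mathbf H_d\simeq\mathrm{End}_{\mathbf U^m}(\mathbf W^{\otimes d})$ via the right action, and the algebra homomorphism $\mathbf U^m\to\mathrm{End}_{\mathbf H_d}(\mathbf W^{\otimes d})$ is surjective.
   Context: Fix integers $n\ge 1$, $d\ge 2$; $[a,b]$ denotes the set of integers from $a$ to $b$. Algebra $\mathbf U^m$: the unital associative $\mathbb Q(v)$-algebra generated by $E_i,F_i$ ($i\in[1,n-1]$), $H_a^{\pm1}$ ($a\in[1,n]$), $T$, $J_+,J_-$ with relations: $J_++J_-=1$, $J_\alpha J_\beta=\delta_{\alpha,\beta}J_\alpha$; $J_\pm H_a=H_aJ_\pm$, $J_\pm E_i=E_iJ_\pm$, $F_iJ_\pm=J_\pm F_i$; $J_\pm T=TJ_\mp$; $H_aH_b=H_bH_a$, $H_aH_a^{-1}=1$; $H_aE_i=v^{\delta_{ai}-\delta_{a,i+1}}E_iH_a$, $H_aF_i=v^{-\delta_{ai}+\delta_{a,i+1}}F_iH_a$, $H_aT=TH_a$; $E_iF_j-F_jE_i=\delta_{ij}\frac{H_iH_{i+1}^{-1}-H_i^{-1}H_{i+1}}{v-v^{-1}}$; $E_iE_j=E_jE_i$, $F_iF_j=F_jF_i$ if $|i-j|>1$; $E_i^2E_j-(v+v^{-1})E_iE_jE_i+E_jE_i^2=0$, $F_i^2F_j-(v+v^{-1})F_iF_jF_i+F_jF_i^2=0$ if $|i-j|=1$;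 $TE_i=E_iT$, $TF_i=F_iT$ if $i\le n-2$; $E_{n-1}^2T-(v+v^{-1})E_{n-1}TE_{n-1}+TE_{n-1}^2=0$, $F_{n-1}^2T-(v+v^{-1})F_{n-1}TF_{n-1}+TF_{n-1}^2=0$; $T^2E_{n-1}-(v+v^{-1})TE_{n-1}T+E_{n-1}T^2=E_{n-1}$, $T^2F_{n-1}-(v+v^{-1})TF_{n-1}T+F_{n-1}T^2=F_{n-1}$. Hecke algebra $\mathbf H_d$ (type $D_d$): the unital associative $\mathbb Q(v)$-algebra generated by $\tau_1,\dots,\tau_d$ with relations $\tau_i^2=(v^2-1)\tau_i+v^2$ ($1\le i\le d$); $\tau_j\tau_{j+1}\tau_j=\tau_{j+1}\tau_j\tau_{j+1}$ ($1\le j\le d-2$); $\tau_i\tau_j=\tau_j\tau_i$ ($1\le j\le i-2\le d-3$); $\tau_d\tau_l=\tau_l\tau_d$ ($l\ne d-2$); $\tau_d\tau_{d-2}\tau_d=\tau_{d-2}\tau_d\tau_{d-2}$ (when $d\ge 3$). Tensor spaces: $\mathbf V$ is a $\mathbb Q(v)$-vector space with basis $\mathbf v_1,\dots,\mathbf v_{2n+1}$, and $\mathbf W\subset\mathbf V$ is spanned by the $\mathbf v_i$, $i\ne n+1$. For $\mathbf r=(r_1,\dots,r_d)\in[1,2n+1]^d$, $\mathbf v_{\mathbf r}=\mathbf v_{r_1}\otimes\cdots\otimes\mathbf v_{r_d}$. Extend $\mathbf r$ to length $2d$ by $r_{2d+1-i}=2n+2-r_i$, and identify $\mathbf r$ with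 its extension. For $p\in[1,2d]$, $\mathbf r'_p$ (resp. $\mathbf r''_p$) is obtained from the extended $\mathbf r$ by replacing $r_p$ by $r_p+1$ and $r_{2d+1-p}$ by $r_{2d+1-p}-1$ (resp. $r_p$ by $r_p-1$ and $r_{2d+1-p}$ by $r_{2d+1-p}+1$). Operators on $\mathbf V^{\otimes d}$ ($i\in[1,n]$, $a\in[1,n+1]$): $E_i\mathbf v_{\mathbf r}=v^{-\sum_{1\le j\le 2d}\delta_{i+1,r_j}}\sum_{p:r_p=i}v^{2\sum_{j<p}\delta_{i+1,r_j}}\mathbf v_{\mathbf r'_p}$; $F_i\mathbf v_{\mathbf r}=v^{-\sum_{1\le j\le 2d}\delta_{i,r_j}}\sum_{p:r_p=i+1}v^{2\sum_{j>p}\delta_{i,r_j}}\mathbf v_{\mathbf r''_p}$; $H_a^{\pm1}\mathbf v_{\mathbf r}=v^{\mp\sum_{1\le j\le 2d}\delta_{a,r_j}}\mathbf v_{\mathbf r}$; $J_+$ (resp. $J_-$) sends $\mathbf v_{\mathbf r}$ to itself if no $r_i$ equals $n+1$ and $\#\{j\in[1,d]:r_j\ge n+1\}$ is even (resp. odd), and to $0$ otherwise. $\mathbf U^m$-action on $\mathbf W^{\otimes d}$: the generators $E_i,F_i$ ($i\in[1,n-1]$), $H_a^{\pm1}$ ($a\in[1,n]$), $J_\pm$ act as the restrictions to $\mathbf W^{\otimes d}$ of the operators on $\mathbf V^{\otimes d}$ with the same names, that is, by $E_i\mathbf v_{\mathbf r}=v^{-\sum_{1\le j\le 2d}\delta_{i+1,r_j}}\sum_{p:r_p=i}v^{2\sum_{j<p}\delta_{i+1,r_j}}\mathbf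 v_{\mathbf r'_p}$, $F_i\mathbf v_{\mathbf r}=v^{-\sum_{1\le j\le 2d}\delta_{i,r_j}}\sum_{p:r_p=i+1}v^{2\sum_{j>p}\delta_{i,r_j}}\mathbf v_{\mathbf r''_p}$, $H_a^{\pm1}\mathbf v_{\mathbf r}=v^{\mp\sum_{1\le j\le 2d}\delta_{a,r_j}}\mathbf v_{\mathbf r}$, and $J_+\mathbf v_{\mathbf r}=\mathbf v_{\mathbf r}$ (resp. $J_-\mathbf v_{\mathbf r}=\mathbf v_{\mathbf r}$) if $\#\{j\in[1,d]:r_j\ge n+1\}$ is even (resp. odd) and $0$ otherwise, for $\mathbf r$ with no $r_i$ equal to $n+1$; and $T\cdot\mathbf v_{\mathbf r}=\big(F_nE_n+\frac{H_nH_{n+1}^{-1}-H_n^{-1}H_{n+1}}{v-v^{-1}}\big)\mathbf v_{\mathbf r}$. Right $\mathbf H_d$-action (restricted from $\mathbf V^{\otimes d}$): for $1\le j\le d-1$ let $\mathbf rs_j$ be obtained by exchanging $r_j,r_{j+1}$; let $\mathbf rs_d$ be obtained by replacing $(r_{d-1},r_d)$ by $(2n+2-r_d,2n+2-r_{d-1})$. For $j\le d-1$: $\mathbf v_{\mathbf r}\tau_j=\mathbf v_{\mathbf rs_j}$ if $r_j<r_{j+1}$, $v^2\mathbf v_{\mathbf r}$ if $r_j=r_{j+1}$, $(v^2-1)\mathbf v_{\mathbf r}+v^2\mathbf v_{\mathbf rs_j}$ if $r_j>r_{j+1}$; and $\mathbf v_{\mathbf r}\tau_d=\mathbf v_{\mathbf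 rs_d}$, $v^2\mathbf v_{\mathbf r}$, $(v^2-1)\mathbf v_{\mathbf r}+v^2\mathbf v_{\mathbf rs_d}$ according as $r_{d-1}+r_d<2n+2$, $=2n+2$, $>2n+2$. *)

(* Defs.v *)
From HB Require Import structures.
From mathcomp Require Import all_boot all_order all_algebra.
From mathcomp Require Import perm boolp monalg.

Set Implicit Arguments.
Unset Strict Implicit.
Unset Printing Implicit Defensive.

Import GRing.Theory.
Local Open Scope ring_scope.
Local Open Scope quotient_scope.

Lemma malgC_comm (M : monomType) (R : comNzRingType) (a : R) (x : {malg R[M]}) :
  a%:MP * x = x * a%:MP.
Proof.
rewrite !malgM_def fgmulUg fgmulgU.
by apply: eq_bigr => k _; rewrite mul1m mulm1 mulrC.
Qed.

Lemma mulrB_split (R : nzRingType) (x y z t : R) :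
  x * y - z * t = (x - z) * y + z * (y - t).
Proof. by rewrite mulrBl mulrBr subrKA. Qed.

Notation free_alg K X := {malg K[{fmonom X}]}.

Definition free_gen (K : fieldType) (X : choiceType) (x : X) : free_alg K X :=
  << fmu x >>.

Section Ideal.
Variables (K : fieldType) (X : choiceType).
Variable rels : free_alg K X -> free_alg K X -> Prop.

(* The two-sided ideal generated by the differences [x - y], [rels x y]. *)
Inductive rel_ideal : free_alg K X -> Prop :=
| rel_ideal_gen a x y b of rels x y : rel_ideal (a * (x - y) * b)
| rel_ideal0 : rel_ideal 0
| rel_idealD x y of rel_ideal x & rel_ideal y : rel_ideal (x + y).

Lemma rel_idealMl a x : rel_ideal x -> rel_ideal (a * x).
Proof.
elim=> [b y z c h||y z _ hy _ hz]; last by rewrite mulrDr; apply: rel_idealD.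
- by rewrite !mulrA -(mulrA _ _ c) mulrA; apply: rel_ideal_gen.
- by rewrite mulr0; apply: rel_ideal0.
Qed.

Lemma rel_idealMr a x : rel_ideal x -> rel_ideal (x * a).
Proof.
elim=> [b y z c h||y z _ hy _ hz]; last by rewrite mulrDl; apply: rel_idealD.
- by rewrite -(mulrA _ c a); apply: rel_ideal_gen.
- by rewrite mul0r; apply: rel_ideal0.
Qed.

Lemma rel_idealN x : rel_ideal x -> rel_ideal (- x).
Proof. by rewrite -mulN1r; apply: rel_idealMl. Qed.

Definition rel_equiv : rel (free_alg K X) := fun x y => `[< rel_ideal (x - y) >].

Lemma rel_equivP : equiv_class_of rel_equiv.
Proof.
split=> [x|x y|y x z].
- by apply/asboolP; rewrite subrr; apply: rel_ideal0.
- by apply/asboolP/asboolP => /rel_idealN; rewrite opprB.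
- move=> /asboolP hxy /asboolP hyz; apply/asboolP.
  by rewrite -(subrKA y); apply: rel_idealD.
Qed.
Canonical rel_equiv_rel := EquivRelPack rel_equivP.

(* A ring may not be trivial in the library's [algType], hence [proper]. *)
Definition pres_alg (proper : ~ rel_ideal 1) := {eq_quot rel_equiv_rel}.

End Ideal.

HB.lock Definition pres_pi (K : fieldType) (X : choiceType)
    (rels : free_alg K X -> free_alg K X -> Prop) (proper : ~ rel_ideal rels 1)
    (x : free_alg K X) : pres_alg proper :=
  \pi_(pres_alg proper) x.

HB.lock Definition pres_add (K : fieldType) (X : choiceType)
    (rels : free_alg K X -> free_alg K X -> Prop) (proper : ~ rel_ideal rels 1)
    (x y : pres_alg proper) : pres_alg proper :=
  pres_pi proper (repr x + repr y).

HB.lock Definition pres_opp (K : fieldType) (X : choiceType)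
    (rels : free_alg K X -> free_alg K X -> Prop) (proper : ~ rel_ideal rels 1)
    (x : pres_alg proper) : pres_alg proper :=
  pres_pi proper (- repr x).

HB.lock Definition pres_mul (K : fieldType) (X : choiceType)
    (rels : free_alg K X -> free_alg K X -> Prop) (proper : ~ rel_ideal rels 1)
    (x y : pres_alg proper) : pres_alg proper :=
  pres_pi proper (repr x * repr y).

HB.lock Definition pres_scale (K : fieldType) (X : choiceType)
    (rels : free_alg K X -> free_alg K X -> Prop) (proper : ~ rel_ideal rels 1)
    (a : K) (x : pres_alg proper) : pres_alg proper :=
  pres_pi proper (a *: repr x).

Section Presentation.
Variables (K : fieldType) (X : choiceType).
Variable (rels : free_alg K X -> free_alg K X -> Prop).
Variable proper : ~ rel_ideal rels 1.
Local Notation A := (free_alg K X).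
Local Notation Q := (pres_alg proper).
Local Notation pres_pi := (@pres_pi _ _ _ proper).
Local Notation pres_add := (@pres_add _ _ _ proper).
Local Notation pres_opp := (@pres_opp _ _ _ proper).
Local Notation pres_mul := (@pres_mul _ _ _ proper).
Local Notation pres_scale := (@pres_scale _ _ _ proper).

HB.instance Definition _ := Choice.on Q.

Definition pres_gen (x : X) : Q := pres_pi (free_gen K x).

Lemma pres_piP x y : pres_pi x = pres_pi y <-> rel_ideal rels (x - y).
Proof.
rewrite pres_pi.unlock; split=> [/eqP|h]; first by rewrite piE => /asboolP.
by apply/eqP; rewrite piE; apply/asboolP.
Qed.

Lemma pres_piK (x : Q) : pres_pi (repr x) = x.
Proof. by rewrite pres_pi.unlock; exact: reprK. Qed.

Lemma pres_repr x : rel_ideal rels (repr (pres_pi x) - x).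
Proof. by apply/pres_piP; rewrite pres_piK. Qed.

Lemma pres_piD x y : pres_pi (x + y) = pres_add (pres_pi x) (pres_pi y).
Proof.
rewrite pres_add.unlock; apply/esym/pres_piP; rewrite opprD addrACA.
by apply: rel_idealD; apply: pres_repr.
Qed.

Lemma pres_piN x : pres_pi (- x) = pres_opp (pres_pi x).
Proof.
by rewrite pres_opp.unlock; apply/esym/pres_piP; rewrite -opprD; apply/rel_idealN/pres_repr.
Qed.

Lemma pres_piM x y : pres_pi (x * y) = pres_mul (pres_pi x) (pres_pi y).
Proof.
rewrite pres_mul.unlock; apply/esym/pres_piP; set x' := repr _; set y' := repr _.
rewrite mulrB_split.
by apply: rel_idealD; [apply: rel_idealMr|apply: rel_idealMl]; apply: pres_repr.
Qed.

Lemma pres_piZ a x : pres_pi (a *: x) = pres_scale a (pres_pi x).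
Proof.
rewrite pres_scale.unlock; apply/esym/pres_piP; rewrite -scalerBr -mul_malgC.
by apply/rel_idealMl/pres_repr.
Qed.

Local Definition piE' := (pres_piD, pres_piN, pres_piM, pres_piZ).

Lemma pres_addA : associative pres_add.
Proof.
by move=> x y z; rewrite -[x]pres_piK -[y]pres_piK -[z]pres_piK -!piE' addrA.
Qed.
Lemma pres_addC : commutative pres_add.
Proof. by move=> x y; rewrite -[x]pres_piK -[y]pres_piK -!piE' addrC. Qed.
Lemma pres_add0 : left_id (pres_pi 0) pres_add.
Proof. by move=> x; rewrite -[x]pres_piK -!piE' add0r. Qed.
Lemma pres_addN : left_inverse (pres_pi 0) pres_opp pres_add.
Proof. by move=> x; rewrite -[x]pres_piK -!piE' addNr. Qed.

HB.instance Definition _ :=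
  GRing.isZmodule.Build Q pres_addA pres_addC pres_add0 pres_addN.

Lemma pres_mulA : associative pres_mul.
Proof.
by move=> x y z; rewrite -[x]pres_piK -[y]pres_piK -[z]pres_piK -!piE' mulrA.
Qed.
Lemma pres_mul1 : left_id (pres_pi 1) pres_mul.
Proof. by move=> x; rewrite -[x]pres_piK -!piE' mul1r. Qed.
Lemma pres_mulr1 : right_id (pres_pi 1) pres_mul.
Proof. by move=> x; rewrite -[x]pres_piK -!piE' mulr1. Qed.
Lemma pres_mulDl : left_distributive pres_mul +%R.
Proof.
move=> x y z; rewrite -[x]pres_piK -[y]pres_piK -[z]pres_piK.
by rewrite -[LHS]/(pres_mul (pres_add _ _) _) -[RHS]/(pres_add _ _) -!piE' mulrDl.
Qed.
Lemma pres_mulDr : right_distributive pres_mul +%R.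
Proof.
move=> x y z; rewrite -[x]pres_piK -[y]pres_piK -[z]pres_piK.
by rewrite -[LHS]/(pres_mul _ (pres_add _ _)) -[RHS]/(pres_add _ _) -!piE' mulrDr.
Qed.
Lemma pres_1neq0 : pres_pi 1 != 0.
Proof. by apply/eqP => /pres_piP; rewrite subr0. Qed.

HB.instance Definition _ := GRing.Zmodule_isNzRing.Build Q
  pres_mulA pres_mul1 pres_mulr1 pres_mulDl pres_mulDr pres_1neq0.

Lemma pres_scaleA a b x : pres_scale a (pres_scale b x) = pres_scale (a * b) x.
Proof. by rewrite -[x]pres_piK -!piE' scalerA. Qed.
Lemma pres_scale1 : left_id 1 pres_scale.
Proof. by move=> x; rewrite -[x]pres_piK -!piE' scale1r. Qed.
Lemma pres_scaleDr : right_distributive pres_scale +%R.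
Proof.
move=> a x y; rewrite -[x]pres_piK -[y]pres_piK.
by rewrite -[LHS]/(pres_scale _ (pres_add _ _)) -[RHS]/(pres_add _ _)
  -!piE' scalerDr.
Qed.
Lemma pres_scaleDl x : {morph pres_scale^~ x : a b / a + b}.
Proof.
move=> a b; rewrite -[x]pres_piK.
by rewrite -[RHS]/(pres_add _ _) -!piE' scalerDl.
Qed.

HB.instance Definition _ := GRing.Zmodule_isLmodule.Build K Q
  pres_scaleA pres_scale1 pres_scaleDr pres_scaleDl.

Lemma pres_scaleAl a (x y : Q) : a *: (x * y) = a *: x * y.
Proof.
rewrite -[x]pres_piK -[y]pres_piK.
by rewrite -[LHS]/(pres_scale _ (pres_mul _ _)) -[RHS]/(pres_mul (pres_scale _ _) _)
  -!piE' scalerAl.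
Qed.

HB.instance Definition _ := GRing.Lmodule_isLalgebra.Build K Q pres_scaleAl.

Lemma pres_scaleAr a (x y : Q) : a *: (x * y) = x * (a *: y).
Proof.
rewrite -[x]pres_piK -[y]pres_piK.
rewrite -[LHS]/(pres_scale _ (pres_mul _ _)) -[RHS]/(pres_mul _ (pres_scale _ _)).
by rewrite -!piE' -!mul_malgC mulrA malgC_comm mulrA.
Qed.

HB.instance Definition _ := GRing.Lalgebra_isAlgebra.Build K Q pres_scaleAr.

Lemma pres_pi_is_zmod_morphism : zmod_morphism pres_pi.
Proof. by move=> x y; rewrite pres_piD pres_piN. Qed.
HB.instance Definition _ :=
  GRing.isZmodMorphism.Build A Q pres_pi pres_pi_is_zmod_morphism.

Lemma pres_pi_is_monoid_morphism : monoid_morphism pres_pi.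
Proof. by split; [exact: erefl|exact: pres_piM]. Qed.
HB.instance Definition _ :=
  GRing.isMonoidMorphism.Build A Q pres_pi pres_pi_is_monoid_morphism.

HB.instance Definition _ := GRing.isScalable.Build K A Q *:%R pres_pi pres_piZ.

Lemma pres_ind (P : Q -> Prop) :
  P 1 -> (forall x y, P x -> P y -> P (x + y)) ->
  (forall a x, P x -> P (a *: x)) -> (forall g x, P x -> P (pres_gen g * x)) ->
  forall x, P x.
Proof.
move=> P1 PD PZ PM x; rewrite -[x]pres_piK (monalgE (repr x)) raddf_sum.
elim/big_ind: _ => [||m _]; [by rewrite -(scale0r 1); apply: PZ|exact: PD|].
have -> : << (repr x)@_m *g m >> = (repr x)@_m *: << m >> :> A.
  by apply/malgP => k; rewrite mcoeffZ !mcoeffU mulrnAr mulr1.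
rewrite /= linearZ; apply: PZ; case: m; elim=> [|g s IHs].
  by rewrite -fmoneE -[X in P X]/(pres_pi 1) rmorph1.
have -> : << FMonom (g :: s) >> = free_gen K g * << FMonom s >> :> A.
  by rewrite malgM_def fgmulUU mulr1 /mmul /= /mul /= fmmulE fmuE.
by rewrite rmorphM; apply: PM.
Qed.

End Presentation.

Section FreeLift.
Variables (K : fieldType) (X : choiceType) (B : algType K) (h : X -> B).

Definition fmonom_eval (m : {fmonom X}) : B := \prod_(x <- (m : seq X)) h x.

Lemma fmonom_eval_mmorphism : mmorphism fmonom_eval.
Proof.
split=> [x y|]; first by rewrite /fmonom_eval fmM big_cat.
by rewrite /fmonom_eval fm1 big_nil.
Qed.
HB.instance Definition _ :=
  isMultiplicative.Build {fmonom X} B fmonom_eval fmonom_eval_mmorphism.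

Definition free_lift : free_alg K X -> B := mmap (in_alg B) fmonom_eval.

Lemma free_lift_gen x : free_lift (free_gen K x) = h x.
Proof. by rewrite /free_lift mmapU [_ 1]scale1r mul1r /fmonom_eval fmU big_seq1. Qed.

Lemma free_lift_is_zmod_morphism : zmod_morphism free_lift.
Proof. exact: mmap_is_additive. Qed.
HB.instance Definition _ := GRing.isZmodMorphism.Build (free_alg K X) B free_lift
  free_lift_is_zmod_morphism.

Lemma free_lift_is_monoid_morphism : monoid_morphism free_lift.
Proof.
have c (g : free_alg K X) m m' : GRing.comm (in_alg B g@_m) (fmonom_eval m').
  by rewrite /GRing.comm mulr_algl mulr_algr.
by have [] := @commr_mmap_is_multiplicative _ K B (in_alg B) fmonom_eval c.
Qed.
HB.instance Definition _ :=
  GRing.isMonoidMorphism.Build (free_alg K X) B free_lift free_lift_is_monoid_morphism.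

Lemma free_lift_is_scalable : scalable free_lift.
Proof. by move=> a x; rewrite /free_lift mmapZ mulr_algl. Qed.
HB.instance Definition _ :=
  GRing.isScalable.Build K (free_alg K X) B *:%R free_lift free_lift_is_scalable.

Section Ideal.
Variable rels : free_alg K X -> free_alg K X -> Prop.
Hypothesis hr : forall x y, rels x y -> free_lift x = free_lift y.

Lemma free_lift_ideal x : rel_ideal rels x -> free_lift x = 0.
Proof.
elim=> [a y z b /hr e||y z _ hy _ hz]; last by rewrite rmorphD /= hy hz addr0.
- by rewrite !rmorphM rmorphB /= e subrr mulr0 mul0r.
- exact: rmorph0.
Qed.

Lemma free_lift_proper : ~ rel_ideal rels 1.
Proof.
by move=> /free_lift_ideal; rewrite rmorph1 => /eqP; rewrite oner_eq0.
Qed.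

Variable proper : ~ rel_ideal rels 1.

Local Notation Q := (pres_alg proper).

Definition pres_lift (x : Q) : B := free_lift (repr x).

Lemma pres_lift_pi x : pres_lift (pres_pi proper x) = free_lift x.
Proof.
apply/subr0_eq; rewrite -rmorphB.
exact/free_lift_ideal/pres_repr.
Qed.

Lemma pres_lift_gen x : pres_lift (pres_gen proper x) = h x.
Proof. by rewrite pres_lift_pi free_lift_gen. Qed.

Lemma pres_lift_is_zmod_morphism : zmod_morphism pres_lift.
Proof.
move=> x y; rewrite -[x]pres_piK -[y]pres_piK -raddfB !pres_lift_pi.
exact: rmorphB.
Qed.
HB.instance Definition _ :=
  GRing.isZmodMorphism.Build Q B pres_lift pres_lift_is_zmod_morphism.

Lemma pres_lift_is_monoid_morphism : monoid_morphism pres_lift.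
Proof.
split=> [|x y]; first by rewrite -(rmorph1 (pres_pi proper)) pres_lift_pi rmorph1.
by rewrite -[x]pres_piK -[y]pres_piK -rmorphM !pres_lift_pi; exact: rmorphM.
Qed.
HB.instance Definition _ :=
  GRing.isMonoidMorphism.Build Q B pres_lift pres_lift_is_monoid_morphism.

Lemma pres_lift_is_scalable : scalable pres_lift.
Proof.
by move=> a x; rewrite -[x]pres_piK -linearZ !pres_lift_pi; exact: linearZ.
Qed.
HB.instance Definition _ :=
  GRing.isScalable.Build K Q B *:%R pres_lift pres_lift_is_scalable.

End Ideal.
End FreeLift.

(* Ordinals start at 0 while the mathematical indices start at 1: here and in
   the Hecke algebra, the ordinal [i] stands for the index [i.+1]. *)
Inductive Um_gen (n : nat) : Type :=
| UE of 'I_n.-1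
| UF of 'I_n.-1
| UH of 'I_n
| UHinv of 'I_n
| UT
| UJ of bool. (* [true] for J_+, [false] for J_- *)
Arguments UT {n}.
Arguments UJ {n} _.

HB.instance Definition _ n := gen_eqMixin (Um_gen n).
HB.instance Definition _ n := gen_choiceMixin (Um_gen n).

Definition qserre (K : fieldType) (v : K) (A : lalgType K) (x y : A) : A :=
  x ^+ 2 * y - (v + v^-1) *: (x * y * x) + y * x ^+ 2.

Section UmRelations.
Variables (K : fieldType) (v : K) (n : nat).
Variables (A : lalgType K) (g : Um_gen n -> A).
Local Notation E i := (g (UE i)).
Local Notation F i := (g (UF i)).
Local Notation H a := (g (UH a)).
Local Notation Hinv a := (g (UHinv a)).
Local Notation T := (g UT).
Local Notation J e := (g (UJ e)).

Inductive Um_rel : A -> A -> Prop :=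
| Um_J1 : Um_rel (J true + J false) 1
| Um_JJ e f : Um_rel (J e * J f) (if e == f then J e else 0)
| Um_JH e a : Um_rel (J e * H a) (H a * J e)
| Um_JE e i : Um_rel (J e * E i) (E i * J e)
| Um_FJ e i : Um_rel (F i * J e) (J e * F i)
| Um_JT e : Um_rel (J e * T) (T * J (~~ e))
| Um_HH a b : Um_rel (H a * H b) (H b * H a)
| Um_HHinv a : Um_rel (H a * Hinv a) 1
| Um_HinvH a : Um_rel (Hinv a * H a) 1
| Um_HE (a : 'I_n) (i : 'I_n.-1) :
    Um_rel (H a * E i)
           (v ^ ((a == i :> nat)%:Z - (a == i.+1 :> nat)%:Z) *: (E i * H a))
| Um_HF (a : 'I_n) (i : 'I_n.-1) :
    Um_rel (H a * F i)
           (v ^ (- (a == i :> nat)%:Z + (a == i.+1 :> nat)%:Z) *: (F i * H a))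
| Um_HT a : Um_rel (H a * T) (T * H a)
| Um_EF_eq (i : 'I_n.-1) (a b : 'I_n) of a = i :> nat & b = i.+1 :> nat :
    Um_rel (E i * F i - F i * E i)
           ((v - v^-1)^-1 *: (H a * Hinv b - Hinv a * H b))
| Um_EF_neq i j of i != j : Um_rel (E i * F j - F j * E i) 0
| Um_EE (i j : 'I_n.-1) of (i.+1 < j)%N || (j.+1 < i)%N :
    Um_rel (E i * E j) (E j * E i)
| Um_FF (i j : 'I_n.-1) of (i.+1 < j)%N || (j.+1 < i)%N :
    Um_rel (F i * F j) (F j * F i)
| Um_serreE (i j : 'I_n.-1) of (i.+1 == j)%N || (j.+1 == i)%N :
    Um_rel (qserre v (E i) (E j)) 0
| Um_serreF (i j : 'I_n.-1) of (i.+1 == j)%N || (j.+1 == i)%N :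
    Um_rel (qserre v (F i) (F j)) 0
| Um_TE (i : 'I_n.-1) of (i.+2 < n)%N : Um_rel (T * E i) (E i * T)
| Um_TF (i : 'I_n.-1) of (i.+2 < n)%N : Um_rel (T * F i) (F i * T)
| Um_serreET (i : 'I_n.-1) of i.+2 = n : Um_rel (qserre v (E i) T) 0
| Um_serreFT (i : 'I_n.-1) of i.+2 = n : Um_rel (qserre v (F i) T) 0
| Um_serreTE (i : 'I_n.-1) of i.+2 = n : Um_rel (qserre v T (E i)) (E i)
| Um_serreTF (i : 'I_n.-1) of i.+2 = n : Um_rel (qserre v T (F i)) (F i).

End UmRelations.

Section HeckeRelations.
Variables (K : fieldType) (v : K) (d : nat).
Variables (A : lalgType K) (tau : 'I_d -> A).

Inductive Hd_rel : A -> A -> Prop :=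
| Hd_quad i : Hd_rel (tau i ^+ 2) ((v ^+ 2 - 1) *: tau i + v ^+ 2 *: 1)
| Hd_braid (j k : 'I_d) of k = j.+1 :> nat & (k.+1 < d)%N :
    Hd_rel (tau j * tau k * tau j) (tau k * tau j * tau k)
| Hd_comm (i j : 'I_d) of (j.+1 < i)%N & (i.+1 < d)%N :
    Hd_rel (tau i * tau j) (tau j * tau i)
| Hd_comm_last (t l : 'I_d) of t.+1 = d & l.+3 <> d :
    Hd_rel (tau t * tau l) (tau l * tau t)
| Hd_braid_last (t l : 'I_d) of t.+1 = d & l.+3 = d :
    Hd_rel (tau t * tau l * tau t) (tau l * tau t * tau l).

End HeckeRelations.

Section RelationTransport.
Variables (K : fieldType) (v : K) (A B : lalgType K) (phi : {lrmorphism A -> B}).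
Let phi0 : phi 0 = 0. Proof. exact: rmorph0. Qed.
Let phi1 : phi 1 = 1. Proof. exact: rmorph1. Qed.
Let phiD x y : phi (x + y) = phi x + phi y. Proof. exact: rmorphD. Qed.
Let phiN x : phi (- x) = - phi x. Proof. exact: rmorphN. Qed.
Let phiM x y : phi (x * y) = phi x * phi y. Proof. exact: rmorphM. Qed.
Let phiZ a x : phi (a *: x) = a *: phi x. Proof. exact: linearZ. Qed.
Let phiE := (phi0, phi1, phiZ, phiD, phiN, phiM, expr2).

Lemma Um_rel_morph n (g : Um_gen n -> A) x y :
  Um_rel v g x y -> Um_rel v (phi \o g) (phi x) (phi y).
Proof.
pose g' := phi \o g; have gE z : phi (g z) = g' z by [].
have qE a b : phi (qserre v a b) = qserre v (phi a) (phi b).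
  by rewrite /qserre !phiE.
by case=> *; rewrite ?qE ?phiE ?(fun_if phi) ?phiE ?gE; constructor.
Qed.

Lemma Hd_rel_morph d (g : 'I_d -> A) x y :
  Hd_rel v g x y -> Hd_rel v (phi \o g) (phi x) (phi y).
Proof.
pose g' := phi \o g; have gE z : phi (g z) = g' z by [].
by case=> *; rewrite ?phiE -?[_ * _]expr2 ?gE -?expr2; constructor.
Qed.

End RelationTransport.

Section Algebras.
Variables (K : fieldType) (v : K).

Lemma Um_proper n : ~ rel_ideal (Um_rel v (@free_gen K (Um_gen n))) 1.
Proof.
pose h (x : Um_gen n) : K^o :=
  match x with UH _ | UHinv _ => 1 | UJ e => e%:R | _ => 0 end.
apply: (@free_lift_proper _ _ _ h) => x y /(Um_rel_morph (free_lift h)).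
have -> : free_lift h \o @free_gen K _ = h.
  by apply/funext => z; exact: free_lift_gen.
suff hK (a b : K^o) : Um_rel v h a b -> a = b by move=> /hK.
case=> * /=.
all: rewrite /qserre ?expr0n ?(mulr1, mulr0, mul0r, subrr, scaler0, addr0) //=.
- by repeat match goal with b : bool |- _ => destruct b end;
    rewrite /= ?(mulr0, mul0r, mulr1).
- by rewrite mul1r.
Qed.

Definition Um n := pres_alg (@Um_proper n).
Definition um n (x : Um_gen n) : Um n := pres_gen (@Um_proper n) x.

Lemma Hd_proper d : ~ rel_ideal (Hd_rel v (@free_gen K 'I_d)) 1.
Proof.
pose h (x : 'I_d) : K^o := v ^+ 2.
apply: (@free_lift_proper _ _ _ h) => x y /(Hd_rel_morph (free_lift h)).
have -> : free_lift h \o @free_gen K _ = h.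
  by apply/funext => z; exact: free_lift_gen.
suff hK (a b : K^o) : Hd_rel v h a b -> a = b by move=> /hK.
case=> *; rewrite /h //.
by rewrite expr2 /GRing.scale /= mulr1 mulrBl mul1r subrK.
Qed.

Definition Hd d := pres_alg (@Hd_proper d).
Definition hd d (i : 'I_d) : Hd d := pres_gen (@Hd_proper d) i.

End Algebras.

Section TensorSpace.
Variables (K : fieldType) (v : K) (n d : nat).

(* The letter [x : 'I_n.*2.+1] stands for [x.+1] in [1, 2n+1]: the involution
   [r |-> 2n+2-r] is [rev_ord] and the letter n+1 is the ordinal of value [n]. *)
Definition word := {ffun 'I_d -> 'I_n.*2.+1}.
Definition xword := {ffun 'I_(d + d) -> 'I_n.*2.+1}.

(* [xword_of r] is the extension of [r] by r_{2d+1-i} = 2n+2-r_i. *)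
Definition xword_of (r : word) : xword :=
  [ffun p => match split p with
             | inl j => r j
             | inr j => rev_ord (r (rev_ord j))
             end].
Definition word_of (R : xword) : word := [ffun j => R (lshift d j)].

Definition letter (R : xword) p : nat := (R p).+1.
Definition mult (i : nat) (R : xword) : nat := (\sum_p (letter R p == i))%N.
Definition mult_before (i : nat) (R : xword) (p : 'I_(d + d)) : nat :=
  (\sum_(j < d + d | j < p) (letter R j == i))%N.
Definition mult_after (i : nat) (R : xword) (p : 'I_(d + d)) : nat :=
  (\sum_(j < d + d | p < j) (letter R j == i))%N.

(* [raise R p] is r'_p and [lower R p] is r''_p; they are only used where the
   new letters stay in range. *)
Definition raise (R : xword) p : xword :=
  [ffun q => if q == p then inord (R q).+1
             else if q == rev_ord p then inord (R q).-1 else R q].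
Definition lower (R : xword) p : xword :=
  [ffun q => if q == p then inord (R q).-1
             else if q == rev_ord p then inord (R q).+1 else R q].

(* The d-th tensor power of V is the space with basis the words [vec r]; that of
   W is the span [Wd] of the words avoiding the letter n+1. *)
Definition Vd := {ffun word -> K^o}.
Definition vec (r : word) : Vd := [ffun s => (s == r)%:R].

Definition no_mid (r : word) := [forall j, (r j).+1 != n.+1].
Definition Wd : {vspace Vd} := <<[seq vec r | r in no_mid]>>%VS.

Definition extend (f : word -> Vd) (w : Vd) : Vd := \sum_r (w r : K) *: f r.

Definition opE i : Vd -> Vd := extend (fun r =>
  let R := xword_of r in
  v ^- mult i.+1 R *: \sum_(p | letter R p == i)
    v ^+ (2 * mult_before i.+1 R p) *: vec (word_of (raise R p))).
Definition opF i : Vd -> Vd := extend (fun r =>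
  let R := xword_of r in
  v ^- mult i R *: \sum_(p | letter R p == i.+1)
    v ^+ (2 * mult_after i R p) *: vec (word_of (lower R p))).
Definition opH a : Vd -> Vd :=
  extend (fun r => v ^- mult a (xword_of r) *: vec r).
Definition opHinv a : Vd -> Vd :=
  extend (fun r => v ^+ mult a (xword_of r) *: vec r).
Definition opJ (e : bool) : Vd -> Vd := extend (fun r =>
  if no_mid r && (odd #|[set j | (n.+1 <= (r j).+1)%N]| == ~~ e)
  then vec r else 0).
Definition opT (w : Vd) : Vd :=
  opF n (opE n w) +
  (v - v^-1)^-1 *: (opH n (opHinv n.+1 w) - opHinv n (opH n.+1 w)).

Definition word_swap (r : word) (j k : 'I_d) : word := [ffun q => r (tperm j k q)].
Definition word_swap_rev (r : word) (j k : 'I_d) : word :=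
  [ffun q => if q == j then rev_ord (r k)
             else if q == k then rev_ord (r j) else r q].

(* [tau_rule x y r rs] is v_{rs}, v^2 v_r or (v^2-1) v_r + v^2 v_{rs} according
   as x < y, x = y or x > y. *)
Definition tau_rule (x y : nat) (r rs : word) : Vd :=
  if (x < y)%N then vec rs
  else if x == y then v ^+ 2 *: vec r
  else (v ^+ 2 - 1) *: vec r + v ^+ 2 *: vec rs.

(* [ordS] and [ord_pred] are the cyclic successor and predecessor in ['I_d];
   neither wraps around below when d >= 2. *)
Definition opTau (t : 'I_d) : Vd -> Vd := extend (fun r =>
  if t.+1 == d then
    let s := ord_pred t in
    tau_rule ((r s).+1 + (r t).+1) n.*2.+2 r (word_swap_rev r s t)
  else
    let s := ordS t in
    tau_rule (r t) (r s) r (word_swap r t s)).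

End TensorSpace.

Section Actions.
Variables (K : fieldType) (A : algType K) (M : vectType K).

Definition left_action (rho : A -> 'End(M)) : Prop :=
  [/\ linear rho, rho 1 = \1%VF & forall a b, rho (a * b) = (rho a \o rho b)%VF].

Definition right_action (sigma : A -> 'End(M)) : Prop :=
  [/\ linear sigma, sigma 1 = \1%VF
    & forall a b, sigma (a * b) = (sigma b \o sigma a)%VF].

(* [f] belongs to End_A(M); the same condition serves for left and right
   actions. *)
Definition equivariant (rho : A -> 'End(M)) (f : 'End(M)) : Prop :=
  forall a m, f (rho a m) = rho a (f m).

End Actions.

Section WdActions.
Variables (K : fieldType) (v : K) (n d : nat).
Local Notation W := (subvs_of (Wd K n d)).

(* [g] is the restriction to the subspace of the operator [f]. *)
Definition restricts (g : 'End(W)) (f : Vd K n d -> Vd K n d) : Prop :=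
  forall w : W, vsval (g w) = f (vsval w).

Definition is_Um_action (rho : Um v n -> 'End(W)) : Prop :=
  left_action rho /\
  [/\ forall i : 'I_n.-1, restricts (rho (um v (UE i))) (opE v i.+1)
        /\ restricts (rho (um v (UF i))) (opF v i.+1),
      forall a : 'I_n, restricts (rho (um v (UH a))) (opH v a.+1)
        /\ restricts (rho (um v (UHinv a))) (opHinv v a.+1),
      forall e, restricts (rho (um v (UJ e))) (opJ e)
    & restricts (rho (um v UT)) (@opT K v n d)].

Definition is_Hd_action (sigma : Hd v d -> 'End(W)) : Prop :=
  right_action sigma /\ forall t, restricts (sigma (hd v t)) (opTau v t).

End WdActions.

(* The field Q(v) and its variable. *)
Definition Qv : fieldType := {fraction {poly rat}}.
Definition qv : Qv := tofrac 'X.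

(* Main.v *)
Require Import Defs.
From HB Require Import structures.
From mathcomp Require Import all_boot all_order all_algebra.
From mathcomp Require Import perm boolp monalg.
From mathcomp Require Import zify ring.

(* W^{⊗d} is identified with functions on words in signed letters, a letter
   c <= n being (+, c) and 2n+2-c being (-, c).  Reading off the first letter
   turns E_i, F_i, T into recursions on the word, so that the relations of U^m
   and the commutation with the Hecke algebra follow by induction on d; tau_d
   is tau_{d-1} conjugated by the sign change of the last letter.

   Let d <= n and let r0 be the increasing word in the letters n-d+1, ..., n.
   Sorting by descents shows that v_{r0} H is the whole weight space of r0 (with
   even parity), and an exchange argument on descents shows that h |-> v_{r0} h
   is injective.  Each v_{r0} tau_j is b v_{r0} for some b in U^m (F_a E_a swaps
   two adjacent letters, T flips the sign of a letter n), so v_{r0} H is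
   contained in U^m v_{r0}.
   The weight idempotents p_s are images of elements of U^m, by Lagrange
   interpolation in the H_a.  Moving letters one at a time with E_a, F_a and T
   gives p_s = x p_{r0} y with x, y in U^m, whence W^{⊗d} = U^m v_{r0}.
   An endomorphism f commuting with U^m is determined by f(v_{r0}), which lies in
   p_{r0} W^{⊗d} = v_{r0} H, so f is right multiplication by some h.  If f
   commutes with H, then (f x) v_{r0} = b v_{r0} for some b in U^m, hence
   f p_s = (f x) p_{r0} y = b p_{r0} y, and f is the sum of the f p_s. *)

(** Operators are computed on coordinate functions, hence in transposed form: the coordinate of
    [E_a w] at a word collects the words from which it arises. At [x :: s] every operator becomes a
    combination of operators at [s], with powers of v and the H_a as the only carry, so under the
    induction hypothesis each relation of U^m is a finite identity of rational functions in v. The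
    obstacle is T, whose definition leaves W through the letter n+1. On W its recursion closes up
    nevertheless, because the Cartan term absorbs the part of F_n E_n that returns to the letter it
    started from.

    Since H_d is given by generators and relations, injectivity needs an upper bound on H_d: a
    spanning set indexed by the words reached from r0. Its elements are built along with the words;
    that they are well defined uses only the relations between two generators. As d <= n, the levels
    of r0 are distinct, so a generator never fixes a reached word.

    That v is not a root of unity is used twice: to separate the weights v^k, and to invert the
    quantum integers [m] by which F_a E_a or E_a F_a acts where a neighbouring level is empty. *)

Set Implicit Arguments.
Unset Strict Implicit.
Unset Printing Implicit Defensive.
Import GRing.Theory.
Local Open Scope ring_scope.

(** * Signed words and the relations of U^m *)

(* [(true, c)] stands for the letter [c] and [(false, c)] for [2n-c], with [c < n]. *)
Definition sletter := (bool * nat)%type.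
Definition sfun (K : fieldType) := seq sletter -> K.

Ltac nat_case :=
  match goal with |- context [@eq_op ?T ?x ?y] =>
    lazymatch type of x with nat =>
    first [ rewrite (_ : (x == y) = true); [|by lia]
          | rewrite (_ : (x == y) = false); [|by lia]
          | let H := fresh "ne" in have [H|H] := eqVneq x y; [try subst|] ]
    end
  end.
Ltac nat_cases := repeat (nat_case; cbv iota).

Section SignedWords.
Variables (K : fieldType) (v : K).
Local Notation F := (sfun K).
Implicit Types (w f g : F) (s : seq sletter) (b : bool) (a c t : nat).

Definition sgnv b : K := if b then v else v^-1.

Definition slice (x : sletter) w : F := fun s => w (x :: s).
Definition comb (k : K) f (l : K) g : F := fun s => k * f s + l * g s.
Definition scal (k : K) f : F := fun s => k * f s.

Definition level a s := count (fun x : sletter => x.2 == a) s.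
(** [true] gives H_a and [false] its inverse. In the extended word each of the letters (+, a) and
    (-, a) accounts for exactly one occurrence of the letter a, so the sign does not affect the
    weight. *)
Definition sH b a w : F := fun s => sgnv (~~ b) ^+ level a s * w s.

(* The coordinates of [E_a w], [F_a w] and [T w] at a word, by recursion on its
   first letter; the factor [1] puts the right-hand sides in the form [comb]. *)
Fixpoint sE a w s {struct s} : K :=
  if s is (b, c) :: s' then
    if c == a.+1 then sgnv b * sE a (slice (b, c) w) s' +
                      1 * sH b a.+1 (slice (b, a) w) s'
    else sE a (slice (b, c) w) s'
  else 0.

Fixpoint sF a w s {struct s} : K :=
  if s is (b, c) :: s' then
    if c == a then sgnv (~~ b) * sF a (slice (b, c) w) s' +
                   1 * sH (~~ b) a (slice (b, a.+1) w) s'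
    else sF a (slice (b, c) w) s'
  else 0.

Fixpoint sT t w s {struct s} : K :=
  if s is (b, c) :: s' then
    if c == t then sgnv (~~ b) * sT t (slice (b, c) w) s' +
                   1 * sH (~~ b) t (slice (~~ b, c) w) s'
    else sT t (slice (b, c) w) s'
  else 0.

Definition sJ (e : bool) w : F :=
  fun s => if odd (count (fun x : sletter => ~~ x.1) s) == ~~ e then w s else 0.

Lemma sliceE x w s : w (x :: s) = slice x w s. Proof. by []. Qed.
Lemma slice_comb x k f l g :
  slice x (comb k f l g) = comb k (slice x f) l (slice x g).
Proof. by []. Qed.
Lemma slice_scal x k f : slice x (scal k f) = scal k (slice x f).
Proof. by []. Qed.

Lemma slice_H b a b' c w :
  slice (b', c) (sH b a w) =
  if c == a then scal (sgnv (~~ b)) (sH b a (slice (b', c) w))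
  else sH b a (slice (b', c) w).
Proof.
by apply/funext => s; rewrite /slice /scal /sH /level /= ; case: (c == a); rewrite /= ?exprS ?mulrA.
Qed.

Lemma slice_E a b c w :
  slice (b, c) (sE a w) =
  if c == a.+1 then comb (sgnv b) (sE a (slice (b, c) w)) 1
                         (sH b a.+1 (slice (b, a) w))
  else sE a (slice (b, c) w).
Proof. by apply/funext => s; rewrite {1}/slice /=; case: (c == _). Qed.

Lemma slice_F a b c w :
  slice (b, c) (sF a w) =
  if c == a then comb (sgnv (~~ b)) (sF a (slice (b, c) w)) 1
                      (sH (~~ b) a (slice (b, a.+1) w))
  else sF a (slice (b, c) w).
Proof. by apply/funext => s; rewrite {1}/slice /=; case: (c == _). Qed.

Lemma slice_T t b c w :
  slice (b, c) (sT t w) =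
  if c == t then comb (sgnv (~~ b)) (sT t (slice (b, c) w)) 1
                      (sH (~~ b) t (slice (~~ b, c) w))
  else sT t (slice (b, c) w).
Proof. by apply/funext => s; rewrite {1}/slice /=; case: (c == _). Qed.

Lemma slice_J e b c w :
  slice (b, c) (sJ e w) = sJ (if b then e else ~~ e) (slice (b, c) w).
Proof.
apply/funext => s; rewrite /slice /sJ /= oddD.
by case: b; case: e => /=; case: (odd _).
Qed.

Lemma sH_comb b a k f l g : sH b a (comb k f l g) = comb k (sH b a f) l (sH b a g).
Proof. by apply/funext => s; rewrite /comb /sH; ring. Qed.
Lemma sH_scal b a k f : sH b a (scal k f) = scal k (sH b a f).
Proof. by apply/funext => s; rewrite /scal /sH; ring. Qed.
Lemma sJ_comb e k f l g : sJ e (comb k f l g) = comb k (sJ e f) l (sJ e g).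
Proof. by apply/funext => s; rewrite /comb /sJ; case: ifP => _ //; ring. Qed.
Lemma sJ_scal e k f : sJ e (scal k f) = scal k (sJ e f).
Proof. by apply/funext => s; rewrite /scal /sJ; case: ifP => _ //; ring. Qed.

Lemma scal_comb k f : scal k f = comb k f 0 f.
Proof. by apply/funext => s; rewrite /scal /comb; ring. Qed.

Lemma sE_comb a k f l g : sE a (comb k f l g) = comb k (sE a f) l (sE a g).
Proof.
apply/funext => s; elim: s f g => [|[b c] s IH] f g /=; first by rewrite /comb /=; ring.
by rewrite /comb /= !slice_comb !IH !sH_comb /comb; case: (c == _) => //; ring.
Qed.
Lemma sE_scal a k f : sE a (scal k f) = scal k (sE a f).
Proof. by rewrite !scal_comb sE_comb. Qed.
Lemma sF_comb a k f l g : sF a (comb k f l g) = comb k (sF a f) l (sF a g).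
Proof.
apply/funext => s; elim: s f g => [|[b c] s IH] f g /=; first by rewrite /comb /=; ring.
by rewrite /comb /= !slice_comb !IH !sH_comb /comb; case: (c == _) => //; ring.
Qed.
Lemma sF_scal a k f : sF a (scal k f) = scal k (sF a f).
Proof. by rewrite !scal_comb sF_comb. Qed.
Lemma sT_comb a k f l g : sT a (comb k f l g) = comb k (sT a f) l (sT a g).
Proof.
apply/funext => s; elim: s f g => [|[b c] s IH] f g /=; first by rewrite /comb /=; ring.
by rewrite /comb /= !slice_comb !IH !sH_comb /comb; case: (c == _) => //; ring.
Qed.
Lemma sT_scal a k f : sT a (scal k f) = scal k (sT a f).
Proof. by rewrite !scal_comb sT_comb. Qed.

Definition lin_rules := (slice_comb, slice_scal, sH_comb, sH_scal, sE_comb, sE_scal,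
  sF_comb, sF_scal, sT_comb, sT_scal, sJ_comb, sJ_scal).

Ltac slices :=
  repeat first [rewrite !lin_rules | rewrite slice_H | rewrite slice_E
               | rewrite slice_F | rewrite slice_T | nat_case; cbv iota].

Hypothesis v0 : v != 0.

Lemma sgnvN b : sgnv (~~ b) = (sgnv b)^-1.
Proof. by case: b; rewrite /= ?invrK. Qed.
Lemma sgnv0 b : sgnv b != 0.
Proof. by case: b; rewrite /= ?invr_eq0. Qed.

Lemma sHH b a b' a' w : sH b a (sH b' a' w) = sH b' a' (sH b a w).
Proof. by apply/funext => s; rewrite /sH; ring. Qed.
Lemma sHK b a w : sH b a (sH (~~ b) a w) = w.
Proof.
apply/funext => s; rewrite /sH mulrA -exprMn negbK sgnvN mulVf ?expr1n ?mul1r //.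
exact: sgnv0.
Qed.

Lemma sHE b a i w : sH b a (sE i w) =
  scal (if a == i then sgnv b else if a == i.+1 then sgnv (~~ b) else 1) (sE i (sH b a w)).
Proof.
apply/funext => s; elim: s w => [|[b' c] s IH] w; first by rewrite /scal /sH /=; ring.
rewrite /scal 2![_ (_ :: _)]sliceE /=.
slices; rewrite /comb /scal ?IH; nat_cases; rewrite /scal ?[sH b _ (sH b' _ _)]sHH ?sgnvN;
try by [|field; rewrite ?sgnv0].
Qed.

Lemma sHF b a i w : sH b a (sF i w) =
  scal (if a == i then sgnv (~~ b) else if a == i.+1 then sgnv b else 1) (sF i (sH b a w)).
Proof.
apply/funext => s; elim: s w => [|[b' c] s IH] w; first by rewrite /scal /sH /=; ring.
rewrite /scal 2![_ (_ :: _)]sliceE /=.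
slices; rewrite /comb /scal ?IH; nat_cases; rewrite /scal ?[sH b _ (sH (~~ b') _ _)]sHH ?sgnvN;
try by [|field; rewrite ?sgnv0].
Qed.

Lemma sHT b a t w : sH b a (sT t w) = sT t (sH b a w).
Proof.
apply/funext => s; elim: s w => [|[b' c] s IH] w; first by rewrite /scal /sH /=; ring.
rewrite 2![_ (_ :: _)]sliceE /=.
slices; rewrite /comb /scal ?IH; nat_cases; rewrite /scal ?[sH b _ (sH (~~ b') _ _)]sHH ?sgnvN;
try by [|field; rewrite ?sgnv0].
Qed.

Lemma sJH e b a w : sJ e (sH b a w) = sH b a (sJ e w).
Proof. by apply/funext => s; rewrite /sJ /sH; case: ifP => _ //; ring. Qed.

Lemma sJE e i w : sJ e (sE i w) = sE i (sJ e w).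
Proof.
apply/funext => s; elim: s e w => [|[b c] s IH] e w; first by rewrite /sJ /=; case: ifP.
rewrite 2![_ (_ :: _)]sliceE slice_J.
by slices; rewrite ?slice_J ?lin_rules /comb ?IH ?sJH.
Qed.

Lemma sJF e i w : sJ e (sF i w) = sF i (sJ e w).
Proof.
apply/funext => s; elim: s e w => [|[b c] s IH] e w; first by rewrite /sJ /=; case: ifP.
rewrite 2![_ (_ :: _)]sliceE slice_J.
by slices; rewrite ?slice_J ?lin_rules /comb ?IH ?sJH.
Qed.

Lemma sJT e t w : sJ e (sT t w) = sT t (sJ (~~ e) w).
Proof.
apply/funext => s; elim: s e w => [|[b c] s IH] e w; first by rewrite /sJ /=; case: ifP.
rewrite 2![_ (_ :: _)]sliceE slice_J.
by slices; rewrite ?slice_J ?lin_rules /comb ?IH ?sJH; case: b; rewrite /= ?negbK.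
Qed.

Lemma sJ1 w : comb 1 (sJ true w) 1 (sJ false w) = w.
Proof. by apply/funext => s; rewrite /comb /sJ; case: (odd _) => /=; ring. Qed.

Lemma sJJ e e' w : sJ e (sJ e' w) = if e == e' then sJ e w else scal 0 w.
Proof.
by apply/funext => s; rewrite /scal /sJ; case: e; case: e'; rewrite /= ?mul0r /sJ; case: (odd _).
Qed.

(** Writes both sides at [x :: s] as combinations of operator monomials at [s]. The operators [sH]
    are moved innermost and cancelled in inverse pairs, so that equal monomials become syntactically
    equal. *)
Ltac expand :=
  rewrite ![_ (_ :: _)]sliceE; cbn [negb];
  repeat first [rewrite !lin_rules | rewrite slice_H | rewrite slice_E
               | rewrite slice_F | rewrite slice_T | rewrite sHE | rewrite sHF
               | rewrite sHT | rewrite (sHK true) | rewrite (sHK false)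
               | rewrite [sH false _ (sH true _ _)]sHH
               | nat_case; cbv iota; cbn [negb]];
  rewrite /comb /scal; cbn [negb sgnv].

Lemma sEE i j : (i.+1 < j)%N -> forall s w, sE i (sE j w) s = sE j (sE i w) s.
Proof.
move=> ij; elim=> [|[b c] s IH] w; first by rewrite /=; ring.
by case: b; expand; rewrite ?IH; try field.
Qed.

Lemma sFF i j : (i.+1 < j)%N -> forall s w, sF i (sF j w) s = sF j (sF i w) s.
Proof.
move=> ij; elim=> [|[b c] s IH] w; first by rewrite /=; ring.
by case: b; expand; rewrite ?IH; try field.
Qed.

Lemma sTE t i : (i.+1 < t)%N -> forall s w, sT t (sE i w) s = sE i (sT t w) s.
Proof.
move=> ij; elim=> [|[b c] s IH] w; first by rewrite /=; ring.
by case: b; expand; rewrite ?IH; try field.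
Qed.
Lemma sTF t i : (i.+1 < t)%N -> forall s w, sT t (sF i w) s = sF i (sT t w) s.
Proof.
move=> ij; elim=> [|[b c] s IH] w; first by rewrite /=; ring.
by case: b; expand; rewrite ?IH; try field.
Qed.

Lemma sEF_neq (i j : nat) : i != j -> forall s w, sE i (sF j w) s = sF j (sE i w) s.
Proof.
move=> ij; elim=> [|[b c] s IH] w; first by rewrite /=; ring.
by case: b; expand; rewrite ?IH; try field.
Qed.

Hypothesis v2 : v - v^-1 != 0.

Lemma sEF i : forall s w, sE i (sF i w) s - sF i (sE i w) s =
  (v - v^-1)^-1 * (sH true i (sH false i.+1 w) s - sH false i (sH true i.+1 w) s).
Proof.
elim=> [|[b c] s IH] w; first by rewrite /sH /=; ring.
have {}IH w' : sE i (sF i w') s = sF i (sE i w') s +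
 (v - v^-1)^-1 * (sH true i (sH false i.+1 w') s - sH false i (sH true i.+1 w') s).
  by rewrite -IH; ring.
(* The form that the denominator v - v^-1 takes once [field] has cleared v^-1. *)
have v3 : v * v - 1 != 0 by have := mulf_neq0 v0 v2; rewrite mulrBr mulfV.
by case: b; expand; rewrite ?IH [sH true i.+1 (sH false i _)]sHH; try by field; rewrite v0.
Qed.

Local Notation q2 := (v + v^-1).

(** This and the following cubic relations are solved for one monomial, so that the induction
    hypothesis can serve as a rewriting rule and leave an identity for [field]. *)
Lemma sSerreE_up i : forall s w,
  sE i (sE i (sE i.+1 w)) s = q2 * sE i (sE i.+1 (sE i w)) s - sE i.+1 (sE i (sE i w)) s.
Proof.
elim=> [|[b c] s IH] w; first by rewrite /=; ring.
by case: b; expand; rewrite ?IH; field.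
Qed.

Lemma sSerreE_down i : forall s w,
  sE i.+1 (sE i.+1 (sE i w)) s = q2 * sE i.+1 (sE i (sE i.+1 w)) s - sE i (sE i.+1 (sE i.+1 w)) s.
Proof.
elim=> [|[b c] s IH] w; first by rewrite /=; ring.
by case: b; expand; rewrite ?IH; field.
Qed.

Lemma sSerreF_up i : forall s w,
  sF i (sF i (sF i.+1 w)) s = q2 * sF i (sF i.+1 (sF i w)) s - sF i.+1 (sF i (sF i w)) s.
Proof.
elim=> [|[b c] s IH] w; first by rewrite /=; ring.
by case: b; expand; rewrite ?IH; field.
Qed.

Lemma sSerreF_down i : forall s w,
  sF i.+1 (sF i.+1 (sF i w)) s = q2 * sF i.+1 (sF i (sF i.+1 w)) s - sF i (sF i.+1 (sF i.+1 w)) s.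
Proof.
elim=> [|[b c] s IH] w; first by rewrite /=; ring.
by case: b; expand; rewrite ?IH; field.
Qed.

Lemma sSerreET i : forall s w,
  sE i (sE i (sT i.+1 w)) s = q2 * sE i (sT i.+1 (sE i w)) s - sT i.+1 (sE i (sE i w)) s.
Proof.
elim=> [|[b c] s IH] w; first by rewrite /=; ring.
by case: b; expand; rewrite ?IH; field.
Qed.

Lemma sSerreFT i : forall s w,
  sF i (sF i (sT i.+1 w)) s = q2 * sF i (sT i.+1 (sF i w)) s - sT i.+1 (sF i (sF i w)) s.
Proof.
elim=> [|[b c] s IH] w; first by rewrite /=; ring.
by case: b; expand; rewrite ?IH; field.
Qed.

Lemma sSerreTE i : forall s w,
  sT i.+1 (sT i.+1 (sE i w)) s =
  q2 * sT i.+1 (sE i (sT i.+1 w)) s - sE i (sT i.+1 (sT i.+1 w)) s + sE i w s.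
Proof.
elim=> [|[b c] s IH] w; first by rewrite /=; ring.
by case: b; expand; rewrite ?IH; field.
Qed.

Lemma sSerreTF i : forall s w,
  sT i.+1 (sT i.+1 (sF i w)) s =
  q2 * sT i.+1 (sF i (sT i.+1 w)) s - sF i (sT i.+1 (sT i.+1 w)) s + sF i w s.
Proof.
elim=> [|[b c] s IH] w; first by rewrite /=; ring.
by case: b; expand; rewrite ?IH; field.
Qed.

End SignedWords.

Ltac nat_order_case :=
  match goal with
  | |- context [@eq_op _ (?b, ?x) (?c, ?y)] => rewrite [(b, x) == (c, y)]xpair_eqE /=
  | |- context [@eq_op ?T ?x ?y] =>
    lazymatch type of x with nat =>
    first [ rewrite (_ : (x == y) = true); [|by lia]
          | rewrite (_ : (x == y) = false); [|by lia]
          | let H := fresh "ne" in have [H|H] := eqVneq x y; [try subst|] ]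
    end
  | |- context [leq ?x ?y] =>
    first [ rewrite (_ : (leq x y) = true); [|by lia]
          | rewrite (_ : (leq x y) = false); [|by lia]
          | let H := fresh "ne" in case H : (leq x y) ]
  end.

(** * The Hecke operators on signed words *)

Section SignedHecke.
Variables (K : fieldType) (v : K).
Local Notation F := (sfun K).
Implicit Types (w f g : F) (s : seq sletter) (b : bool) (a c t : nat).

Local Notation sE := (@sE K v).
Local Notation sF := (@sF K v).
Local Notation sH := (@sH K v).
Local Notation sT := (@sT K v).

(** The order of the letters that the pairs stand for: as (-, c) is 2n-c, the negative letters come
    last and in decreasing level. *)
Definition slt (x y : sletter) : bool :=
  match x.1, y.1 with
  | true, true => (x.2 < y.2)%N
  | true, false => true
  | false, true => false
  | false, false => (y.2 < x.2)%N
  end.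

(* On words that are too short the value is junk, chosen so that [sA0] commutes
   with the other operators and satisfies the quadratic relation everywhere. *)
Definition sA0 w : F := fun s =>
  if s is x :: y :: s' then
    if slt x y then v ^+ 2 * w (y :: x :: s')
    else if x == y then v ^+ 2 * w s
    else (v ^+ 2 - 1) * w s + 1 * w (y :: x :: s')
  else v ^+ 2 * w s.

Fixpoint sA k w s : K :=
  match k, s with
  | 0, _ => sA0 w s
  | k'.+1, x :: s' => sA k' (slice x w) s'
  | _, _ => v ^+ 2 * w s
  end.

Fixpoint flip s : seq sletter :=
  match s with
  | [::] => [::]
  | [:: x] => [:: (~~ x.1, x.2)]
  | x :: s' => x :: flip s'
  end.
Definition sS w : F := fun s => w (flip s).

Lemma slice_A0 x y w : slice y (slice x (sA0 w)) =
  if slt x y then scal (v ^+ 2) (slice x (slice y w))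
  else if x == y then scal (v ^+ 2) (slice y (slice x w))
  else comb (v ^+ 2 - 1) (slice y (slice x w)) 1 (slice x (slice y w)).
Proof.
by apply/funext => s; rewrite {1 2}/slice /=; case: (slt x y) => //; case: (x == y).
Qed.

Lemma sA_nil k w : sA k w [::] = v ^+ 2 * w [::].
Proof. by case: k. Qed.

Lemma sA0_comb k f l g : sA0 (comb k f l g) = comb k (sA0 f) l (sA0 g).
Proof.
apply/funext => -[|x [|y s]]; rewrite /comb /=; try by ring.
by case: (slt x y); [|case: (x == y)]; ring.
Qed.

Lemma sA_comb m k f l g : sA m (comb k f l g) = comb k (sA m f) l (sA m g).
Proof.
elim: m f g => [|m IH] f g; first exact: sA0_comb.
apply/funext => -[|x s] /=; first by rewrite /comb; ring.
by rewrite slice_comb IH.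
Qed.

Lemma sA_scal m k f : sA m (scal k f) = scal k (sA m f).
Proof. by rewrite !scal_comb sA_comb. Qed.

Hypothesis v0 : v != 0.

(** Exchanging two adjacent letters does not change how many letters satisfy [P], so any linear
    operation that depends on the word only through this number commutes with [sA k]. It is applied
    to powers of v (for H) and to a parity test (for J). *)
Lemma count_A (k : nat) (P : pred sletter) (X : K -> nat -> K) w s :
  (forall (c y z : K) n, X (c * y + z) n = c * X y n + X z n) ->
  (forall n, X 0 n = 0) ->
  sA k (fun s => X (w s) (count P s)) s = X (sA k w s) (count P s).
Proof.
move=> XD X0; have XZ (c y : K) n : X (c * y) n = c * X y n.
  by rewrite -[c * y]addr0 XD X0 addr0.
elim: k w P X XD X0 XZ s => [|k IH] w P X XD X0 XZ [|x s] //=.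
  by case: s => [|y s] //=; case: (slt x y);
    [|case: (x == y)]; rewrite ?mul1r ?XD ?XZ // addnCA.
pose Y u n := X u (P x + n)%N.
by rewrite -[RHS]/(Y (sA k (slice x w) s) (count P s)) -IH // => *; rewrite /Y ?XD ?X0 ?XZ.
Qed.

Lemma sA_H k b a w : sA k (sH b a w) = sH b a (sA k w).
Proof.
apply/funext => s; pose X y n := sgnv v (~~ b) ^+ n * y.
by rewrite [LHS](@count_A k (fun x => x.2 == a) X) /X // => *; ring.
Qed.

Lemma sA_J k e w : sA k (sJ e w) = sJ e (sA k w).
Proof.
apply/funext => s; pose X (y : K) n := if odd n == ~~ e then y else 0.
rewrite [LHS](@count_A k (fun x => ~~ x.1) X) // /X.
  by move=> c y z n; case: ifP => _ //; ring.
by move=> n; case: ifP.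
Qed.

Ltac expand2 :=
  rewrite ![_ (_ :: _)]sliceE; cbn [negb];
  repeat first [rewrite !lin_rules | rewrite slice_H | rewrite slice_E
               | rewrite slice_F | rewrite slice_T | rewrite slice_A0 /slt /=
               | rewrite (sHE v0) | rewrite (sHF v0)
               | rewrite (sHT v0) | rewrite (sHK v0 true) | rewrite (sHK v0 false)
               | rewrite [sH false _ (sH true _ _)]sHH
               | nat_order_case; cbv iota; cbn [negb]];
  rewrite /comb /scal; cbn [negb sgnv].

Lemma sA0_E a w : sA0 (sE a w) = sE a (sA0 w).
Proof.
apply/funext => -[|[b c] [|[b' c'] s]]; first by rewrite /= mulr0.
  by rewrite /=; case: eqP => _; rewrite /slice /sH /=; ring.
by rewrite {1}/sA0 /slt /= -/sE; case: b; case: b'; expand2; try field.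
Qed.

Lemma sA0_F a w : sA0 (sF a w) = sF a (sA0 w).
Proof.
apply/funext => -[|[b c] [|[b' c'] s]]; first by rewrite /= mulr0.
  by rewrite /=; case: eqP => _; rewrite /slice /sH /=; ring.
by rewrite {1}/sA0 /slt /= -/sF; case: b; case: b'; expand2; try field.
Qed.

(* A letter of level above [t] would lie between the two letters exchanged by [sT t]. *)
Lemma sA0_T t w s : all (fun x : sletter => x.2 <= t)%N s ->
  sA0 (sT t w) s = sT t (sA0 w) s.
Proof.
case: s => [|[b c] [|[b' c'] s]] //=; first by rewrite mulr0.
  by move=> _; case: eqP => _; rewrite /slice /sH /=; ring.
move=> /and3P[ct ct' _].
rewrite -!/(sT t _ (_ :: _)) /slt /=; case: b; case: b'; expand2; try by field.
Qed.

Lemma sA_E k a w : sA k (sE a w) = sE a (sA k w).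
Proof.
elim: k w => [|k IH] w; first exact: sA0_E.
apply/funext => -[|[b c] s] /=; first by rewrite mulr0.
rewrite slice_E; case: ifP => _; rewrite ?sA_comb IH ?sA_H //.
Qed.

Lemma sA_F k a w : sA k (sF a w) = sF a (sA k w).
Proof.
elim: k w => [|k IH] w; first exact: sA0_F.
apply/funext => -[|[b c] s] /=; first by rewrite mulr0.
rewrite slice_F; case: ifP => _; rewrite ?sA_comb IH ?sA_H //.
Qed.

Lemma sA_T k t w s : all (fun x : sletter => x.2 <= t)%N s ->
  sA k (sT t w) s = sT t (sA k w) s.
Proof.
elim: k w s => [|k IH] w s; first exact: sA0_T.
case: s => [|[b c] s] /=; first by rewrite mulr0.
move=> /andP[_ hs]; rewrite slice_T; case: ifP => _; last by rewrite IH.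
by rewrite sA_comb sA_H {1}/comb IH.
Qed.

Lemma sA_quad k w s : sA k (sA k w) s = (v ^+ 2 - 1) * sA k w s + v ^+ 2 * w s.
Proof.
elim: k w s => [|k IH] w [|[b c] s] /=; try by ring.
  case: s => [|[b' c'] s] /=; first by ring.
  rewrite /slt /=; case: b; case: b'; rewrite ?xpair_eqE /=; repeat nat_order_case => //=; try by ring.
exact: IH.
Qed.

Lemma sA_comm (k l : nat) w s : (k.+1 < l)%N -> sA k (sA l w) s = sA l (sA k w) s.
Proof.
elim: k l w s => [|k IH] [|[|l]] w s // kl; last first.
  by case: s => [|x s] /=; [|exact: (IH l.+1 (slice x w) s)].
case: s => [|x [|y s]] //=.
by rewrite slice_A0 /slice /scal /comb; case: ifP => _; rewrite -?/(scal _ _) ?sA_scal //; case: ifP => _;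
  rewrite -?/(scal _ _) -?/(comb _ _ _ _) ?sA_scal ?sA_comb.
Qed.

(** The length bound excludes the junk values: on a word of [k.+2] letters [sA k.+1] is the scalar
    v^2, and the braid relation need not hold. Peeling off letters reduces to k = 0, where the signs
    and the order of three letters are enumerated. *)
Lemma sA_braid (k : nat) w s : (k.+2 < size s)%N ->
  sA k (sA k.+1 (sA k w)) s = sA k.+1 (sA k (sA k.+1 w)) s.
Proof.
elim: k w s => [|k IH] w [|x s] //= hs; last exact: IH.
case: x s hs => b1 c1 [|[b2 c2] [|[b3 c3] s]] //= _.
by rewrite /slt /=; case: b1; case: b2; case: b3;
  rewrite ?xpair_eqE /=; repeat (nat_order_case; rewrite /slice //= ?/slt /=); try ring.
Qed.

Lemma size_flip s : size (flip s) = size s.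
Proof. by elim: s => [|x [|y s] IH] //; move: IH => /= ->. Qed.

Lemma flipK : involutive flip.
Proof.
elim=> [|[b c] [|y s] IH] //; first by rewrite /= negbK.
by rewrite -[flip (_ :: _)]/((b, c) :: flip (y :: s)) -{2}IH; case: (flip (y :: s)) (size_flip (y :: s)).
Qed.

Lemma flip_cons x s : (0 < size s)%N -> flip (x :: s) = x :: flip s.
Proof. by case: s. Qed.

Lemma sSS w : sS (sS w) = w.
Proof. by apply/funext => s; rewrite /sS flipK. Qed.

Section Local.

(** Identities such as [slice_S] and [sS_A] hold only at words that are long enough. Locality allows
    their use under another operator, which reads only words of the same length. *)
Definition local (X : F -> F) := forall w w' s,
  (forall s', size s' = size s -> w s' = w' s') -> X w s = X w' s.

Lemma local_H b a : local (sH b a).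
Proof. by move=> w w' s ww'; rewrite /sH ww'. Qed.
Lemma local_E a : local (sE a).
Proof.
move=> w w' s; elim: s w w' => [|[b c] s IH] w w' ww' //=.
case: ifP => _; last by apply: IH => s' ss; apply: ww'; rewrite /= ss.
by congr (_ * _ + _ * _); [apply: IH|apply: local_H] => s' ss; apply: ww'; rewrite /= ss.
Qed.
Lemma local_F a : local (sF a).
Proof.
move=> w w' s; elim: s w w' => [|[b c] s IH] w w' ww' //=.
case: ifP => _; last by apply: IH => s' ss; apply: ww'; rewrite /= ss.
by congr (_ * _ + _ * _); [apply: IH|apply: local_H] => s' ss; apply: ww'; rewrite /= ss.
Qed.
Lemma local_T t : local (sT t).
Proof.
move=> w w' s; elim: s w w' => [|[b c] s IH] w w' ww' //=.
case: ifP => _; last by apply: IH => s' ss; apply: ww'; rewrite /= ss.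
by congr (_ * _ + _ * _); [apply: IH|apply: local_H] => s' ss; apply: ww'; rewrite /= ss.
Qed.
Lemma local_A k : local (sA k).
Proof.
elim: k => [|k IH] w w' [|x s] ww' /=; try by rewrite ww'.
  by case: s ww' => [|y s] ww'; rewrite !ww'.
by apply: IH => s' ss; apply: ww'; rewrite /= ss.
Qed.

Lemma slice_S x w s : (0 < size s)%N -> slice x (sS w) s = sS (slice x w) s.
Proof. by case: s. Qed.

Lemma sS_H b a w : sS (sH b a w) = sH b a (sS w).
Proof.
apply/funext => s; rewrite /sS /sH; congr (_ ^+ _ * _).
by elim: s => [|x [|y s] IH] //; move: IH; rewrite /level /= => ->.
Qed.

(** The sign of a letter enters the recursion only through factors coming from the letters after it.
    On a one-letter word the tail contributes 0 to the sum and exponent 0 to [sH], so the sign of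
    the last letter does not matter. The same holds for F and T. *)
Lemma sS_E a w : sS (sE a w) = sE a (sS w).
Proof.
apply/funext => s; elim: s w => [|[b c] [|y s] IH] w //.
  by rewrite /sS /= /slice /sH /level /=; case: ifP => _ //; ring.
have {}IH w' : sE _ w' (flip (y :: s)) = _ := IH w'.
have hH b' a' w' : sH b' a' w' (flip (y :: s)) = sH b' a' (sS w') (y :: s) by rewrite -sS_H.
rewrite {1}/sS flip_cons // [LHS]sliceE [RHS]sliceE !slice_E.
have ys s' : size s' = size (y :: s) -> (0 < size s')%N by move=> ->.
case: ifP => _; rewrite /comb IH ?hH.
  by congr (_ * _ + _ * _); apply: local_E => s' /ys hs; rewrite slice_S.
by apply: local_E => s' /ys hs; rewrite slice_S.
Qed.

Lemma sS_F a w : sS (sF a w) = sF a (sS w).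
Proof.
apply/funext => s; elim: s w => [|[b c] [|y s] IH] w //.
  by rewrite /sS /= /slice /sH /level /=; case: ifP => _ //; ring.
have {}IH w' : sF _ w' (flip (y :: s)) = _ := IH w'.
have hH b' a' w' : sH b' a' w' (flip (y :: s)) = sH b' a' (sS w') (y :: s) by rewrite -sS_H.
rewrite {1}/sS flip_cons // [LHS]sliceE [RHS]sliceE !slice_F.
have ys s' : size s' = size (y :: s) -> (0 < size s')%N by move=> ->.
case: ifP => _; rewrite /comb IH ?hH.
  by congr (_ * _ + _ * _); apply: local_F => s' /ys hs; rewrite slice_S.
by apply: local_F => s' /ys hs; rewrite slice_S.
Qed.

Lemma sS_T t w : sS (sT t w) = sT t (sS w).
Proof.
apply/funext => s; elim: s w => [|[b c] [|y s] IH] w //.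
  by rewrite /sS /= /slice /sH /level /=; case: ifP => _ //; ring.
have {}IH w' : sT _ w' (flip (y :: s)) = _ := IH w'.
have hH b' a' w' : sH b' a' w' (flip (y :: s)) = sH b' a' (sS w') (y :: s) by rewrite -sS_H.
rewrite {1}/sS flip_cons // [LHS]sliceE [RHS]sliceE !slice_T.
have ys s' : size s' = size (y :: s) -> (0 < size s')%N by move=> ->.
case: ifP => _; rewrite /comb IH ?hH.
  by congr (_ * _ + _ * _); apply: local_T => s' /ys hs; rewrite slice_S.
by apply: local_T => s' /ys hs; rewrite slice_S.
Qed.

Lemma sS_J e w s : (0 < size s)%N -> sS (sJ e w) s = sJ (~~ e) (sS w) s.
Proof.
rewrite /sS /sJ; suff h : (0 < size s)%N -> odd (count (fun x : sletter => ~~ x.1) (flip s)) = ~~ odd (count (fun x : sletter => ~~ x.1) s).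
  by move=> /h->; case: (odd _); case: e.
elim: s => [|[b c] [|y s] IH] // _; first by case: b.
have hc u : count (fun x : sletter => ~~ x.1) ((b, c) :: u) =
  (~~ b + count (fun x : sletter => ~~ x.1) u)%N by [].
by rewrite flip_cons // 2!hc [LHS]oddD IH // addbN -oddD.
Qed.

Lemma sS_A k w s : (k.+2 < size s)%N -> sS (sA k w) s = sA k (sS w) s.
Proof.
elim: k w s => [|k IH] w [|x s] // hs.
  by case: s hs => [|y [|z s]].
rewrite /sS flip_cons; last by case: s hs.
rewrite /= -/(sS _ s) IH //; apply: local_A => s' ss.
by rewrite slice_S // ss; case: s hs {ss}.
Qed.

(* The last generator is conjugate to the previous one under [sS]. *)
Definition sB k w := sS (sA k (sS w)).

Lemma sB_quad k w s : sB k (sB k w) s = (v ^+ 2 - 1) * sB k w s + v ^+ 2 * w s.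
Proof. by rewrite /sB sSS [LHS]/sS sA_quad [sS w (flip s)]/sS flipK. Qed.

Lemma sA_B_comm (k l : nat) w s : (k.+2 < l.+1)%N -> (l.+1 < size s)%N ->
  sA k (sB l w) s = sB l (sA k w) s.
Proof.
move=> kl ls; rewrite /sB -sS_A; last lia.
rewrite {1 3}/sS sA_comm //; apply: local_A => s' ss; rewrite sS_A //.
by rewrite ss size_flip; lia.
Qed.

(** Both generators act on the last two letters, so conjugation by [sS] does not help here. Slicing
    reduces to words of exactly two letters, which are enumerated by sign and order. *)
Lemma sA_B_comm_last k w s : size s = k.+2 -> sA k (sB k w) s = sB k (sA k w) s.
Proof.
elim: k w s => [|k IH] w [|x s] //.
  case: x s => b1 c1 [|[b2 c2] []] //= _.
  rewrite /sB /sS /= /slt /=; case: b1; case: b2;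
  rewrite ?xpair_eqE /=; repeat (nat_order_case; rewrite /sS //= ?/slt /=); try ring.
move=> [hs].
have hx s' : size s' = size s -> (0 < size s')%N by rewrite hs => ->.
have e1 w' : forall s', size s' = size s -> slice x (sB k.+1 w') s' = sB k (slice x w') s'.
  move=> s' ss; rewrite /sB slice_S ?hx // {1}/sS /= -/(sS _ _).
  rewrite -[LHS]/(sA k (slice x (sS w')) (flip s')) -[RHS]/(sA k (sS (slice x w')) (flip s')).
  by apply: local_A => s2 ss2; rewrite slice_S // hx // ss2 size_flip.
rewrite -[LHS]/(sA k (slice x (sB k.+1 w)) s) (local_A k (e1 w)) IH //.
by rewrite -[RHS]/(slice x (sB k.+1 (sA k.+1 w)) s) e1.
Qed.

(** [sS] commutes with [sA k], which does not touch the last letter, so this is the braid relation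
    of [sA k] and [sA k.+1] conjugated by [sS]. *)
Lemma sB_braid (k : nat) w s : (k.+2 < size s)%N ->
  sB k.+1 (sA k (sB k.+1 w)) s = sA k (sB k.+1 (sA k w)) s.
Proof.
move=> ks; have ks' s' : size s' = size s -> (k.+2 < size s')%N by move=> ->.
rewrite -(@sS_A k (sA k.+1 (sS (sA k w)))) // {1}/sB.
rewrite [RHS]/sS [LHS]/sS.
have -> : sA k.+1 (sS (sA k (sB k.+1 w))) (flip s) = sA k.+1 (sA k (sA k.+1 (sS w))) (flip s).
  by apply: local_A => s' ss; rewrite sS_A ?ks' ?ss ?size_flip // /sB sSS.
rewrite -sA_braid ?size_flip //; apply: local_A => s' ss; apply: local_A => s2 ss2.
by rewrite sS_A // ks' // ss2 ss size_flip.
Qed.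

End Local.
End SignedHecke.

(** * Coordinates of the tensor space *)

Section Words.
Variables (K : fieldType) (v : K) (n : nat).
Local Notation L := 'I_n.*2.+1.

Lemma extend_vec d (f : word n d -> Vd K n d) r : extend f (vec K r) = f r.
Proof.
rewrite /extend (bigD1 r) //= ffunE eqxx scale1r big1 ?addr0 // => s sr.
by rewrite ffunE (negPf sr) scale0r.
Qed.

Lemma extend_is_linear d (f : word n d -> Vd K n d) : linear (extend f).
Proof.
move=> k x y; rewrite /extend scaler_sumr -big_split; apply: eq_bigr => r _ /=.
by rewrite !ffunE scalerDl scalerA.
Qed.

Lemma Vd_sum d (w : Vd K n d) : w = \sum_r (w r : K) *: vec K r.
Proof.
apply/ffunP => s; rewrite sum_ffunE (bigD1 s) //= big1 => [|r rs]; rewrite !ffunE.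
  by rewrite eqxx addr0 [_ *: _]mulr1.
by rewrite eq_sym (negPf rs) [_ *: _]mulr0.
Qed.

Lemma eq_linear_vec d (V : lmodType K) (f g : Vd K n d -> V) : linear f -> linear g ->
  (forall r, f (vec K r) = g (vec K r)) -> f =1 g.
Proof.
move=> lf lg fg w; rewrite [w]Vd_sum.
pose f' := HB.pack_for {linear Vd K n d -> V} f (GRing.isLinear.Build _ _ _ _ f lf).
pose g' := HB.pack_for {linear Vd K n d -> V} g (GRing.isLinear.Build _ _ _ _ g lg).
rewrite -[f]/(f' : _ -> _) -[g]/(g' : _ -> _) !linear_sum; apply: eq_bigr => r _.
by rewrite !linearZ /= fg.
Qed.

Definition upd d (r : word n d) (j : 'I_d) (x : L) : word n d :=
  [ffun k => if k == j then x else r k].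

(* Half [true] is position [j], half [false] is position [2d+1-j]. *)
Definition mult_at d i (r : word n d) : nat := \sum_j ((r j == i :> nat) + (r j + i == n.*2)%N)%N.

Definition bef d (h : bool) i (r : word n d) (j : 'I_d) : nat :=
  (if h then \sum_(k < d | k < j) (r k == i :> nat)
   else \sum_k (r k == i :> nat) + \sum_(k < d | j < k) (r k + i == n.*2))%N.

Definition aft d (h : bool) i (r : word n d) (j : 'I_d) : nat :=
  (if h then \sum_(k < d | j < k) (r k == i :> nat) + \sum_k (r k + i == n.*2)
   else \sum_(k < d | k < j) (r k + i == n.*2))%N.

Lemma sum_xword d (A : nmodType) (P : pred 'I_(d + d)) (G : 'I_(d + d) -> A) :
  \sum_(p | P p) G p = \sum_(j < d | P (lshift d j)) G (lshift d j) +
                       \sum_(j < d | P (rshift d (rev_ord j))) G (rshift d (rev_ord j)).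
Proof.
rewrite big_mkcond big_split_ord -!big_mkcond /=; congr (_ + _).
by rewrite (reindex_inj rev_ord_inj).
Qed.

Lemma xword_l d (r : word n d) j : xword_of r (lshift d j) = r j.
Proof. by rewrite ffunE (unsplitK (inl j)). Qed.
Lemma xword_r d (r : word n d) j : xword_of r (rshift d (rev_ord j)) = rev_ord (r j).
Proof. by rewrite ffunE (unsplitK (inr _)) rev_ordK. Qed.

Lemma rev_eq (x : L) i : ((rev_ord x).+1 == i.+1) = (x + i == n.*2)%N.
Proof. by have := ltn_ord x; rewrite /=; lia. Qed.

Lemma multE d i (r : word n d) : mult i.+1 (xword_of r) = mult_at i r.
Proof.
rewrite /mult /letter (sum_xword predT) /mult_at big_split /=.
by congr (_ + _)%N; apply: eq_bigr => j _; rewrite ?xword_l ?xword_r ?rev_eq.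
Qed.

Lemma lr_ltn d (j k : 'I_d) :
  [/\ (lshift d j < lshift d k)%N = (j < k)%N,
      (lshift d j < rshift d (rev_ord k))%N,
      (rshift d (rev_ord j) < lshift d k)%N = false &
      (rshift d (rev_ord j) < rshift d (rev_ord k))%N = (k < j)%N].
Proof. by have := ltn_ord j; have := ltn_ord k; rewrite /=; split; lia. Qed.

Lemma bef_l d i (r : word n d) j : mult_before i.+1 (xword_of r) (lshift d j) = bef true i r j.
Proof.
rewrite /mult_before /letter (sum_xword (fun p => p < _)%N) /bef.
rewrite [X in _ + X]big_pred0 ?addr0; last by move=> k; case: (lr_ltn k j).
by apply: eq_big => k; rewrite ?xword_l //; case: (lr_ltn k j).
Qed.
Lemma bef_r d i (r : word n d) j :
  mult_before i.+1 (xword_of r) (rshift d (rev_ord j)) = bef false i r j.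
Proof.
rewrite /mult_before /letter (sum_xword (fun p => p < _)%N) /bef; congr (_ + _)%N.
  by apply: eq_big => k; rewrite ?xword_l //; case: (lr_ltn k j).
by apply: eq_big => k; rewrite ?xword_r ?rev_eq //; case: (lr_ltn k j).
Qed.
Lemma aft_l d i (r : word n d) j : mult_after i.+1 (xword_of r) (lshift d j) = aft true i r j.
Proof.
rewrite /mult_after /letter (sum_xword (fun p => _ < p)%N) /aft; congr (_ + _)%N.
  by apply: eq_big => k; rewrite ?xword_l //; case: (lr_ltn j k).
by apply: eq_big => k; rewrite ?xword_r ?rev_eq //; case: (lr_ltn j k).
Qed.
Lemma aft_r d i (r : word n d) j :
  mult_after i.+1 (xword_of r) (rshift d (rev_ord j)) = aft false i r j.
Proof.
rewrite /mult_after /letter (sum_xword (fun p => _ < p)%N) /aft.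
rewrite [X in X + _]big_pred0 ?add0r; last by move=> k; case: (lr_ltn j k).
by apply: eq_big => k; rewrite ?xword_r ?rev_eq //; case: (lr_ltn j k).
Qed.

Lemma raise_l d (r : word n d) j :
  word_of (raise (xword_of r) (lshift d j)) = upd r j (inord (r j).+1).
Proof.
have hj := ltn_ord j; apply/ffunP => k; have hk := ltn_ord k; rewrite [LHS]ffunE [LHS]ffunE [RHS]ffunE !xword_l (inj_eq (@lshift_inj _ _)).
rewrite (_ : (_ == rev_ord _) = false); last by apply/eqP => /(congr1 val) /=; lia.
by case: eqP => // ->.
Qed.
Lemma raise_r d (r : word n d) j :
  word_of (raise (xword_of r) (rshift d (rev_ord j))) = upd r j (inord (r j).-1).
Proof.
have hj := ltn_ord j.
apply/ffunP => k; have hk := ltn_ord k; rewrite [LHS]ffunE [LHS]ffunE [RHS]ffunE !xword_l.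
rewrite (_ : (_ == rshift _ _) = false); last by apply/eqP => /(congr1 val) /=; lia.
rewrite (_ : (_ == rev_ord _) = (k == j)); first by case: eqP => // ->.
by apply/eqP/eqP => [/(congr1 val)|->] /=; [move=> ?; apply/val_inj => /=|apply/val_inj => /=]; lia.
Qed.
Lemma lower_l d (r : word n d) j :
  word_of (lower (xword_of r) (lshift d j)) = upd r j (inord (r j).-1).
Proof.
have hj := ltn_ord j; apply/ffunP => k; have hk := ltn_ord k; rewrite [LHS]ffunE [LHS]ffunE [RHS]ffunE !xword_l (inj_eq (@lshift_inj _ _)).
rewrite (_ : (_ == rev_ord _) = false); last by apply/eqP => /(congr1 val) /=; lia.
by case: eqP => // ->.
Qed.
Lemma lower_r d (r : word n d) j :
  word_of (lower (xword_of r) (rshift d (rev_ord j))) = upd r j (inord (r j).+1).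
Proof.
have hj := ltn_ord j.
apply/ffunP => k; have hk := ltn_ord k; rewrite [LHS]ffunE [LHS]ffunE [RHS]ffunE !xword_l.
rewrite (_ : (_ == rshift _ _) = false); last by apply/eqP => /(congr1 val) /=; lia.
rewrite (_ : (_ == rev_ord _) = (k == j)); first by case: eqP => // ->.
by apply/eqP/eqP => [/(congr1 val)|->] /=; [move=> ?; apply/val_inj => /=|apply/val_inj => /=]; lia.
Qed.

Definition cE d h a (r : word n d) j : K := v ^- mult_at a.+1 r * v ^+ (2 * bef h a.+1 r j).
Definition cF d h a (r : word n d) j : K := v ^- mult_at a r * v ^+ (2 * aft h a r j).

Lemma opE_vec d a (r : word n d) : opE v a.+1 (vec K r) =
  \sum_(j | r j == a :> nat) cE true a r j *: vec K (upd r j (inord (r j).+1)) +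
  \sum_(j | (r j + a == n.*2)%N) cE false a r j *: vec K (upd r j (inord (r j).-1)).
Proof.
rewrite /opE extend_vec (sum_xword (fun p => _ == _)) scalerDr !scaler_sumr multE.
congr (_ + _); apply: eq_big => j; rewrite /letter ?xword_l ?xword_r ?rev_eq // => _.
  by rewrite scalerA bef_l raise_l.
by rewrite scalerA bef_r raise_r.
Qed.

Lemma opF_vec d a (r : word n d) : opF v a.+1 (vec K r) =
  \sum_(j | r j == a.+1 :> nat) cF true a r j *: vec K (upd r j (inord (r j).-1)) +
  \sum_(j | (r j + a.+1 == n.*2)%N) cF false a r j *: vec K (upd r j (inord (r j).+1)).
Proof.
rewrite /opF extend_vec (sum_xword (fun p => _ == _)) scalerDr !scaler_sumr multE.
congr (_ + _); apply: eq_big => j; rewrite /letter ?xword_l ?xword_r ?rev_eq // => _.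
  by rewrite scalerA aft_l lower_l.
by rewrite scalerA aft_r lower_r.
Qed.

Lemma opH_vec d a (r : word n d) : opH v a.+1 (vec K r) = v ^- mult_at a r *: vec K r.
Proof. by rewrite /opH extend_vec multE. Qed.
Lemma opHinv_vec d a (r : word n d) : opHinv v a.+1 (vec K r) = v ^+ mult_at a r *: vec K r.
Proof. by rewrite /opHinv extend_vec multE. Qed.

End Words.

(** * Splitting off the first letter of a vector *)

Section VectorSlices.
Variables (K : fieldType) (v : K) (n : nat).
Local Notation L := 'I_n.*2.+1.

Definition wcons d (x : L) (r : word n d) : word n d.+1 :=
  [ffun j => if unlift ord0 j is Some k then r k else x].

Definition wtail d (r : word n d.+1) : word n d := [ffun j => r (lift ord0 j)].

Lemma wcons0 d x (r : word n d) : wcons x r ord0 = x.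
Proof. by rewrite ffunE unlift_none. Qed.
Lemma wconsS d x (r : word n d) j : wcons x r (lift ord0 j) = r j.
Proof. by rewrite ffunE liftK. Qed.
Lemma wcons_tail d (r : word n d.+1) : r = wcons (r ord0) (wtail r).
Proof.
apply/ffunP => j; case: (unliftP ord0 j) => [k|] ->; last by rewrite wcons0.
by rewrite wconsS ffunE.
Qed.
Lemma wcons_inj d x y (r s : word n d) : (wcons x r == wcons y s) = (x == y) && (r == s).
Proof.
apply/eqP/andP => [e|[/eqP-> /eqP->]] //; split; apply/eqP.
  by rewrite -(wcons0 x r) e wcons0.
by apply/ffunP => j; rewrite -(wconsS x r) e wconsS.
Qed.

Lemma upd0 d x (r : word n d) z : upd (wcons x r) ord0 z = wcons z r.
Proof.
apply/ffunP => j; rewrite ffunE; case: (unliftP ord0 j) => [k|] ->.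
  by rewrite !wconsS.
by rewrite !wcons0 eqxx.
Qed.
Lemma updS d x (r : word n d) j z : upd (wcons x r) (lift ord0 j) z = wcons x (upd r j z).
Proof.
apply/ffunP => i; rewrite ffunE; case: (unliftP ord0 i) => [k|] ->; last by rewrite !wcons0.
by rewrite !wconsS ffunE (inj_eq lift_inj).
Qed.

Definition vslice d (y : L) (w : Vd K n d.+1) : Vd K n d := [ffun r => w (wcons y r)].

Lemma vslice_is_linear d y : linear (@vslice d y).
Proof. by move=> k w w'; apply/ffunP => r; rewrite !ffunE. Qed.
HB.instance Definition _ d y := GRing.isLinear.Build K (Vd K n d.+1) (Vd K n d) _ (@vslice d y)
  (@vslice_is_linear d y).

Lemma vslice_vec d y x (r : word n d) : vslice y (vec K (wcons x r)) = (y == x)%:R *: vec K r.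
Proof.
apply/ffunP => s; rewrite !ffunE wcons_inj.
by case: (y == x); rewrite /= ?scale1r ?scale0r.
Qed.

Lemma vslice_inj d (w w' : Vd K n d.+1) : (forall y, vslice y w = vslice y w') -> w = w'.
Proof.
by move=> h; apply/ffunP => r; rewrite [r]wcons_tail; have /ffunP/(_ (wtail r)) := h (r ord0); rewrite !ffunE.
Qed.

Lemma eq_linear_wcons d (V : lmodType K) (f g : Vd K n d.+1 -> V) : linear f -> linear g ->
  (forall x r, f (vec K (wcons x r)) = g (vec K (wcons x r))) -> f =1 g.
Proof.
by move=> lf lg h; apply: eq_linear_vec => // r; rewrite [r]wcons_tail.
Qed.

Lemma big_ordS (R : Type) (idx : R) (op : Monoid.law idx) d (P : pred 'I_d.+1) (G : 'I_d.+1 -> R) :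
  \big[op/idx]_(j | P j) G j = op (if P ord0 then G ord0 else idx)
    (\big[op/idx]_(j < d | P (lift ord0 j)) G (lift ord0 j)).
Proof. by rewrite big_mkcond big_ord_recl -big_mkcond. Qed.

Lemma mult_wcons d i x (r : word n d) :
  mult_at i (wcons x r) = ((x == i :> nat) + (x + i == n.*2) + mult_at i r)%N.
Proof.
rewrite /mult_at (big_ordS _ predT) wcons0 /=; congr (_ + _)%N.
by apply: eq_bigr => j _; rewrite wconsS.
Qed.

Lemma bef_wconsS d h i x (r : word n d) j :
  bef h i (wcons x r) (lift ord0 j) = ((x == i :> nat) + bef h i r j)%N.
Proof.
case: h; rewrite /bef.
  rewrite (big_ordS _ (fun k => k < _)%N) wcons0 /=; congr (_ + _)%N.
  by apply: eq_big => k; rewrite ?wconsS // => _; rewrite lift0.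
rewrite (big_ordS _ predT) wcons0 /= -addnA; congr (_ + _)%N; congr (_ + _)%N.
  by apply: eq_bigr => k _; rewrite wconsS.
rewrite (big_ordS _ (fun k => _ < k)%N) /= add0n.
by apply: eq_big => k; rewrite ?wconsS.
Qed.
Lemma aft_wconsS d h i x (r : word n d) j :
  aft h i (wcons x r) (lift ord0 j) = ((x + i == n.*2) + aft h i r j)%N.
Proof.
case: h; rewrite /aft; last first.
  rewrite (big_ordS _ (fun k => k < _)%N) wcons0 /=; congr (_ + _)%N.
  by apply: eq_big => k; rewrite ?wconsS.
rewrite (big_ordS _ (fun k => _ < k)%N) /= add0n.
rewrite (big_ordS _ predT) wcons0 /= [LHS]addnCA; congr (_ + _)%N; congr (_ + _)%N.
  by apply: eq_big => k; rewrite ?wconsS.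
by apply: eq_bigr => k _; rewrite wconsS.
Qed.
Lemma bef_wcons0 d h i x (r : word n d) :
  bef h i (wcons x r) ord0 = if h then 0%N else ((x == i :> nat) + mult_at i r)%N.
Proof.
case: h; rewrite /bef; first by rewrite big_pred0.
rewrite /mult_at (big_ordS _ predT) wcons0 big_split /= addnA; congr (_ + _ + _)%N.
  by apply: eq_bigr => k _; rewrite wconsS.
rewrite (big_ordS _ (fun k => _ < k)%N) /= add0n.
by apply: eq_big => k; rewrite ?wconsS.
Qed.
Lemma aft_wcons0 d h i x (r : word n d) :
  aft h i (wcons x r) ord0 = if h then ((x + i == n.*2)%N + mult_at i r)%N else 0%N.
Proof.
case: h; rewrite /aft; last by rewrite big_pred0.
rewrite (big_ordS _ (fun k => _ < k)%N) /= add0n /mult_at (big_ordS _ predT) wcons0 big_split /= addnCA.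
congr (_ + (_ + _))%N.
  by apply: eq_big => k; rewrite ?wconsS.
by apply: eq_bigr => k _; rewrite wconsS.
Qed.

Hypothesis v0 : v != 0.

HB.instance Definition _ d i := GRing.isLinear.Build K (Vd K n d) (Vd K n d) _
  (opE v i) (extend_is_linear _).
HB.instance Definition _ d i := GRing.isLinear.Build K (Vd K n d) (Vd K n d) _
  (opF v i) (extend_is_linear _).
HB.instance Definition _ d i := GRing.isLinear.Build K (Vd K n d) (Vd K n d) _
  (opH v i) (extend_is_linear _).
HB.instance Definition _ d i := GRing.isLinear.Build K (Vd K n d) (Vd K n d) _
  (opHinv v i) (extend_is_linear _).
HB.instance Definition _ d e := GRing.isLinear.Build K (Vd K n d) (Vd K n d) _
  (opJ e) (extend_is_linear _).
HB.instance Definition _ d t := GRing.isLinear.Build K (Vd K n d) (Vd K n d) _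
  (opTau v t) (extend_is_linear _).

Fact opT_is_linear d : linear (@opT K v n d).
Proof.
move=> k x y; rewrite /opT [opE v n _]linearP [opF v n (_ + _)]linearP.
rewrite [opHinv v n.+1 _]linearP [opH v n.+1 _]linearP.
rewrite [opH v n (_ + _)]linearP [opHinv v n (_ + _)]linearP opprD addrACA -scalerBr.
by rewrite [_^-1 *: (_ + _)]scalerDr scalerA mulrC -scalerA addrACA -scalerDr.
Qed.
HB.instance Definition _ d := GRing.isLinear.Build K (Vd K n d) (Vd K n d) _
  (@opT K v n d) (@opT_is_linear d).

Definition wgt (a : nat) (y : L) : nat := ((y == a :> nat) + (y + a == n.*2))%N.

Lemma vslice_H d a y w : vslice y (@opH K v n d.+1 a.+1 w) =
  v ^- wgt a y *: opH v a.+1 (vslice y w).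
Proof.
move: w; apply: eq_linear_wcons => [k w w'|k w w'|x r]; first by rewrite !linearP.
  by rewrite !linearP.
rewrite opH_vec linearZ /= vslice_vec mult_wcons.
have [->|yx] := eqVneq y x; last by rewrite !scale0r !linear0 ?scaler0.
by rewrite !scale1r opH_vec scalerA -invfM -exprD addnC.
Qed.

Lemma vslice_Hinv d a y w : vslice y (@opHinv K v n d.+1 a.+1 w) =
  v ^+ wgt a y *: opHinv v a.+1 (vslice y w).
Proof.
move: w; apply: eq_linear_wcons => [k w w'|k w w'|x r]; first by rewrite !linearP.
  by rewrite !linearP.
rewrite opHinv_vec linearZ /= vslice_vec mult_wcons.
have [->|yx] := eqVneq y x; last by rewrite !scale0r !linear0 ?scaler0.
by rewrite !scale1r opHinv_vec scalerA -exprD.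
Qed.

Lemma exprVD i j : v ^- i * v ^+ (i + j) = v ^+ j.
Proof. by rewrite exprD mulKf // expf_neq0. Qed.

Lemma cE0 d a (x : L) (r : word n d) h : (if h then x == a :> nat else x + a == n.*2)%N ->
  (a < n)%N -> cE v h a (wcons x r) ord0 = if h then v ^- mult_at a.+1 r else v ^+ mult_at a.+1 r.
Proof.
rewrite /cE bef_wcons0 mult_wcons; have := ltn_ord x; case: h => xb xa an.
  have -> : (x == a.+1 :> nat) = false by lia.
  have -> : (x + a.+1 == n.*2)%N = false by lia.
  by rewrite !add0n muln0 mulr1.
have -> : (x + a.+1 == n.*2)%N = (x == a.+1 :> nat) by lia.
rewrite -[RHS](exprVD ((x == a.+1 :> nat) + (x == a.+1 :> nat) + mult_at a.+1 r)).
by congr (_ * _ ^+ _); lia.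
Qed.

Lemma cES d a (x : L) (r : word n d) h j : cE v h a (wcons x r) (lift ord0 j) =
  v ^+ (x == a.+1 :> nat) * v ^- (x + a.+1 == n.*2)%N * cE v h a r j.
Proof.
rewrite /cE mult_wcons bef_wconsS.
move: (nat_of_bool (x == a.+1 :> nat)) (nat_of_bool (x + a.+1 == n.*2)%N) => A B.
by rewrite mulnDr mul2n -addnn !exprD; field; rewrite ?expf_neq0.
Qed.

Lemma cF0 d a (x : L) (r : word n d) h : (if h then x == a.+1 :> nat else x + a.+1 == n.*2)%N ->
  (a < n)%N -> cF v h a (wcons x r) ord0 = if h then v ^+ mult_at a r else v ^- mult_at a r.
Proof.
rewrite /cF aft_wcons0 mult_wcons; have := ltn_ord x; case: h => xb xa an.
  have -> : (x == a :> nat) = false by lia.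
  have -> : (x + a == n.*2)%N = false by lia.
  by rewrite !add0n mul2n -addnn exprVD.
have -> : (x == a :> nat) = false by lia.
have -> : (x + a == n.*2)%N = false by lia.
by rewrite !add0n muln0 mulr1.
Qed.

Lemma cFS d a (x : L) (r : word n d) h j : cF v h a (wcons x r) (lift ord0 j) =
  v ^- (x == a :> nat) * v ^+ (x + a == n.*2)%N * cF v h a r j.
Proof.
rewrite /cF mult_wcons aft_wconsS.
move: (nat_of_bool (x == a :> nat)) (nat_of_bool (x + a == n.*2)%N) => A B.
by rewrite mulnDr mul2n -addnn !exprD; field; rewrite ?expf_neq0.
Qed.

(** If the changed letter is not the first one, the first letter contributes only a power of v. If
    it is the first one, its left copy has nothing before it, which leaves v^-m = H on the tail,
    while its mirror image has all m relevant letters of the tail before it, which gives v^(-m+2m),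
    the inverse of H. *)
Lemma vslice_E d a y w : (a < n)%N -> vslice y (@opE K v n d.+1 a.+1 w) =
  (v ^+ (y == a.+1 :> nat) * v ^- (y + a.+1 == n.*2)%N) *: opE v a.+1 (vslice y w)
  + (y == a.+1 :> nat)%:R *: opH v a.+2 (vslice (inord a) w)
  + (y + a.+1 == n.*2)%N%:R *: opHinv v a.+2 (vslice (inord (n.*2 - a)) w).
Proof.
move=> an; move: w; apply: eq_linear_wcons => [k w w'|k w w'|x r]; first by rewrite !linearP.
  by rewrite ![in LHS]linearP /= 2![k *: (_ + _)]scalerDr [RHS]addrACA; congr (_ + _); rewrite addrACA.
have hx := ltn_ord x; have hy := ltn_ord y.
rewrite opE_vec (big_ordS _ (fun j => wcons x r j == a :> nat)).
rewrite (big_ordS _ (fun j => wcons x r j + a == n.*2)%N) !wcons0 /=.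
under eq_bigl do rewrite wconsS.
under eq_bigr do rewrite wconsS updS cES.
under [X in _ + (_ + X)]eq_bigl do rewrite wconsS.
under [X in _ + (_ + X)]eq_bigr do rewrite wconsS updS cES.
set c := _ * v ^- _.
have sumE (P : pred 'I_d) (c' : 'I_d -> K) (u : 'I_d -> word n d) :
  vslice y (\sum_(j | P j) (c * c' j) *: vec K (wcons x (u j))) =
  (c * (y == x)%:R) *: \sum_(j | P j) c' j *: vec K (u j).
  rewrite linear_sum scaler_sumr; apply: eq_bigr => j _.
  by rewrite linearZ /= vslice_vec !scalerA mulrAC.
rewrite addrACA linearD -/(vslice _ _) [X in _ + X]linearD /= !sumE -scalerDr -opE_vec.
rewrite [LHS]addrC -[RHS]addrA; congr (_ + _).
  rewrite vslice_vec linearZ /= scalerA.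
  by have [->|_] := eqVneq y x; rewrite // !mulr0n !mulr0 !scale0r.
have eq_inord (z : L) m : (m <= n.*2)%N -> (inord m == z) = (z == m :> nat).
  by move=> mn; rewrite -val_eqE /= inordK // eq_sym.
rewrite linearD /= !vslice_vec !eq_inord; try lia.
congr (_ + _).
  have [xa|xa] := eqVneq (x : nat) a; last by rewrite scale0r !linear0 ?scaler0.
  rewrite scale1r opH_vec linearZ /= upd0 vslice_vec (@cE0 _ _ _ _ true) ?xa //.
  by rewrite eq_sym eq_inord ?scalerA 1?mulrC //; lia.
have -> : (x + a == n.*2)%N = (x == (n.*2 - a)%N :> nat) by lia.
have [xa|xa] := eqVneq (x : nat) (n.*2 - a)%N; last by rewrite scale0r !linear0 ?scaler0.
rewrite scale1r opHinv_vec linearZ /= upd0 vslice_vec (@cE0 _ _ _ _ false) //; last lia.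
rewrite eq_sym eq_inord ?scalerA 1?mulrC; last lia.
by congr (_%:R * _ *: _); lia.
Qed.

(** As for E, except that now the letters after the changed one count: the left copy sees all those
    of the tail and yields the inverse of H, the mirror image sees none and yields H. *)
Lemma vslice_F d a y w : (a < n)%N -> vslice y (@opF K v n d.+1 a.+1 w) =
  (v ^- (y == a :> nat) * v ^+ (y + a == n.*2)%N) *: opF v a.+1 (vslice y w)
  + (y == a :> nat)%:R *: opHinv v a.+1 (vslice (inord a.+1) w)
  + (y + a == n.*2)%N%:R *: opH v a.+1 (vslice (inord (n.*2 - a.+1)) w).
Proof.
move=> an; move: w; apply: eq_linear_wcons => [k w w'|k w w'|x r]; first by rewrite !linearP.
  by rewrite ![in LHS]linearP /= 2![k *: (_ + _)]scalerDr [RHS]addrACA; congr (_ + _); rewrite addrACA.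
have hx := ltn_ord x; have hy := ltn_ord y.
rewrite opF_vec (big_ordS _ (fun j => wcons x r j == a.+1 :> nat)).
rewrite (big_ordS _ (fun j => wcons x r j + a.+1 == n.*2)%N) !wcons0 /=.
under eq_bigl do rewrite wconsS.
under eq_bigr do rewrite wconsS updS cFS.
under [X in _ + (_ + X)]eq_bigl do rewrite wconsS.
under [X in _ + (_ + X)]eq_bigr do rewrite wconsS updS cFS.
set c := _ * v ^+ _.
have sumE (P : pred 'I_d) (c' : 'I_d -> K) (u : 'I_d -> word n d) :
  vslice y (\sum_(j | P j) (c * c' j) *: vec K (wcons x (u j))) =
  (c * (y == x)%:R) *: \sum_(j | P j) c' j *: vec K (u j).
  rewrite linear_sum scaler_sumr; apply: eq_bigr => j _.
  by rewrite linearZ /= vslice_vec !scalerA mulrAC.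
rewrite addrACA linearD -/(vslice _ _) [X in _ + X]linearD /= !sumE -scalerDr -opF_vec.
rewrite [LHS]addrC -[RHS]addrA; congr (_ + _).
  rewrite vslice_vec linearZ /= scalerA.
  by have [->|_] := eqVneq y x; rewrite // !mulr0n !mulr0 !scale0r.
have eq_inord (z : L) m : (m <= n.*2)%N -> (inord m == z) = (z == m :> nat).
  by move=> mn; rewrite -val_eqE /= inordK // eq_sym.
rewrite linearD /= !vslice_vec !eq_inord; try lia.
congr (_ + _).
  have [xa|xa] := eqVneq (x : nat) a.+1; last by rewrite scale0r !linear0 ?scaler0.
  rewrite scale1r opHinv_vec linearZ /= upd0 vslice_vec (@cF0 _ _ _ _ true) ?xa //.
  by rewrite eq_sym eq_inord ?scalerA 1?mulrC //; lia.
have -> : (x + a.+1 == n.*2)%N = (x == (n.*2 - a.+1)%N :> nat) by lia.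
have [xa|xa] := eqVneq (x : nat) (n.*2 - a.+1)%N; last by rewrite scale0r !linear0 ?scaler0.
rewrite scale1r opH_vec linearZ /= upd0 vslice_vec (@cF0 _ _ _ _ false) //; last lia.
rewrite eq_sym eq_inord ?scalerA 1?mulrC; last lia.
by congr (_%:R * _ *: _); lia.
Qed.

End VectorSlices.

(** * The operators of U^m in signed-word coordinates *)

Section Coordinates.
Variables (K : fieldType) (v : K) (n : nat).
Local Notation L := 'I_n.*2.+1.

Definition lett (x : sletter) : L := inord (if x.1 then x.2 else n.*2 - x.2)%N.

Lemma lettE x : (x.2 < n)%N -> lett x = (if x.1 then x.2 else n.*2 - x.2)%N :> nat.
Proof. by move=> xn; rewrite inordK //; case: ifP => _; lia. Qed.

(** Vanishes at words of the wrong length or with a level at least n. Components with the letter n+1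
    are never read, so [phi] is injective on W only. *)
Fixpoint phi d : Vd K n d -> sfun K :=
  match d with
  | 0 => fun w s => if s is [::] then w [ffun=> ord0] else 0
  | d'.+1 => fun w s => if s is x :: s' then
      if (x.2 < n)%N then phi (vslice (lett x) w) s' else 0 else 0
  end.

Definition zerof : sfun K := fun _ => 0.

Lemma phi_slice d x (w : Vd K n d.+1) :
  slice x (phi w) = if (x.2 < n)%N then phi (vslice (lett x) w) else zerof.
Proof. by apply/funext => s; rewrite /slice /=; case: ifP. Qed.

Lemma phi0_slice x (w : Vd K n 0) : slice x (phi w) = zerof.
Proof. by []. Qed.

Lemma phi_comb d k (w w' : Vd K n d) : phi (k *: w + w') = comb k (phi w) 1 (phi w').
Proof.
elim: d w w' => [|d IH] w w'; apply/funext => -[|x s]; rewrite /comb /= ?ffunE //;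
  rewrite ?mul1r ?mulr0 ?addr0 //.
by case: ifP => _; rewrite ?linearP ?IH /comb ?mul1r ?mulr0 ?addr0.
Qed.

Lemma phi0 d : phi (0 : Vd K n d) = zerof.
Proof.
elim: d => [|d IH]; apply/funext => -[|x s] //=; first by rewrite ffunE.
by rewrite linear0 IH; case: ifP.
Qed.
Lemma phi_scal d k (w : Vd K n d) : phi (k *: w) = scal k (phi w).
Proof.
rewrite -[k *: w]addr0 phi_comb phi0.
by apply/funext => s; rewrite /comb mulr0 addr0.
Qed.
Lemma phiD d (w w' : Vd K n d) : phi (w + w') = comb 1 (phi w) 1 (phi w').
Proof. by rewrite -phi_comb scale1r. Qed.

Lemma scal0 (f : sfun K) : scal 0 f = zerof.
Proof. by apply/funext => s; rewrite /scal mul0r. Qed.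
Lemma sE0 a : sE v a zerof = zerof. Proof. by rewrite -{1}(scal0 zerof) sE_scal scal0. Qed.
Lemma sF0 a : sF v a zerof = zerof. Proof. by rewrite -{1}(scal0 zerof) sF_scal scal0. Qed.
Lemma sT0 a : sT v a zerof = zerof. Proof. by rewrite -{1}(scal0 zerof) sT_scal scal0. Qed.
Lemma sH0 b a : sH v b a zerof = zerof. Proof. by rewrite -{1}(scal0 zerof) sH_scal scal0. Qed.
Lemma sJ0 e : sJ e zerof = zerof. Proof. by rewrite -{1}(scal0 zerof) sJ_scal scal0. Qed.
Lemma sA_0 k : sA v k zerof = zerof. Proof. by rewrite -{1}(scal0 zerof) sA_scal scal0. Qed.

Definition zero_rules := (sE0, sF0, sT0, sH0, sJ0, sA_0, phi0_slice).

Lemma Vd0 (w : Vd K n 0) : exists k : K, w = k *: vec K [ffun=> ord0].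
Proof.
exists (w [ffun=> ord0]); apply/ffunP => r; rewrite !ffunE.
rewrite (_ : r = [ffun=> ord0]) ?eqxx /=; first by rewrite [_ *: _]mulr1.
by apply/ffunP => -[].
Qed.

Lemma op0 (X : {linear Vd K n 0 -> Vd K n 0}) w : (forall r, X (vec K r) = 0) -> X w = 0.
Proof. by move=> X0; have [k ->] := Vd0 w; rewrite linearZ /= X0 scaler0. Qed.

Hypothesis v0 : v != 0.

Lemma phi_H d a (w : Vd K n d) : (a < n)%N -> phi (opH v a.+1 w) = sH v true a (phi w).
Proof.
move=> an; elim: d w => [|d IH] w.
  have [k ->] := Vd0 w; rewrite linearZ /= opH_vec /mult_at big_ord0 invr1 scale1r.
  by apply/funext => -[|x s]; rewrite /sH /= ?mul1r ?mulr0.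
apply/funext => -[|[b c] s]; first by rewrite /sH /= mulr0.
rewrite ![_ (_ :: _)]sliceE slice_H // !phi_slice /=.
case: ifP => cn; last by rewrite !zero_rules; case: ifP => _; rewrite /scal ?mulr0.
rewrite vslice_H // phi_scal IH; have := @lettE (b, c) cn; move: (lett _) => y /= yE.
rewrite /wgt (_ : (_ + _ = (c == a))%N); last by case: b yE => yE; lia.
by case: (c == a); rewrite ?expr1 // expr0 invr1 /scal mul1r.
Qed.

Lemma phi_Hinv d a (w : Vd K n d) : (a < n)%N -> phi (opHinv v a.+1 w) = sH v false a (phi w).
Proof.
move=> an; elim: d w => [|d IH] w.
  have [k ->] := Vd0 w; rewrite linearZ /= opHinv_vec /mult_at big_ord0 scale1r.
  by apply/funext => -[|x s]; rewrite /sH /= ?mul1r ?mulr0.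
apply/funext => -[|[b c] s]; first by rewrite /sH /= mulr0.
rewrite ![_ (_ :: _)]sliceE slice_H // !phi_slice /=.
case: ifP => cn; last by rewrite !zero_rules; case: ifP => _; rewrite /scal ?mulr0.
rewrite vslice_Hinv // phi_scal IH; have := @lettE (b, c) cn; move: (lett _) => y /= yE.
rewrite /wgt (_ : (_ + _ = (c == a))%N); last by case: b yE => yE; lia.
by case: (c == a); rewrite ?expr1 // expr0 /scal mul1r.
Qed.

Lemma phi_E d a (w : Vd K n d) : (a.+1 < n)%N -> phi (opE v a.+1 w) = sE v a (phi w).
Proof.
move=> an; elim: d w => [|d IH] w.
  rewrite op0 ?phi0 => [|r]; last by rewrite /= opE_vec !big_ord0 addr0.
  by apply/funext => -[|[b c] s] //=; rewrite !zero_rules; case: ifP => _; rewrite /zerof; ring.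
apply/funext => -[|[b c] s] //=; rewrite !phi_slice /=.
case: ifP => cn; last first.
  by case: eqP => [|_]; [lia|rewrite !zero_rules].
rewrite vslice_E //; last lia.
have := @lettE (b, c) cn; move: (lett _) => y /= yE.
rewrite !phiD !phi_scal IH !phi_H // !phi_Hinv // (_ : (a < n)%N); last lia.
rewrite /comb /scal.
have -> : (y == a.+1 :> nat) = b && (c == a.+1) by case: b yE; lia.
have -> : (y + a.+1 == n.*2)%N = ~~ b && (c == a.+1) by case: b yE; lia.
case: (eqVneq c a.+1) => [_|_]; last by rewrite !andbF expr0 invr1 mulr0n !mul1r !mul0r !addr0.
by rewrite /lett /=; case: b {yE}; rewrite /sgnv /= ?expr0 ?expr1 ?mulr0n ?mulr1n; field; rewrite ?oner_eq0 ?v0.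
Qed.

Lemma phi_F d a (w : Vd K n d) : (a.+1 < n)%N -> phi (opF v a.+1 w) = sF v a (phi w).
Proof.
move=> an; elim: d w => [|d IH] w.
  rewrite op0 ?phi0 => [|r]; last by rewrite /= opF_vec !big_ord0 addr0.
  by apply/funext => -[|[b c] s] //=; rewrite !zero_rules; case: ifP => _; rewrite /zerof; ring.
apply/funext => -[|[b c] s] //=; rewrite !phi_slice /=.
case: ifP => cn; last first.
  by case: eqP => [|_]; [lia|rewrite !zero_rules].
rewrite vslice_F //; last lia.
have := @lettE (b, c) cn; move: (lett _) => y /= yE.
rewrite !phiD !phi_scal IH !phi_H ?phi_Hinv ?an; try lia.
rewrite /comb /scal.
have -> : (y == a :> nat) = b && (c == a) by case: b yE; lia.
have -> : (y + a == n.*2)%N = ~~ b && (c == a) by case: b yE; lia.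
case: (eqVneq c a) => [_|_]; last by rewrite !andbF expr0 invr1 mulr0n !mul1r !mul0r !addr0.
by rewrite /lett /=; case: b {yE}; rewrite /sgnv /= ?expr0 ?expr1 ?mulr0n ?mulr1n; field; rewrite ?oner_eq0 ?v0.
Qed.

(* Coordinates of [opJ], which does not vanish on the [no_mid] words only. *)
Lemma no_mid_wcons d y (r : word n d) : no_mid (wcons y r) = (y != n :> nat) && no_mid r.
Proof.
apply/forallP/andP => [h|[yn /forallP h] j].
  split; first by have := h ord0; rewrite wcons0 eqSS.
  by apply/forallP => j; have := h (lift ord0 j); rewrite wconsS.
by case: (unliftP ord0 j) => [k|] ->; rewrite ?wcons0 ?wconsS // eqSS.
Qed.

Definition npar d (r : word n d) : nat := #|[set j | (n.+1 <= (r j).+1)%N]|.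
Lemma npar_wcons d y (r : word n d) : npar (wcons y r) = ((n <= y) + npar r)%N.
Proof.
rewrite /npar -!sum1dep_card (big_ordS _ (fun j => n < (wcons y r j).+1)%N) wcons0 ltnS /=.
rewrite (eq_bigl (fun j => n < (r j).+1)%N) => [|j]; last by rewrite wconsS.
by case: leqP.
Qed.

Lemma opJE d e (w : Vd K n d) r :
  opJ e w r = if no_mid r && (odd (npar r) == ~~ e) then w r else 0.
Proof.
move: w; pose f (w : Vd K n d) : Vd K n d :=
  [ffun r => if no_mid r && (odd (npar r) == ~~ e) then w r else 0].
suff h : opJ e =1 f by move=> w; rewrite h ffunE.
apply: eq_linear_vec => [k w w'|k w w'|s]; first by rewrite !linearP.
  by apply/ffunP => s; rewrite !ffunE; case: ifP => _ //; rewrite [_ *: _]mulr0 addr0.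
rewrite /opJ extend_vec -/(npar s); apply/ffunP => t; rewrite !ffunE.
by have [->|ts] := eqVneq t s; case: ifP => _; rewrite ffunE ?eqxx ?(negPf ts) // if_same.
Qed.

(** Valid on all of V: [opJ] kills the words containing the letter n+1, and [phi] does not see
    them. *)
Lemma phi_J d e (w : Vd K n d) : phi (opJ e w) = sJ e (phi w).
Proof.
clear v0.
elim: d e w => [|d IH] e w.
  apply/funext => -[|[b c] s]; last by rewrite /sJ /= if_same.
  rewrite /= opJE /sJ /=; have -> : no_mid ([ffun=> ord0] : word n 0) by apply/forallP => -[].
  by rewrite /npar (_ : [set _ | _] = set0) ?cards0 //; apply/setP => -[].
apply/funext => -[|[b c] s]; first by rewrite /sJ /= if_same.
rewrite ![_ (_ :: _)]sliceE slice_J !phi_slice /=.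
case: ifP => cn; last by rewrite zero_rules.
rewrite -IH; congr (phi _ s); apply/ffunP => r.
rewrite !(opJE, ffunE) no_mid_wcons npar_wcons oddD.
have := @lettE (b, c) cn; move: (lett _) => y /= yE.
have -> : y != n :> nat by case: b yE; lia.
have -> : (n <= y)%N = ~~ b by case: b yE; lia.
by case: b {yE}; rewrite //=; case: e; case: (odd _).
Qed.

End Coordinates.

(** * The subspace W and the operator T *)

Section NoMiddle.
Variables (K : fieldType) (v : K) (n : nat).
Local Notation L := 'I_n.*2.+1.

Definition inW d (w : Vd K n d) : Prop := forall r, ~~ no_mid r -> w r = 0.

Lemma inW_slice d y (w : Vd K n d.+1) : inW w -> inW (vslice y w).
Proof. by move=> h r hr; rewrite ffunE h // no_mid_wcons negb_and hr orbT. Qed.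

Lemma inW_mid d (y : L) (w : Vd K n d.+1) : y = n :> nat -> inW w -> vslice y w = 0.
Proof.
by move=> yn h; apply/ffunP => r; rewrite !ffunE h // no_mid_wcons yn eqxx.
Qed.

Lemma inW_sliceP d (w : Vd K n d.+1) : inW w <->
  (forall y : L, if y == n :> nat then vslice y w = 0 else inW (vslice y w)).
Proof.
split=> [h y|h r]; first by case: eqP => yn; [apply: inW_mid|apply: inW_slice].
rewrite [r]wcons_tail no_mid_wcons; set y := r _; set s := wtail r => yr.
have -> : w (wcons y s) = vslice y w s by rewrite ffunE.
by have := h y; case: eqP yr => [_ _ ->|_ yr]; [rewrite ffunE|apply].
Qed.

Lemma inW0 d : inW (0 : Vd K n d). Proof. by move=> r _; rewrite ffunE. Qed.
Lemma inWP d k (w w' : Vd K n d) : inW w -> inW w' -> inW (k *: w + w').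
Proof. by move=> h h' r hr; rewrite !ffunE h ?h' // [_ *: _]mulr0 addr0. Qed.
Lemma inWD d (w w' : Vd K n d) : inW w -> inW w' -> inW (w + w').
Proof. by rewrite -[w]scale1r; move=> h; apply: inWP; rewrite -[w]scale1r. Qed.
Lemma inWZ d k (w : Vd K n d) : inW w -> inW (k *: w).
Proof. by move=> h; rewrite -[k *: w]addr0; apply: inWP => //; apply: inW0. Qed.

Lemma mid_of_lett (y : L) : y != n :> nat ->
  exists2 x : sletter, (x.2 < n)%N & lett n x = y.
Proof.
move=> yn; have := ltn_ord y; exists (if (y < n)%N then (true, y : nat) else (false, n.*2 - y)%N).
  by case: ifP => /=; lia.
by apply: ord_inj; case: ifP => yn'; rewrite lettE /=; lia.
Qed.

Lemma phi_inj d (w w' : Vd K n d) : inW w -> inW w' -> phi w = phi w' -> w = w'.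
Proof.
elim: d w w' => [|d IH] w w' hw hw' e.
  have [k ek] := Vd0 w; have [k' ek'] := Vd0 w'; move: e.
  rewrite ek ek' => /(congr1 (@^~ [::])); rewrite /= !ffunE eqxx [_ *: _]mulr1.
  by rewrite [_ *: _]mulr1 => ->.
apply: vslice_inj => y; have [yn|/mid_of_lett[x xn <-]] := eqVneq (y : nat) n.
  by rewrite !inW_mid.
apply: IH; try exact: inW_slice.
by have := congr1 (slice x) e; rewrite !phi_slice xn.
Qed.

Hypothesis v0 : v != 0.
Hypothesis v2 : v - v^-1 != 0.

Lemma opH_mid d (w : Vd K n d) : inW w -> opH v n.+1 w = w.
Proof.
elim: d w => [|d IH] w hw.
  by have [k ->] := Vd0 w; rewrite linearZ /= opH_vec /mult_at big_ord0 invr1 scale1r.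
apply: vslice_inj => y; rewrite vslice_H; have [yn|yn] := eqVneq (y : nat) n.
  by rewrite inW_mid // linear0 scaler0.
rewrite IH; last exact: inW_slice.
rewrite /wgt (negPf yn) (_ : (_ == _) = false) ?invr1 ?scale1r //.
by have := ltn_ord y; lia.
Qed.

Lemma opHinv_mid d (w : Vd K n d) : inW w -> opHinv v n.+1 w = w.
Proof.
elim: d w => [|d IH] w hw.
  by have [k ->] := Vd0 w; rewrite linearZ /= opHinv_vec /mult_at big_ord0 scale1r.
apply: vslice_inj => y; rewrite vslice_Hinv; have [yn|yn] := eqVneq (y : nat) n.
  by rewrite inW_mid // linear0 scaler0.
rewrite IH; last exact: inW_slice.
rewrite /wgt (negPf yn) (_ : (_ == _) = false) ?scale1r //.
by have := ltn_ord y; lia.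
Qed.

Lemma opHE d i (w : Vd K n d) r : opH v i w r = v ^- mult i (xword_of r) * w r.
Proof.
pose f (w : Vd K n d) : Vd K n d := [ffun r => v ^- mult i (xword_of r) * w r].
suff h : opH v i =1 f by rewrite h ffunE.
apply: eq_linear_vec => [k u u'|k u u'|s]; first by rewrite linearP.
  by apply/ffunP => s; rewrite !ffunE mulrDr mulrCA.
rewrite /opH extend_vec; apply/ffunP => s'; rewrite !ffunE /GRing.scale /=.
by case: eqP => [->|]; rewrite ?mulr0.
Qed.
Lemma opHinvE d i (w : Vd K n d) r : opHinv v i w r = v ^+ mult i (xword_of r) * w r.
Proof.
pose f (w : Vd K n d) : Vd K n d := [ffun r => v ^+ mult i (xword_of r) * w r].
suff h : opHinv v i =1 f by rewrite h ffunE.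
apply: eq_linear_vec => [k u u'|k u u'|s]; first by rewrite linearP.
  by apply/ffunP => s; rewrite !ffunE mulrDr mulrCA.
rewrite /opHinv extend_vec; apply/ffunP => s'; rewrite !ffunE /GRing.scale /=.
by case: eqP => [->|]; rewrite ?mulr0.
Qed.
Lemma inW_H d i (w : Vd K n d) : inW w -> inW (opH v i w).
Proof. by move=> h r hr; rewrite opHE h ?mulr0. Qed.
Lemma inW_Hinv d i (w : Vd K n d) : inW w -> inW (opHinv v i w).
Proof. by move=> h r hr; rewrite opHinvE h ?mulr0. Qed.
Lemma inW_J d e (w : Vd K n d) : inW w -> inW (opJ e w).
Proof. by move=> h r hr; rewrite opJE (negPf hr). Qed.

Lemma inW_E d a (w : Vd K n d) : (a.+1 < n)%N -> inW w -> inW (opE v a.+1 w).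
Proof.
move=> an; elim: d w => [|d IH] w hw.
  by rewrite op0 => [|r]; [apply: inW0|rewrite /= opE_vec !big_ord0 addr0].
apply/inW_sliceP => y; rewrite vslice_E //; last lia.
case: eqP => [yn|/eqP yn]; last first.
  by apply: inWD; first apply: inWD; apply: inWZ;
    [apply/IH/inW_slice|apply/inW_H/inW_slice|apply/inW_Hinv/inW_slice].
have [-> ->] : (y == a.+1 :> nat) = false /\ (y + a.+1 == n.*2)%N = false by split; lia.
by rewrite (inW_mid yn hw) !scale0r linear0 scaler0 !addr0.
Qed.
Lemma inW_F d a (w : Vd K n d) : (a.+1 < n)%N -> inW w -> inW (opF v a.+1 w).
Proof.
move=> an; elim: d w => [|d IH] w hw.
  by rewrite op0 => [|r]; [apply: inW0|rewrite /= opF_vec !big_ord0 addr0].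
apply/inW_sliceP => y; rewrite vslice_F //; last lia.
case: eqP => [yn|/eqP yn]; last first.
  by apply: inWD; first apply: inWD; apply: inWZ;
    [apply/IH/inW_slice|apply/inW_Hinv/inW_slice|apply/inW_H/inW_slice].
have [-> ->] : (y == a :> nat) = false /\ (y + a == n.*2)%N = false by split; lia.
by rewrite (inW_mid yn hw) !scale0r linear0 scaler0 !addr0.
Qed.

Section Positive.
Variable t : nat.
Hypothesis tn : n = t.+1.

Let vsE d (y : L) (w : Vd K n d.+1) : vslice y (opE v n w) =
  (v ^+ (y == n :> nat) * v ^- (y + n == n.*2)%N) *: opE v n (vslice y w)
  + (y == n :> nat)%:R *: opH v n.+1 (vslice (inord t) w)
  + (y + n == n.*2)%N%:R *: opHinv v n.+1 (vslice (inord n.+1) w).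
Proof.
have := @vslice_E K v n v0 d t y w; rewrite -tn => /(_ (leqnn n)) ->.
by rewrite (_ : n.*2 - t = n.+1)%N //; lia.
Qed.

Let vsF d (y : L) (w : Vd K n d.+1) : vslice y (opF v n w) =
  (v ^- (y == t :> nat) * v ^+ (y + t == n.*2)%N) *: opF v n (vslice y w)
  + (y == t :> nat)%:R *: opHinv v n (vslice (inord n) w)
  + (y + t == n.*2)%N%:R *: opH v n (vslice (inord n) w).
Proof.
have := @vslice_F K v n v0 d t y w; rewrite -tn => /(_ (leqnn n)) ->.
by rewrite (_ : n.*2 - n = n)%N //; lia.
Qed.

(** F_n changes only the letter n+1, which is its own mirror image and does not occur in W. *)
Lemma opF_mid d (w : Vd K n d) : inW w -> opF v n w = 0.
Proof.
elim: d w => [|d IH] w hw.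
  by rewrite op0 // => r /=; have := opF_vec v t r; rewrite -tn => ->; rewrite !big_ord0 addr0.
apply: vslice_inj => y; rewrite vsF linear0.
have -> : vslice (inord n) w = 0 by rewrite inW_mid // inordK //; lia.
rewrite !linear0 ?scaler0 !addr0; have [yn|yn] := eqVneq (y : nat) n.
  by rewrite inW_mid // !linear0 ?scaler0.
by rewrite IH ?scaler0 //; apply: inW_slice.
Qed.

(** E_n takes either of the letters [t] and [n.+1] (from 0) to the middle letter, and F_n takes the
    middle letter back to either; this is how the sign of a letter comes to change. H_{n+1} is the
    identity on W, hence the plain sum of the two slices. *)
Lemma slice_EF d (y : L) (w : Vd K n d.+1) : inW w -> y != n :> nat ->
  vslice y (opF v n (opE v n w)) =
  (v ^- (y == t :> nat) * v ^+ (y + t == n.*2)%N) *: opF v n (opE v n (vslice y w))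
  + (y == t :> nat)%:R *: opHinv v n (vslice (inord t) w + vslice (inord n.+1) w)
  + (y + t == n.*2)%N%:R *: opH v n (vslice (inord t) w + vslice (inord n.+1) w).
Proof.
move=> hw yn; rewrite vsF.
have -> : vslice (inord n) (opE v n w) = vslice (inord t) w + vslice (inord n.+1) w.
  rewrite vsE inordK; last lia.
  rewrite eqxx addnn eqxx (@inW_mid _ (inord n) w) //; last by rewrite inordK //; lia.
  by rewrite linear0 scaler0 add0r !scale1r opH_mid ?opHinv_mid; try exact: inW_slice.
congr (_ *: opF v n _ + _ + _).
rewrite vsE (negPf yn) (_ : (_ == n.*2)%N = false); last by apply/negP; lia.
by rewrite !scale0r !addr0 expr0 invr1 mulr1 scale1r.
Qed.

Let vsH d (y : L) (w : Vd K n d.+1) : vslice y (opH v n w) = v ^- wgt t y *: opH v n (vslice y w).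
Proof. by have := vslice_H v t y w; rewrite -tn. Qed.
Let vsHinv d (y : L) (w : Vd K n d.+1) : vslice y (opHinv v n w) = v ^+ wgt t y *: opHinv v n (vslice y w).
Proof. by have := vslice_Hinv v t y w; rewrite -tn. Qed.

(** The Cartan term absorbs the summand of [slice_EF] that returns to the letter [y] itself, by 1 -
    v/(v - v^-1) = -v^-1/(v - v^-1) for y = t and 1 + v^-1/(v - v^-1) = v/(v - v^-1) for y = n+1.
    Besides the recursive term, only the slice at the opposite sign remains. *)
Lemma slice_opT d (y : L) (w : Vd K n d.+1) : inW w -> y != n :> nat ->
  vslice y (opT v w) = (v ^- (y == t :> nat) * v ^+ (y + t == n.*2)%N) *: opT v (vslice y w)
  + (y == t :> nat)%:R *: opHinv v n (vslice (inord n.+1) w)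
  + (y + t == n.*2)%N%:R *: opH v n (vslice (inord t) w).
Proof.
move=> hw yn; have ltn_y := ltn_ord y.
have v3 : v * v - 1 != 0 by have := mulf_neq0 v0 v2; rewrite mulrBr mulfV.
rewrite /opT linearD linearZ linearB /= slice_EF // !opH_mid ?opHinv_mid //; try exact: inW_slice.
rewrite vsH vsHinv.
have [yt|yt] := eqVneq (y : nat) t.
  have -> : (y + t == n.*2)%N = false by lia.
  have -> : wgt t y = 1%N by rewrite /wgt; lia.
  rewrite !scale0r !addr0 !scale1r mulr1 linearD /= (_ : inord t = y); last by rewrite -yt inord_val.
  rewrite !scalerDr; move: (opF _ _ _) (opH _ _ _) (opHinv _ _ _) (opHinv _ _ _) => A B C D.
  by apply/ffunP => r; rewrite !ffunE /GRing.scale /=; field; rewrite v0.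
have [yt'|yt'] := eqVneq (y + t)%N (n.*2)%N.
  have -> : wgt t y = 1%N by rewrite /wgt; lia.
  have ey : inord n.+1 = y by apply: ord_inj; rewrite inordK; lia.
  rewrite !scale0r !addr0 !scale1r expr0 invr1 mul1r linearD /= ey.
  rewrite !scalerDr; move: (opF _ _ _) (opH _ _ _) (opH _ _ _) (opHinv _ _ _) => A B C D.
  by apply/ffunP => r; rewrite !ffunE /GRing.scale /=; field; rewrite v0.
have -> : wgt t y = 0%N by rewrite /wgt; lia.
by rewrite !scale0r !addr0 expr0 invr1 mulr1 !scale1r.
Qed.

Lemma opT0 (w : Vd K n 0) : opT v w = 0.
Proof.
rewrite /opT opF_mid ?opH_mid ?opHinv_mid ?add0r; last 3 first.
- by move=> r /forallP[]; case.
- by move=> r /forallP[]; case.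
- by rewrite op0 => [|r]; [apply: inW0|have := opE_vec v t r; rewrite -tn /= => ->; rewrite !big_ord0 addr0].
have -> : opH v n w = w.
  have [k ->] := Vd0 w; rewrite linearZ /=.
  by have := opH_vec v t ([ffun=> ord0] : word n 0); rewrite -tn => ->; rewrite /mult_at big_ord0 invr1 scale1r.
have -> : opHinv v n w = w.
  have [k ->] := Vd0 w; rewrite linearZ /=.
  by have := opHinv_vec v t ([ffun=> ord0] : word n 0); rewrite -tn => ->; rewrite /mult_at big_ord0 scale1r.
by rewrite subrr scaler0.
Qed.

(** E_n leaves W, but the middle slice of E_n w is a sum of two slices of w, hence in a smaller W,
    where F_n vanishes. *)
Lemma inW_T d (w : Vd K n d) : inW w -> inW (opT v w).
Proof.
elim: d w => [|d IH] w hw; first by rewrite opT0; apply: inW0.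
apply/inW_sliceP => y; case: eqP => [yn|/eqP yn].
  rewrite /opT linearD linearZ linearB /= !opH_mid ?opHinv_mid //.
  rewrite vsF vsH vsHinv (inW_mid yn hw) !(linear0, scaler0, oppr0, addr0).
  have [yt yt'] : (y == t :> nat) = false /\ (y + t == n.*2)%N = false.
    by have := ltn_ord y; split; lia.
  rewrite yt yt' !scale0r !addr0 expr0 invr1 mulr1 scale1r vsE yn eqxx addnn eqxx.
  rewrite (inW_mid yn hw) // !linear0 ?scaler0 add0r !scale1r opH_mid ?opHinv_mid; try exact: inW_slice.
  by rewrite opF_mid //; apply: inWD; apply: inW_slice.
rewrite slice_opT //.
by apply: inWD; first apply: inWD; apply: inWZ; [apply/IH/inW_slice|apply/inW_Hinv/inW_slice|apply/inW_H/inW_slice].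
Qed.

Lemma phi_T d (w : Vd K n d) : inW w -> phi (opT v w) = sT v t (phi w).
Proof.
have Hn a (u : Vd K n a) : phi (opH v n u) = sH v true t (phi u).
  by have := @phi_H K v n v0 a t u; rewrite -tn => /(_ (leqnn n)).
have Hn' a (u : Vd K n a) : phi (opHinv v n u) = sH v false t (phi u).
  by have := @phi_Hinv K v n v0 a t u; rewrite -tn => /(_ (leqnn n)).
elim: d w => [|d IH] w hw.
  rewrite opT0 phi0; apply/funext => -[|[b c] s] //=; rewrite !zero_rules.
  by case: ifP => _; rewrite /zerof; ring.
apply/funext => -[|[b c] s] //=; rewrite !phi_slice /=.
case: ifP => cn; last by rewrite !zero_rules; case: ifP => _; rewrite /zerof; ring.
have := @lettE n (b, c) cn; move ey: (lett n (b, c)) => y /= yE.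
rewrite slice_opT //; last by case: b yE {ey}; lia.
rewrite !phiD !phi_scal IH ?Hn ?Hn'; last exact: inW_slice.
rewrite /comb /scal.
have -> : (y == t :> nat) = b && (c == t) by case: b yE {ey}; lia.
have -> : (y + t == n.*2)%N = ~~ b && (c == t) by case: b yE {ey}; lia.
have [ct|_] := eqVneq c t; last by rewrite !andbF expr0 invr1 mulr0n !mul1r !mul0r !addr0.
have e1 : lett n (true, c) = inord t by rewrite /lett /= ct.
have e2 : lett n (false, c) = inord n.+1 by rewrite /lett /= ct; congr inord; lia.
rewrite -e1 -e2.
by case: b {yE ey}; rewrite /sgnv /= ?expr0 ?expr1 ?mulr0n ?mulr1n; field; rewrite ?oner_eq0 ?v0.
Qed.

End Positive.

End NoMiddle.

(** * The Hecke generators in coordinates *)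

Section HeckeCoordinates.
Variables (K : fieldType) (v : K) (n : nat).
Local Notation L := 'I_n.*2.+1.

(** The transpose of [tau_rule]: the coefficient at [r] receives contributions from [r] and from
    [S r] only, and [S] exchanges the cases x < y and x > y. Stated for an arbitrary involution in
    order to cover both kinds of generators. *)
Lemma tau_coord d (S : word n d -> word n d) (x y : word n d -> nat) :
  involutive S -> (forall t, (x (S t) < y (S t)) = (y t < x t))%N ->
  (forall t, x t = y t -> S t = t) ->
  forall w r, extend (fun r => tau_rule v (x r) (y r) r (S r)) w r =
    if (x r < y r)%N then v ^+ 2 * w (S r) else if x r == y r then v ^+ 2 * w r
    else (v ^+ 2 - 1) * w r + w (S r).
Proof.
move=> SK Slt Seq; set g := fun r => tau_rule _ _ _ _ _.
pose f (w : Vd K n d) : Vd K n d := [ffun r =>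
  if (x r < y r)%N then v ^+ 2 * w (S r) else if x r == y r then v ^+ 2 * w r
    else (v ^+ 2 - 1) * w r + w (S r)].
move=> w r; suff -> : extend g w = f w by rewrite ffunE.
move: w {r}; apply: eq_linear_vec => [||s]; first exact: extend_is_linear.
  move=> k w w'; apply/ffunP => r; rewrite !ffunE /GRing.scale /=.
  by case: ifP => _; [|case: ifP => _]; ring.
have Sgt t : (y (S t) < x (S t))%N = (x t < y t)%N by rewrite -Slt SK.
apply/ffunP => t; rewrite extend_vec /g /f /tau_rule !ffunE (inv_eq SK).
have zero : (if (x t < y t)%N then v ^+ 2 * 0%:R else if x t == y t then v ^+ 2 * 0%:R
    else (v ^+ 2 - 1) * 0%:R + 0%:R) = 0 :> K by case: ifP => _; [|case: ifP => _]; ring.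
case: (ltngtP (x s) (y s)) => xys.
- have [ts|ts] := eqVneq t (S s).
    have := Sgt s; rewrite -ts xys; case: ltngtP => // _ _.
    have [e|_] := eqVneq t s; last by rewrite ffunE ts eqxx /=; ring.
    by have := Sgt s; rewrite -ts e xys ltnNge ltnW.
  rewrite ffunE (negPf ts); have [->|_] := eqVneq t s; last by rewrite /= zero.
  by rewrite xys /=; ring.
- rewrite !ffunE /GRing.scale /=; have [ts|ts] := eqVneq t (S s).
    have := Slt s; rewrite -ts xys => ->.
    have [e|_] := eqVneq t s; last by rewrite /=; ring.
    by have := Slt s; rewrite -ts e xys ltnNge ltnW.
  have [->|_] := eqVneq t s; last by rewrite /= zero; ring.
  by case: ltngtP xys => // _ _ /=; ring.
rewrite ffunE Seq // /GRing.scale /= ffunE; have [->|_] := eqVneq t s.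
  by rewrite xys ltnn eqxx.
by rewrite /= zero mulr0.
Qed.

Definition opA d (j k : 'I_d) : Vd K n d -> Vd K n d :=
  extend (fun r => tau_rule v (r j) (r k) r (word_swap r j k)).
Definition opD d (j k : 'I_d) : Vd K n d -> Vd K n d :=
  extend (fun r => tau_rule v ((r j).+1 + (r k).+1) n.*2.+2 r (word_swap_rev r j k)).
Definition opFlip d (k : 'I_d) (w : Vd K n d) : Vd K n d :=
  [ffun r => w (upd r k (rev_ord (r k)))].

Lemma word_swapK d (j k : 'I_d) : involutive (fun r : word n d => word_swap r j k).
Proof. by move=> r; apply/ffunP => q; rewrite !ffunE tpermK. Qed.
Lemma word_swap_revK d (j k : 'I_d) : j != k ->
  involutive (fun r : word n d => word_swap_rev r j k).
Proof.
move=> jk r; apply/ffunP => q; rewrite !ffunE eqxx.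
have [->|qj] := eqVneq q j; first by rewrite eq_sym (negPf jk) rev_ordK.
by have [->|//] := eqVneq q k; rewrite eqxx rev_ordK.
Qed.

Lemma opA_coord d (j k : 'I_d) w r : opA j k w r =
  if (r j < r k)%N then v ^+ 2 * w (word_swap r j k) else if r j == r k :> nat then v ^+ 2 * w r
  else (v ^+ 2 - 1) * w r + w (word_swap r j k).
Proof.
apply: (@tau_coord d (fun r => word_swap r j k) (fun r => r j) (fun r => r k)).
- exact: word_swapK.
- by move=> t; rewrite !ffunE tpermL tpermR.
- move=> t e; apply/ffunP => q; rewrite ffunE; have {}e := ord_inj e.
  by case: tpermP => [->|->|//].
Qed.

Lemma opD_coord d (j k : 'I_d) w r : j != k -> opD j k w r =
  if (r j + r k < n.*2)%N then v ^+ 2 * w (word_swap_rev r j k)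
  else if (r j + r k == n.*2)%N then v ^+ 2 * w r
  else (v ^+ 2 - 1) * w r + w (word_swap_rev r j k).
Proof.
move=> jk.
have -> : (r j + r k < n.*2)%N = ((r j).+1 + (r k).+1 < n.*2.+2)%N by lia.
have -> : (r j + r k == n.*2)%N = ((r j).+1 + (r k).+1 == n.*2.+2)%N by lia.
apply: (@tau_coord d (fun r => word_swap_rev r j k) (fun r => (r j).+1 + (r k).+1)%N (fun=> n.*2.+2)).
- exact: word_swap_revK.
- by move=> t; rewrite !ffunE eqxx eq_sym (negPf jk) eqxx /=; have := ltn_ord (t j); have := ltn_ord (t k); lia.
- move=> t e; apply/ffunP => q; rewrite ffunE.
  have [->|_] := eqVneq q j; first by apply: ord_inj; rewrite /=; lia.
  by have [->|//] := eqVneq q k; apply: ord_inj; rewrite /=; lia.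
Qed.

(** Replacing r_k by its mirror image turns the comparison of r_j + r_k with 2n into that of r_j
    with r_k, and [word_swap_rev] into [word_swap]. *)
Lemma opD_flip d (j k : 'I_d) w : j != k -> opD j k w = opFlip k (opA j k (opFlip k w)).
Proof.
move=> jk; have kj : k != j by rewrite eq_sym.
have flipE u r : opFlip k u r = u (upd r k (rev_ord (r k))) by rewrite ffunE.
apply/ffunP => r; rewrite opD_coord // flipE opA_coord !flipE.
have -> : upd r k (rev_ord (r k)) j = r j by rewrite ffunE (negPf jk).
have -> : upd r k (rev_ord (r k)) k = rev_ord (r k) by rewrite ffunE eqxx.
rewrite /=; have := ltn_ord (r j); have := ltn_ord (r k) => hk hj.
have -> : (r j < n.*2.+1 - (r k).+1)%N = (r j + r k < n.*2)%N by lia.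
have -> : (r j == n.*2.+1 - (r k).+1 :> nat)%N = (r j + r k == n.*2)%N by lia.
have -> : upd (word_swap (upd r k (rev_ord (r k))) j k) k
  (rev_ord (word_swap (upd r k (rev_ord (r k))) j k k)) = word_swap_rev r j k.
  apply/ffunP => q; rewrite !ffunE tpermR (negPf jk).
  have [->|qk] := eqVneq q k; first by rewrite (negPf kj).
  have [->|qj] := eqVneq q j; first by rewrite tpermL eqxx.
  by rewrite tpermD ?(negPf qk) // eq_sym.
have -> : upd (upd r k (rev_ord (r k))) k (rev_ord (rev_ord (r k))) = r.
  by apply/ffunP => q; rewrite !ffunE rev_ordK; case: eqP => // ->.
by [].
Qed.

Lemma no_mid_swap d (j k : 'I_d) (r : word n d) : no_mid (word_swap r j k) = no_mid r.
Proof.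
apply/forallP/forallP => h q; last by rewrite ffunE.
by have := h (tperm j k q); rewrite ffunE tpermK.
Qed.
Lemma no_mid_swap_rev d (j k : 'I_d) (r : word n d) : j != k ->
  no_mid (word_swap_rev r j k) = no_mid r.
Proof.
move=> jk; suff h (s : word n d) : no_mid s -> no_mid (word_swap_rev s j k).
  by apply/idP/idP => /h //; rewrite word_swap_revK.
move=> ns; have hs q : (s q).+1 != n.+1 by have /forallP := ns; apply.
 apply/forallP => q; rewrite ffunE.
case: (eqVneq q j) => _; first by have := hs k; have := ltn_ord (s k); rewrite /=; lia.
by case: (eqVneq q k) => _ //; have := hs j; have := ltn_ord (s j); rewrite /=; lia.
Qed.

Lemma inW_A d (j k : 'I_d) w : inW w -> inW (opA j k w).
Proof.
move=> h r hr; have hS : w (word_swap r j k) = 0 by apply: h; rewrite no_mid_swap.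
rewrite opA_coord hS (h r hr); case: ifP => _; [|case: ifP => _]; ring.
Qed.
Lemma inW_D d (j k : 'I_d) w : j != k -> inW w -> inW (opD j k w).
Proof.
move=> jk h r hr; have hS : w (word_swap_rev r j k) = 0 by apply: h; rewrite no_mid_swap_rev.
rewrite opD_coord // hS (h r hr); case: ifP => _; [|case: ifP => _]; ring.
Qed.

Lemma phi_Flip d (k : 'I_d) w : k.+1 = d -> phi (opFlip k w) = sS (phi w).
Proof.
have lett_rev x : (x.2 < n)%N -> rev_ord (lett n x) = lett n (~~ x.1, x.2).
  by move=> xn; apply: ord_inj; rewrite /= !lettE //=; case: x.1 => /=; lia.
have flipE m (j : 'I_m) (u : Vd K n m) r : opFlip j u r = u (upd r j (rev_ord (r j))).
  by rewrite ffunE.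
have vslE m y (u : Vd K n m.+1) r : vslice y u r = u (wcons y r) by rewrite ffunE.
elim: d k w => [[]|[|d] IH] // k w kd; apply/funext => -[|x [|y s]] //.
- by rewrite /sS /=; case: ifP => // xn; rewrite !vslE flipE (ord1 k) wcons0 upd0 lett_rev.
- rewrite /sS /= if_same.
  by case: s => [|z s] /=; rewrite if_same.
have [k' kE] : exists k' : 'I_d.+1, k = lift ord0 k'.
  by case: (unliftP ord0 k) => [k' ->|k0]; [exists k'|move: kd; rewrite k0].
rewrite /sS flip_cons // ![phi _ (x :: _)]sliceE !phi_slice; case: ifP => // xn.
rewrite -[RHS]/(sS _ (y :: s)) -(IH k'); last by move: kd; rewrite kE lift0; lia.
by congr (phi _ _); apply/ffunP => r; rewrite !(vslE, flipE) kE wconsS updS.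
Qed.

Lemma word_swap_wconsS d y (r : word n d) j k :
  word_swap (wcons y r) (lift ord0 j) (lift ord0 k) = wcons y (word_swap r j k).
Proof.
apply/ffunP => q; rewrite [LHS]ffunE; case: (unliftP ord0 q) => [q'|] ->.
  by rewrite [RHS]wconsS [RHS]ffunE -(inj_tperm _ _ _ (@lift_inj _ ord0)) wconsS.
by rewrite tpermD ?wcons0 // eq_sym neq_lift.
Qed.

Lemma slt_lett x y : (x.2 < n)%N -> (y.2 < n)%N -> (lett n x < lett n y)%N = slt x y.
Proof. by move=> xn yn; rewrite !lettE // /slt; case: x.1; case: y.1; lia. Qed.
Lemma eq_lett x y : (x.2 < n)%N -> (y.2 < n)%N -> (lett n x == lett n y :> nat) = (x == y).
Proof.
move=> xn yn; rewrite !lettE //; case: x y xn yn => [b c] [b' c'] /= xn yn.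
by rewrite xpair_eqE; case: b; case: b' => /=; lia.
Qed.

Lemma vslice_AS d (j k : 'I_d) y w :
  vslice y (opA (lift ord0 j) (lift ord0 k) w) = opA j k (vslice y w).
Proof.
apply/ffunP => r; rewrite ffunE !opA_coord !wconsS !word_swap_wconsS.
by rewrite /vslice !ffunE.
Qed.

Lemma phi_A d (j k : 'I_d) w : k = j.+1 :> nat -> phi (opA j k w) = sA v j (phi w).
Proof.
elim: d j k w => [[]|d IH] // j k w kj.
have [k' kE] : exists k' : 'I_d, k = lift ord0 k'.
  by case: (unliftP ord0 k) => [k' ->|k0]; [exists k'|move: kj; rewrite k0].
case: (unliftP ord0 j) => [j'|] jE.
  apply/funext => -[|x s]; first by rewrite sA_nil /= mulr0.
  have -> : nat_of_ord j = j'.+1 by rewrite jE lift0.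
  rewrite [LHS]sliceE phi_slice [RHS]/= phi_slice; case: ifP => xn; last by rewrite zero_rules.
  by rewrite kE jE vslice_AS IH //; move: kj; rewrite kE jE !lift0; lia.
case: d k' k kE j jE w kj {IH} => [[]|d] // k' k -> j -> w; rewrite lift0 /= => -[k'0].
have {k'0}-> : k' = ord0 by apply: ord_inj.
apply/funext => -[|x [|y s]]; rewrite /= ?if_same ?mulr0 //.
have [xn|_] := boolP (x.2 < n)%N; last first.
  by rewrite /= if_same; case: ifP => _; [|case: ifP => _]; ring.
have [yn|_] := boolP (y.2 < n)%N; last first.
  by rewrite /=; case: ifP => _; [|case: ifP => _]; ring.
rewrite /=.
rewrite -slt_lett // -eq_lett //.
have -> : vslice (lett n y) (vslice (lett n x) (opA ord0 (lift ord0 ord0) w)) =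
  if (lett n x < lett n y)%N then v ^+ 2 *: vslice (lett n x) (vslice (lett n y) w)
  else if lett n x == lett n y :> nat then v ^+ 2 *: vslice (lett n y) (vslice (lett n x) w)
  else (v ^+ 2 - 1) *: vslice (lett n y) (vslice (lett n x) w) +
       vslice (lett n x) (vslice (lett n y) w).
  apply/ffunP => r; rewrite !ffunE opA_coord wconsS !wcons0.
  have -> : word_swap (wcons (lett n x) (wcons (lett n y) r)) ord0 (lift ord0 ord0) =
     wcons (lett n y) (wcons (lett n x) r).
    apply/ffunP => q; rewrite ffunE; case: (unliftP ord0 q) => [q'|] ->; last first.
      by rewrite tpermL wconsS !wcons0.
    case: (unliftP ord0 q') => [q''|] ->; last by rewrite tpermR wconsS !wcons0.
    by rewrite tpermD // ?wconsS // (inj_eq lift_inj).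
  by case: ifP => _; [|case: ifP => _]; rewrite !ffunE.
case: ifP => _; first by rewrite phi_scal.
case: ifP => _; first by rewrite phi_scal.
by rewrite phi_comb.
Qed.

Lemma phi_D d (j k : 'I_d) w : k = j.+1 :> nat -> k.+1 = d -> phi (opD j k w) = sB v j (phi w).
Proof.
move=> kj kd; have jk : j != k by apply/eqP => e; move: kj; rewrite e; lia.
by rewrite opD_flip // phi_Flip // (phi_A _ kj) phi_Flip.
Qed.

Lemma ordS_val d (t : 'I_d) : (t.+1 < d)%N -> ordS t = t.+1 :> nat.
Proof. by move=> h; rewrite /= modn_small. Qed.
Lemma ord_pred_val d (t : 'I_d) : (0 < t)%N -> t = (ord_pred t).+1 :> nat.
Proof.
move=> h; have := ltn_ord t; rewrite /=.
have -> : (t + d).-1 = (t.-1 + d)%N by lia.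
by rewrite modnDr => ?; rewrite modn_small; lia.
Qed.

Lemma phi_tau d (t : 'I_d) (w : Vd K n d) : (t.+1 < d)%N -> phi (opTau v t w) = sA v t (phi w).
Proof.
move=> td; rewrite -(@phi_A _ t (ordS t)); last exact: ordS_val.
congr (phi _); rewrite /opTau /opA; congr (extend _ w); apply/funext => r.
by rewrite (_ : (_ == d) = false) //; lia.
Qed.

Lemma phi_tau_last d (t : 'I_d) (w : Vd K n d) : (0 < t)%N -> t.+1 = d ->
  phi (opTau v t w) = sB v t.-1 (phi w).
Proof.
move=> t0 td; have e := ord_pred_val t0; have -> : t.-1 = ord_pred t by lia.
rewrite -(@phi_D _ _ t) //.
congr (phi _); rewrite /opTau /opD; congr (extend _ w); apply/funext => r.
by rewrite td eqxx.
Qed.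

Lemma inW_tau d (t : 'I_d) (w : Vd K n d) : (1 < d)%N -> inW w -> inW (opTau v t w).
Proof.
move=> d1 hw; have := ltn_ord t; rewrite leq_eqVlt => /orP[/eqP td|td].
  have e : t = (ord_pred t).+1 :> nat by apply: ord_pred_val; lia.
  rewrite (_ : opTau v t w = opD (ord_pred t) t w).
    by apply: inW_D => //; apply/eqP => h; move: e; rewrite h; lia.
  by rewrite /opTau /opD; congr (extend _ w); apply/funext => r; rewrite td eqxx.
rewrite (_ : opTau v t w = opA t (ordS t) w); first exact: inW_A.
rewrite /opTau /opA; congr (extend _ w); apply/funext => r.
by rewrite (_ : (_ == d) = false) //; lia.
Qed.

End HeckeCoordinates.

Lemma zmod_linear (K : fieldType) (U V : lmodType K) (f : U -> V) :
  zmod_morphism f -> scalable f -> linear f.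
Proof.
move=> fB fZ k x y; have f0 : f 0 = 0 by rewrite -(subrr 0) fB subrr.
by rewrite -{1}(opprK y) fB -(sub0r y) fB f0 sub0r opprK fZ.
Qed.

(** * The two actions *)

Section LeftEndomorphismAlgebra.
Variables (K : fieldType) (M : vectType K).
Hypothesis M0 : (0 < dim M)%N.

(* The product of [lend_algType] is [f * g = f \o g]; that of the library's
   [lfun_algType] is the opposite one, which suits right actions. *)
Definition lend_lalgMixin := GRing.Lmodule_isLalgebra.Build K (lfun_comp_nzRingType M0)
  (fun k x y => @comp_lfunZl _ _ _ _ k x y).
Definition lend_lalgType : lalgType K :=
  HB.pack 'End(M) (lfun_comp_nzRingType M0) lend_lalgMixin.
Definition lend_algMixin := GRing.Lalgebra_isAlgebra.Build K lend_lalgType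
  (fun k x y => @comp_lfunZr _ _ _ _ k x y).
Definition lend_algType : algType K :=
  HB.pack 'End(M) lend_lalgType lend_algMixin.

Lemma Um_action_ex v n (h : Um_gen n -> lend_algType) :
  (forall x y, Um_rel v h x y -> x = y) ->
  exists rho : Um v n -> 'End(M), left_action rho /\ forall g, rho (um v g) = h g.
Proof.
move=> hr.
have hr' x y : Um_rel v (@free_gen K (Um_gen n)) x y -> free_lift h x = free_lift h y.
  move=> /(Um_rel_morph (free_lift h)).
  have -> : free_lift h \o @free_gen K _ = h by apply/funext => z; exact: free_lift_gen.
  exact: hr.
exists (@pres_lift _ _ _ h _ (@Um_proper K v n)); split; last exact: (pres_lift_gen hr').
split.
- exact: zmod_linear (@pres_lift_is_zmod_morphism _ _ _ h _ hr' (@Um_proper K v n))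
    (@pres_lift_is_scalable _ _ _ h _ hr' (@Um_proper K v n)).
- by have [] := @pres_lift_is_monoid_morphism _ _ _ h _ hr' (@Um_proper K v n).
- by have [] := @pres_lift_is_monoid_morphism _ _ _ h _ hr' (@Um_proper K v n).
Qed.

Lemma Hd_action_ex v d (h : 'I_d -> lfun_algType M0) :
  (forall x y, Hd_rel v h x y -> x = y) ->
  exists sigma : Hd v d -> 'End(M), right_action sigma /\ forall t, sigma (hd v t) = h t.
Proof.
move=> hr.
have hr' x y : Hd_rel v (@free_gen K 'I_d) x y -> free_lift h x = free_lift h y.
  move=> /(Hd_rel_morph (free_lift h)).
  have -> : free_lift h \o @free_gen K _ = h by apply/funext => z; exact: free_lift_gen.
  exact: hr.
exists (@pres_lift _ _ _ h _ (@Hd_proper K v d)); split; last exact: (pres_lift_gen hr').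
split.
- exact: zmod_linear (@pres_lift_is_zmod_morphism _ _ _ h _ hr' (@Hd_proper K v d))
    (@pres_lift_is_scalable _ _ _ h _ hr' (@Hd_proper K v d)).
- by have [] := @pres_lift_is_monoid_morphism _ _ _ h _ hr' (@Hd_proper K v d).
- by have [] := @pres_lift_is_monoid_morphism _ _ _ h _ hr' (@Hd_proper K v d).
Qed.

Local Notation B := (lfun_algType M0).

Lemma rendM (f g : B) (w : M) : (f * g : B) w = g (f w). Proof. exact: lfunE. Qed.
Lemma rendD (f g : B) (w : M) : (f + g : B) w = f w + g w. Proof. exact: lfunE. Qed.
Lemma rendZ k (f : B) (w : M) : (k *: f : B) w = k *: f w. Proof. exact: lfunE. Qed.
Lemma rend1 (w : M) : (1 : B) w = w. Proof. exact: lfunE. Qed.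

Lemma Hd_rel_pointwise v d (h : 'I_d -> B) :
  (forall i w, h i (h i w) = (v ^+ 2 - 1) *: h i w + v ^+ 2 *: w) ->
  (forall j k : 'I_d, k = j.+1 :> nat -> (k.+1 < d)%N -> forall w,
     h j (h k (h j w)) = h k (h j (h k w))) ->
  (forall i j : 'I_d, (j.+1 < i)%N -> (i.+1 < d)%N -> forall w, h j (h i w) = h i (h j w)) ->
  (forall t l : 'I_d, t.+1 = d -> l.+3 <> d -> forall w, h l (h t w) = h t (h l w)) ->
  (forall t l : 'I_d, t.+1 = d -> l.+3 = d -> forall w,
     h t (h l (h t w)) = h l (h t (h l w))) ->
  forall x y : B, Hd_rel v h x y -> x = y.
Proof.
move=> quad braid comm comm_last braid_last x y hxy; apply/lfunP => w.
case: hxy => *; rewrite ?expr2 !(rendM, rendD, rendZ, rend1); auto.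
Qed.

End LeftEndomorphismAlgebra.

(** * Defining relations and commutation, deduced from coordinates *)

Section Model.
Variables (K : fieldType) (v : K) (n d : nat).
Hypotheses (v0 : v != 0) (v2 : v - v^-1 != 0) (hn : (0 < n)%N) (hd2 : (1 < d)%N).
Variable M : vectType K.
Hypothesis M0 : (0 < dim M)%N.
Variables (Phi : M -> sfun K) (hU : Um_gen n -> 'End(M)) (hH : 'I_d -> 'End(M)).
Local Notation W := M.
Local Notation t := n.-1.

(** Since [sB k] acts on the letters in positions [k] and [k.+1], the last generator has the index
    [j.-1]. *)
Definition sTau (j : nat) (f : sfun K) : sfun K := if j.+1 == d then sB v j.-1 f else sA v j f.

Hypothesis PhiD : forall w w' s, Phi (w + w') s = Phi w s + Phi w' s.
Hypothesis PhiZ : forall k w s, Phi (k *: w) s = k * Phi w s.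
Hypothesis Phi_inj : forall w w' : M,
  (forall s, size s = d -> all (fun x : sletter => x.2 < n)%N s -> Phi w s = Phi w' s) -> w = w'.
Hypothesis Phi_U : forall g w, Phi (hU g w) = match g with
  | UE i => sE v i (Phi w) | UF i => sF v i (Phi w)
  | UH a => sH v true a (Phi w) | UHinv a => sH v false a (Phi w)
  | UT => sT v t (Phi w) | UJ e => sJ e (Phi w) end.
Hypothesis Phi_H : forall j w, Phi (hH j w) = sTau j (Phi w).

Lemma PhiN (w : W) s : Phi (- w) s = - Phi w s.
Proof. by rewrite -scaleN1r PhiZ mulN1r. Qed.
Lemma Phi0 s : Phi (0 : W) s = 0.
Proof. by rewrite -(scale0r 0) PhiZ mul0r. Qed.

Local Notation A := (lend_algType M0).

Lemma endM (f g : A) (w : W) : (f * g : A) w = f (g w). Proof. exact: lfunE. Qed.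
Lemma endD (f g : A) (w : W) : (f + g : A) w = f w + g w. Proof. exact: lfunE. Qed.
Lemma endN (f : A) (w : W) : (- f : A) w = - f w. Proof. exact: opp_lfunE. Qed.
Lemma endZ k (f : A) (w : W) : (k *: f : A) w = k *: f w. Proof. exact: lfunE. Qed.
Lemma end1 (w : W) : (1 : A) w = w. Proof. exact: lfunE. Qed.
Lemma end0 (w : W) : (0 : A) w = 0. Proof. exact: lfunE. Qed.

Lemma Um_relations (x y : A) : Um_rel v (hU : Um_gen n -> A) x y -> x = y.
Proof.
move=> h; apply/lfunP => w; apply: Phi_inj => s _ _; move: h.
pose E := (endM, endD, endN, endZ, end1, end0, PhiD, PhiN, PhiZ, Phi0, Phi_U).
case.
- by rewrite !E -{3}(sJ1 (Phi w)) /comb !mul1r.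
- move=> e f; rewrite !E sJJ; case: eqP => _; rewrite !E //.
  by rewrite /scal mul0r.
- by move=> e a; rewrite !E sJH.
- by move=> e i; rewrite !E sJE.
- by move=> e i; rewrite !E sJF.
- by move=> e; rewrite !E sJT.
- by move=> a b; rewrite !E sHH.
- by move=> a; rewrite !E (sHK v0 true).
- by move=> a; rewrite !E (sHK v0 false).
- move=> a i; rewrite !E sHE // /scal; congr (_ * _).
  have [->|ai] := eqVneq (a : nat) i; first by rewrite (_ : (_ == _) = false) //; lia.
  by case: eqP => _; rewrite ?sub0r ?subrr ?exprN1 ?expr0z.
- move=> a i; rewrite !E sHF // /scal; congr (_ * _).
  have [->|ai] := eqVneq (a : nat) i; first by rewrite (_ : (_ == _) = false) //; lia.
  by case: eqP => _; rewrite ?oppr0 ?add0r ?expr1z ?expr0z.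
- by move=> a; rewrite !E sHT.
- by move=> i a b ai bi; rewrite !E ai bi; apply: sEF.
- by move=> i j ij; rewrite !E sEF_neq ?subrr.
- by move=> i j /orP[ij|ij]; rewrite !E (sEE v0 ij).
- by move=> i j /orP[ij|ij]; rewrite !E (sFF v0 ij).
- move=> i j ij; rewrite /qserre expr2 !E; case/orP: ij => /eqP <-;
    [rewrite sSerreE_up //|rewrite sSerreE_down //]; ring.
- move=> i j ij; rewrite /qserre expr2 !E; case/orP: ij => /eqP <-;
    [rewrite sSerreF_up //|rewrite sSerreF_down //]; ring.
- by move=> i hi; rewrite !E sTE //; lia.
- by move=> i hi; rewrite !E sTF //; lia.
- move=> i hi; rewrite /qserre expr2 !E; have := sSerreET v0 v2 i s (Phi w).
  by rewrite (_ : i.+1 = t) => [->|]; [ring|lia].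
- move=> i hi; rewrite /qserre expr2 !E; have := sSerreFT v0 v2 i s (Phi w).
  by rewrite (_ : i.+1 = t) => [->|]; [ring|lia].
- move=> i hi; rewrite /qserre expr2 !E; have := sSerreTE v0 v2 i s (Phi w).
  by rewrite (_ : i.+1 = t) => [->|]; [ring|lia].
- move=> i hi; rewrite /qserre expr2 !E; have := sSerreTF v0 v2 i s (Phi w).
  by rewrite (_ : i.+1 = t) => [->|]; [ring|lia].
Qed.

Lemma Phi_last (j : 'I_d) w : j.+1 = d :> nat -> Phi (hH j w) = sB v j.-1 (Phi w).
Proof. by move=> jd; rewrite Phi_H /sTau {1}jd eqxx. Qed.
Lemma Phi_init (j : 'I_d) w : (j.+1 < d)%N -> Phi (hH j w) = sA v j (Phi w).
Proof. by move=> jd; rewrite Phi_H /sTau (ltn_eqF jd). Qed.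

Local Notation B := (lfun_algType M0).

Lemma Hd_relations (x y : B) : Hd_rel v (hH : 'I_d -> B) x y -> x = y.
Proof.
have ext (u u' : W) : (forall s, size s = d -> Phi u s = Phi u' s) -> u = u'.
  by move=> h; apply: Phi_inj => s ss _; apply: h.
apply: Hd_rel_pointwise => [i w|j k kj kd w|i j ji id w|m l md ld w|m l md ld w];
  apply: ext => s ss.
- rewrite PhiD !PhiZ !Phi_H /sTau.
  by case: (i.+1 == d); [apply: sB_quad|apply: sA_quad].
- have jd : (j.+1 < d)%N by lia.
  rewrite (Phi_init (hH k _) jd) (Phi_init (hH j w) kd) (Phi_init w jd).
  rewrite (Phi_init (hH j _) kd) (Phi_init (hH k w) jd) (Phi_init w kd).
  by rewrite kj sA_braid //; lia.
- have jd : (j.+1 < d)%N by lia.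
  rewrite (Phi_init (hH i w) jd) (Phi_init w id) (Phi_init (hH j w) id) (Phi_init w jd).
  by rewrite sA_comm.
- have [->//|lm] := eqVneq l m.
  have {}lm : (l : nat) <> m by move=> e; move/eqP: lm; apply; apply: ord_inj.
  have lt_ld : (l.+1 < d)%N by have := ltn_ord l; lia.
  rewrite (Phi_init (hH m w) lt_ld) (Phi_last w md) (Phi_last (hH l w) md) (Phi_init w lt_ld).
  (* Either the two generators act on the same two positions, or [l] is far enough below them; the
     remaining neighbour is excluded by [ld]. *)
  have [lm'|lm'] := eqVneq (l : nat) m.-1; first by rewrite lm' sA_B_comm_last //; lia.
  by rewrite sA_B_comm //; lia.
- have lt_ld : (l.+1 < d)%N by lia.
  rewrite (Phi_last (hH l _) md) (Phi_init (hH m w) lt_ld) (Phi_last w md).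
  rewrite (Phi_init (hH m _) lt_ld) (Phi_last (hH l w) md) (Phi_init w lt_ld).
  by rewrite (_ : m.-1 = l.+1) ?sB_braid //; lia.
Qed.

Lemma all_flip s : all (fun x : sletter => x.2 < n)%N (flip s) = all (fun x : sletter => x.2 < n)%N s.
Proof. by elim: s => [|x [|y s] IH] //; rewrite flip_cons // [LHS]/= IH. Qed.

Lemma commute_generators g j (w : W) : hH j (hU g w) = hU g (hH j w).
Proof.
apply: Phi_inj => s ss sa; rewrite Phi_H !Phi_U Phi_H /sTau; case: ifP => jd; last first.
  case: g => [i|i|a|a||e]; rewrite ?sA_E ?sA_F ?sA_H ?sA_J //.
  by rewrite sA_T //; apply: sub_all sa => x; lia.
case: g => [i|i|a|a||e]; rewrite /sB.
- by rewrite [in LHS]sS_E sA_E // sS_E.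
- by rewrite [in LHS]sS_F sA_F // sS_F.
- by rewrite [in LHS]sS_H sA_H sS_H.
- by rewrite [in LHS]sS_H sA_H sS_H.
- rewrite sS_T [LHS]/sS sA_T //; last by move: sa; rewrite -all_flip; apply: sub_all => x; lia.
  by rewrite -sS_T.
(* Each [sS] exchanges J_+ and J_-; the two occurrences of [sS] in [sB] cancel. *)
have s0 m : size m = d -> (0 < size m)%N by move=> ->; lia.
rewrite -[in RHS](negbK e) -sS_J ?s0 // [LHS]/sS [RHS]/sS -sA_J.
by apply: local_A => m sm; rewrite sS_J // s0 // sm size_flip.
Qed.

End Model.

(** * The operators on W *)

Section Actions.
Variables (K : fieldType) (v : K) (n d : nat).
Hypotheses (v0 : v != 0) (v2 : v - v^-1 != 0) (hn : (0 < n)%N) (hd2 : (1 < d)%N).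
Local Notation W := (subvs_of (Wd K n d)).

Lemma inW_vec (r : word n d) : no_mid r -> inW (vec K r).
Proof. by move=> hr s hs; rewrite ffunE; case: eqP hs => // ->; rewrite hr. Qed.

Lemma memWd (w : Vd K n d) : reflect (inW w) (w \in Wd K n d).
Proof.
apply: (iffP idP) => [/coord_span ->|hw].
  apply: (big_ind (@inW K n d)) => [||i _]; [exact: inW0|exact: inWD|apply: inWZ].
  have hi : (i < size [seq vec K r | r in @no_mid n d])%N by rewrite size_image.
  by have /imageP[r hr ->] := mem_nth 0 hi; apply: inW_vec.
rewrite [w]Vd_sum; apply: memv_suml => r _.
have [hr|/hw ->] := boolP (no_mid r); last by rewrite scale0r mem0v.
by apply/memvZ/memv_span/image_f.
Qed.

Lemma inW_val (w : W) : inW (vsval w). Proof. exact/memWd/subvsP. Qed.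

(* Locked, because unification would otherwise unfold the vector space structure. *)
Definition resW (X : {linear Vd K n d -> Vd K n d}) : 'End(W) :=
  locked (linfun (vsproj (Wd K n d) \o X \o vsval)).

Lemma resWE (X : {linear Vd K n d -> Vd K n d}) w :
  (forall w, inW w -> inW (X w)) -> vsval (resW X w) = X (vsval w).
Proof. by move=> h; rewrite /resW -lock lfunE /= vsprojK //; apply/memWd/h/inW_val. Qed.

Definition Phi (w : W) : sfun K := phi (vsval w).

Lemma phi_size m (w : Vd K n m) s : (size s != m) || ~~ all (fun x : sletter => x.2 < n)%N s ->
  phi w s = 0.
Proof.
elim: m w s => [|m IH] w [|x s] //=.
by case: ifP => //= xn; rewrite eqSS => hs; apply: IH.
Qed.

Lemma Phi_inj (w w' : W) :
  (forall s, size s = d -> all (fun x : sletter => x.2 < n)%N s -> Phi w s = Phi w' s) -> w = w'.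
Proof.
move=> h; apply/subvs_inj/phi_inj; try exact: inW_val.
apply/funext => s.
have [/eqP ss|ss] := boolP (size s == d); last by rewrite !phi_size ?ss.
by have [sa|sa] := boolP (all (fun x : sletter => x.2 < n)%N s); [apply: h|rewrite !phi_size // sa orbT].
Qed.

Definition hU (g : Um_gen n) : 'End(W) :=
  match g with
  | UE i => resW (opE v i.+1)
  | UF i => resW (opF v i.+1)
  | UH a => resW (opH v a.+1)
  | UHinv a => resW (opHinv v a.+1)
  | UT => resW (@opT K v n d)
  | UJ e => resW (@opJ K n d e)
  end.

Local Notation t := n.-1.

Lemma hUE g w : vsval (hU g w) = match g with
  | UE i => opE v i.+1 (vsval w) | UF i => opF v i.+1 (vsval w)
  | UH a => opH v a.+1 (vsval w) | UHinv a => opHinv v a.+1 (vsval w)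
  | UT => opT v (vsval w) | UJ e => opJ e (vsval w) end.
Proof.
case: g => [i|i|a|a||e]; rewrite /hU resWE // => u hu.
- by apply: inW_E => //; have := ltn_ord i; lia.
- by apply: inW_F => //; have := ltn_ord i; lia.
- exact: inW_H.
- exact: inW_Hinv.
- by apply: (inW_T v0 v2 (t := t)) => //; rewrite prednK.
- exact: inW_J.
Qed.

Lemma Phi_U g w : Phi (hU g w) = match g with
  | UE i => sE v i (Phi w) | UF i => sF v i (Phi w)
  | UH a => sH v true a (Phi w) | UHinv a => sH v false a (Phi w)
  | UT => sT v t (Phi w) | UJ e => sJ e (Phi w) end.
Proof.
rewrite /Phi hUE; case: g => [i|i|a|a||e].
- by apply: phi_E => //; have := ltn_ord i; lia.
- by apply: phi_F => //; have := ltn_ord i; lia.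
- exact: phi_H (ltn_ord a).
- exact: phi_Hinv (ltn_ord a).
- by apply: phi_T => //; [rewrite prednK|exact: inW_val].
- exact: phi_J.
Qed.

(** The endomorphisms form a ring with 1 != 0 only if W is nonzero. The constant word in the first
    letter is a witness, as this letter is not the middle one for n > 0. *)
Lemma dimW_gt0 : (0 < dim (subvs_of (Wd K n d)))%N.
Proof.
suff : \dim (Wd K n d) != 0 by rewrite lt0n.
pose r : word n d := [ffun=> ord0].
have hr : no_mid r by apply/forallP => j; rewrite ffunE eqSS eq_sym -lt0n.
rewrite dimv_eq0; apply/eqP => W0; have : vec K r \in Wd K n d by apply/memWd/inW_vec.
by rewrite W0 memv0 => /eqP/ffunP/(_ r); rewrite !ffunE eqxx => /eqP; rewrite oner_eq0.
Qed.

Lemma PhiD (w w' : W) s : Phi (w + w') s = Phi w s + Phi w' s.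
Proof. by rewrite /Phi /= phiD /comb !mul1r. Qed.
Lemma PhiZ k (w : W) s : Phi (k *: w) s = k * Phi w s.
Proof. by rewrite /Phi /= phi_scal. Qed.

Definition hH (j : 'I_d) : 'End(W) := resW (opTau v j).

Lemma hHE j w : vsval (hH j w) = opTau v j (vsval w).
Proof. by rewrite resWE // => u; apply: inW_tau. Qed.

Lemma Phi_H j w : Phi (hH j w) = sTau v d j (Phi w).
Proof.
rewrite /Phi hHE /sTau; have := ltn_ord j; rewrite leq_eqVlt => /orP[/eqP jd|jd].
  by rewrite {1}jd eqxx phi_tau_last //; lia.
by rewrite phi_tau // (ltn_eqF jd).
Qed.

End Actions.

(** The level [c] of both signed letters (+, c) and (-, c); the middle letter has level [n]. *)
Definition lev n (x : 'I_n.*2.+1) : nat := minn x (n.*2 - x).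

Lemma lev_rev n (x : 'I_n.*2.+1) : lev (rev_ord x) = lev x.
Proof. by rewrite /lev /=; have := ltn_ord x; lia. Qed.

(** * Descents and the standard basis of the Hecke algebra *)

Section NatSteps.
Variable n : nat.
Local Open Scope nat_scope.
Implicit Types (f : nat -> nat) (e t s k : nat).

(** The action of the reflections of type D on the positions of a word of length e+2, the index e+1
    being the last generator. With functions on [nat] all the rank-two identities become linear
    arithmetic; the bound [f k <= n.*2] used below keeps the subtractions from being truncated. *)
Definition stepn e t f : nat -> nat := fun k =>
  if t == e.+1 then if k == e then n.*2 - f e.+1 else if k == e.+1 then n.*2 - f e else f k
  else if k == t then f t.+1 else if k == t.+1 then f t else f k.

Definition descn e t f : bool :=
  if t == e.+1 then n.*2 < f e + f e.+1 else f t.+1 < f t.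

(** For s < t, the edges of the diagram of type D: the chain 0, ..., e, and the node e+1 attached to
    e-1. *)
Definition braided e s t : bool :=
  ((t == s.+1) && (t <= e)) || ((t == e.+1) && (s.+1 == e)).

Lemma step_comm e s t f k : s < t <= e.+1 -> ~~ braided e s t ->
  stepn e s (stepn e t f) k = stepn e t (stepn e s f) k.
Proof.
rewrite /braided => st; rewrite negb_or !negb_and => /andP[b1 b2].
rewrite /stepn; have [te|te] := eqVneq t e.+1.
  subst t; have -> : (s == e.+1) = false by lia.
  by repeat (nat_order_case; cbv iota); try lia; repeat f_equal; lia.
have -> : (s == e.+1) = false by lia.
by repeat (nat_order_case; cbv iota); try lia; repeat f_equal; lia.
Qed.

Lemma desc_comm e s t f : s < t <= e.+1 -> ~~ braided e s t -> (forall k, f k <= n.*2) ->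
  (descn e t (stepn e s f) = descn e t f) * (descn e s (stepn e t f) = descn e s f).
Proof.
rewrite /braided => st; rewrite negb_or !negb_and => /andP[b1 b2] fn.
have f1 := fn e; have f2 := fn e.+1.
rewrite /stepn /descn; have [te|te] := eqVneq t e.+1.
  subst t; have -> : (s == e.+1) = false by lia.
  have [se|se] := eqVneq s e; first subst s.
    by split; repeat (nat_order_case; cbv iota); try lia; repeat f_equal; lia.
  by split; repeat (nat_order_case; cbv iota); try lia; repeat f_equal; lia.
have -> : (s == e.+1) = false by lia.
by split; repeat (nat_order_case; cbv iota); try lia; repeat f_equal; lia.
Qed.

Lemma step_braid e s t f k : braided e s t -> s < t -> (forall k, f k <= n.*2) ->
  stepn e s (stepn e t (stepn e s f)) k = stepn e t (stepn e s (stepn e t f)) k.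
Proof.
move=> b st fn; have f1 := fn e; have f2 := fn e.+1; have f3 := fn s.
case/orP: b => /andP[/eqP-> /= b].
  rewrite /stepn; have [-> ->] : (s.+1 == e.+1) = false /\ (s == e.+1) = false by split; lia.
  by repeat (nat_order_case; cbv iota); try lia; repeat f_equal; lia.
move/eqP: b => b; subst e; rewrite /stepn eqxx (_ : (s == s.+2) = false); last lia.
by repeat (nat_order_case; cbv iota); try lia; repeat f_equal; lia.
Qed.

Lemma desc_braid e s t f : braided e s t -> s < t -> (forall k, f k <= n.*2) ->
  descn e s f -> descn e t f ->
  [/\ descn e t (stepn e s f), descn e s (stepn e t (stepn e s f)),
      descn e s (stepn e t f) & descn e t (stepn e s (stepn e t f))].
Proof.
move=> b st fn; have f1 := fn e; have f2 := fn e.+1; have f3 := fn s.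
case/orP: b => /andP[/eqP-> /= b].
  rewrite /stepn /descn; have [-> ->] : (s.+1 == e.+1) = false /\ (s == e.+1) = false by split; lia.
  by split; repeat (nat_order_case; cbv iota); try lia; repeat f_equal; lia.
move/eqP: b => b; subst e; rewrite /stepn /descn eqxx (_ : (s == s.+2) = false); last lia.
by split; repeat (nat_order_case; cbv iota); try lia; repeat f_equal; lia.
Qed.

Definition ascn e t f : bool :=
  if t == e.+1 then f e + f e.+1 < n.*2 else f t < f t.+1.

Lemma asc_step e t f : t <= e.+1 -> (forall k, f k <= n.*2) ->
  (descn e t (stepn e t f) = ascn e t f) * (ascn e t (stepn e t f) = descn e t f).
Proof.
move=> te fn; have f1 := fn e; have f2 := fn e.+1.
by rewrite /descn /ascn /stepn; split; repeat (nat_order_case; cbv iota); try lia; repeat f_equal; lia.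
Qed.

Lemma stepnK e t f k : t <= e.+1 -> (forall k, f k <= n.*2) -> stepn e t (stepn e t f) k = f k.
Proof.
move=> te fn; have f1 := fn e; have f2 := fn e.+1.
by rewrite /stepn; repeat (nat_order_case; cbv iota); try lia; repeat f_equal; lia.
Qed.

End NatSteps.

Section RelationDescent.
Variables (K : fieldType) (v : K) (A B : lalgType K) (phi : {lrmorphism A -> B}).
Let phi0 : phi 0 = 0. Proof. exact: rmorph0. Qed.
Let phi1 : phi 1 = 1. Proof. exact: rmorph1. Qed.
Let phiD x y : phi (x + y) = phi x + phi y. Proof. exact: rmorphD. Qed.
Let phiN x : phi (- x) = - phi x. Proof. exact: rmorphN. Qed.
Let phiM x y : phi (x * y) = phi x * phi y. Proof. exact: rmorphM. Qed.
Let phiZ a x : phi (a *: x) = a *: phi x. Proof. exact: linearZ. Qed.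
Let phiE := (phi0, phi1, phiZ, phiD, phiN, phiM, expr2).

Lemma Hd_rel_descent d (g : 'I_d -> A) :
  (forall x y, Hd_rel v g x y -> phi x = phi y) ->
  forall x y, Hd_rel v (phi \o g) x y -> x = y.
Proof.
move=> h x y; case=> [i|j k kj kd|i j ji id|t l td ld|t l td ld].
- by have := h _ _ (Hd_quad v g i); rewrite !phiE.
- by have := h _ _ (Hd_braid v g kj kd); rewrite !phiE.
- by have := h _ _ (Hd_comm v g ji id); rewrite !phiE.
- by have := h _ _ (Hd_comm_last v g td ld); rewrite !phiE.
- by have := h _ _ (Hd_braid_last v g td ld); rewrite !phiE.
Qed.

Lemma Um_EF_descent n (g : Um_gen n -> A) :
  (forall x y, Um_rel v g x y -> phi x = phi y) ->
  forall (i : 'I_n.-1) (a b : 'I_n), a = i :> nat -> b = i.+1 :> nat ->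
  phi (g (UE i)) * phi (g (UF i)) - phi (g (UF i)) * phi (g (UE i)) =
  (v - v^-1)^-1 *: (phi (g (UH a)) * phi (g (UHinv b)) - phi (g (UHinv a)) * phi (g (UH b))).
Proof. by move=> h i a b ai bi; have := h _ _ (Um_EF_eq v g ai bi); rewrite !phiE. Qed.

End RelationDescent.

Lemma pres_rel (K : fieldType) (X : choiceType) (rels : free_alg K X -> free_alg K X -> Prop)
  (pr : ~ rel_ideal rels 1) x y : rels x y -> pres_pi pr x = pres_pi pr y.
Proof.
by move=> xy; apply/pres_piP; rewrite -[_ - _]mul1r -[_ * _]mulr1; apply: rel_ideal_gen.
Qed.

Section HeckeWords.
Variables (K : fieldType) (v : K) (n e : nat).
Local Notation d := e.+2.
Local Notation H := (Hd v d).
Local Notation tau := (@hd K v d).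
Implicit Types (r : word n d) (s t : 'I_d) (h : H).

Lemma hd_rel x y : Hd_rel v tau x y -> x = y.
Proof.
apply: (Hd_rel_descent (phi := pres_pi (@Hd_proper K v d)) (g := @free_gen K 'I_d)).
exact: pres_rel.
Qed.

Definition stepw t r : word n d :=
  if t.+1 == d then word_swap_rev r (ord_pred t) t else word_swap r t (ordS t).
Definition gw r : nat -> nat := fun k => if (k < d)%N then r (inord k) : nat else 0%N.
Definition wdesc t r := descn n e t (gw r).

Lemma gw_le r k : (gw r k <= n.*2)%N.
Proof. by rewrite /gw; case: ifP => // _; rewrite -ltnS. Qed.
Lemma gwE r t : gw r t = r t :> nat.
Proof. by rewrite /gw ltn_ord inord_val. Qed.
Lemma gw_inj r r' : gw r = gw r' -> r = r'.
Proof. by move=> rr; apply/ffunP => t; apply: ord_inj; rewrite -!gwE rr. Qed.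

Lemma gw_stepw t r : gw (stepw t r) = stepn n e t (gw r).
Proof.
apply/funext => k; have [kd|kd] := ltnP k d; last first.
  rewrite /gw ltnNge kd /= /stepn; have := ltn_ord t => td.
  rewrite !(ltnNge _ d) !kd /=.
  by repeat (nat_order_case; cbv iota); try lia.
have -> : gw (stepw t r) k = stepw t r (inord k) by rewrite /gw kd.
have [tl|tl] := eqVneq t.+1 d.
  rewrite /stepn /stepw tl eqxx; case: tl => tl; rewrite tl eqxx ffunE.
  have pt : ord_pred t = inord e.
    by apply: ord_inj; rewrite inordK //; have := @ord_pred_val _ t; rewrite tl; lia.
  have tt : t = inord e.+1 by apply: ord_inj; rewrite inordK.
  rewrite pt tt -!val_eqE /= !inordK //.
  by case: eqP => [_|_]; [|case: eqP => [_|_]]; rewrite ?rev_ordK /= /gw ?ltnSn ?kd ?leqnn ?ltnS ?leqnSn //= subSS.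
have td : (t.+1 < d)%N by have := ltn_ord t; lia.
rewrite /stepn /stepw (negPf tl) (_ : (_ == e.+1) = false) ?ffunE; last by lia.
have st : ordS t = inord t.+1 by apply: ord_inj; rewrite ordS_val // inordK.
have tt : t = inord t by rewrite inord_val.
case: tpermP => [kt|kt|kt kt'].
- by rewrite st /gw td -kt inordK // eqxx.
- have {}kt : k = t.+1 by move: (congr1 val kt); rewrite /= modn_small // inordK.
  by rewrite kt (_ : (_ == _) = false) ?eqxx ?gwE //; lia.
- have -> : (k == t) = false by apply/eqP => kE; apply: kt; rewrite kE inord_val.
  have -> : (k == t.+1) = false by apply/eqP => kE; apply: kt'; rewrite kE st.
  by rewrite /gw kd.
Qed.

Definition wasc t r := ascn n e t (gw r).
Let le_t t : (t <= e.+1)%N. Proof. by have := ltn_ord t. Qed.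

Lemma stepwK t : involutive (stepw t).
Proof.
move=> r; apply/gw_inj/funext => k; rewrite !gw_stepw stepnK //; exact: gw_le.
Qed.
Lemma wdesc_step t r : wdesc t (stepw t r) = wasc t r.
Proof. by rewrite /wdesc gw_stepw asc_step //; apply: gw_le. Qed.
Lemma wasc_step t r : wasc t (stepw t r) = wdesc t r.
Proof. by rewrite /wasc gw_stepw asc_step //; apply: gw_le. Qed.

Lemma tau_commute s t : (s < t)%N -> ~~ braided e s t -> tau s * tau t = tau t * tau s.
Proof.
rewrite /braided negb_or !negb_and => st /andP[b1 b2]; apply/esym/hd_rel.
have := le_t t; rewrite leq_eqVlt => /orP[/eqP te|te].
  by apply: Hd_comm_last; [rewrite te|lia].
by apply: Hd_comm; lia.
Qed.
Lemma tau_braid s t : (s < t)%N -> braided e s t ->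
  tau s * tau t * tau s = tau t * tau s * tau t.
Proof.
move=> st /orP[]/andP[/eqP e1 e2]; first by apply: hd_rel; apply: Hd_braid => //; lia.
by apply/esym/hd_rel; apply: Hd_braid_last; [rewrite e1|move/eqP: e2; lia].
Qed.
Lemma tau_quad t : tau t * tau t = (v ^+ 2 - 1) *: tau t + v ^+ 2 *: 1.
Proof. by apply: hd_rel; rewrite -expr2; apply: Hd_quad. Qed.

(* Two descents commute, or generate a dihedral group of order 6. *)
Lemma two_descents s t r : s != t -> wdesc s r -> wdesc t r ->
  [/\ tau s * tau t = tau t * tau s, stepw s (stepw t r) = stepw t (stepw s r) &
      wdesc t (stepw s r) && wdesc s (stepw t r)] \/
  [/\ tau s * tau t * tau s = tau t * tau s * tau t,
      stepw s (stepw t (stepw s r)) = stepw t (stepw s (stepw t r)),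
      wdesc t (stepw s r) && wdesc s (stepw t (stepw s r)) &
      wdesc s (stepw t r) && wdesc t (stepw s (stepw t r))].
Proof.
have main (a b : 'I_d) u : (a < b)%N -> wdesc a u -> wdesc b u ->
  [/\ tau a * tau b = tau b * tau a, stepw a (stepw b u) = stepw b (stepw a u) &
      wdesc b (stepw a u) && wdesc a (stepw b u)] \/
  [/\ tau a * tau b * tau a = tau b * tau a * tau b,
      stepw a (stepw b (stepw a u)) = stepw b (stepw a (stepw b u)),
      wdesc b (stepw a u) && wdesc a (stepw b (stepw a u)) &
      wdesc a (stepw b u) && wdesc b (stepw a (stepw b u))].
  move=> ab da db; have ab' : (a < b <= e.+1)%N by rewrite ab /=.
  have [br|br] := boolP (braided e a b); [right|left]; split.
  - exact: tau_braid.
  - by apply/gw_inj/funext => k; rewrite !gw_stepw step_braid //; apply: gw_le.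
  - by have [] := desc_braid br ab (gw_le u) da db; rewrite /wdesc !gw_stepw => -> ->.
  - by have [] := desc_braid br ab (gw_le u) da db; rewrite /wdesc !gw_stepw => _ _ -> ->.
  - exact: tau_commute.
  - by apply/gw_inj/funext => k; rewrite !gw_stepw step_comm.
  - by rewrite /wdesc !gw_stepw !(desc_comm ab' br (gw_le u)); apply/andP.
rewrite -val_eqE /= neq_ltn => /orP[st|ts] ds dt; first exact: main.
case: (main _ _ _ ts dt ds) => -[e1 e2 d1]; last by right; split; [exact: esym e1|exact: esym e2|..].
by left; split; [exact: esym e1|exact: esym e2|rewrite andbC].
Qed.

(** A termination measure for sorting. A descent moves the larger letter to the smaller weight. For
    the last generator the weights are 2 and 1, and letters x, y with x + y > 2n become 2n-y, 2n-x,
    which lowers the sum by 3(x + y - 2n). *)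
Definition height r : nat := (\sum_(j < d) (d - j) * r j)%N.

Lemma height_step t r : wdesc t r -> (height (stepw t r) < height r)%N.
Proof.
pose a := if t.+1 == d then ord_pred t else t; pose b := if t.+1 == d then t else ordS t.
have ab : a != b.
  rewrite /a /b; case: (t.+1 =P d) => td; apply/eqP => /(congr1 (@nat_of_ord _)).
    by have := @ord_pred_val _ t; lia.
  by rewrite ordS_val; have := ltn_ord t; lia.
have off j : j != a -> j != b -> stepw t r j = r j.
  rewrite /a /b /stepw; case: ifP => _ ja jb; rewrite ffunE; last by rewrite tpermD // eq_sym.
  by rewrite (negPf ja) (negPf jb).
have split2 (F : 'I_d -> nat) : (\sum_j F j = F a + F b + \sum_(j | (j != a) && (j != b)) F j)%N.
  by rewrite (bigD1 a) //= (bigD1 b) 1?eq_sym //= addnA.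
rewrite /height !split2 [X in (_ + X < _)%N](eq_bigr (fun j : 'I_d => (d - j) * r j)%N); last first.
  by move=> j /andP[ja jb]; rewrite off.
rewrite ltn_add2r /wdesc /descn; have := ltn_ord t; have := ltn_ord (r a); have := ltn_ord (r b).
rewrite /a /b /stepw eqSS.
case: (t =P e.+1 :> nat) => te hb ha _.
  have pt : ord_pred t = e :> nat by have := @ord_pred_val _ t; lia.
  have hp : (ord_pred t == t) = false by apply/eqP => h; move: pt; rewrite h te; lia.
  have -> : gw r e = r (ord_pred t) by rewrite -gwE pt.
  have -> : gw r e.+1 = r t by rewrite -gwE te.
  have revE (x : 'I_n.*2.+1) : rev_ord x = (n.*2 - x)%N :> nat by rewrite /= subSS.
  rewrite !ffunE !eqxx (eq_sym t) hp !revE.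
  have -> : (d - ord_pred t = 2)%N by lia.
  have -> : (d - t = 1)%N by lia.
  lia.
have st : ordS t = t.+1 :> nat by apply: ordS_val; have := le_t t; lia.
have -> : gw r t.+1 = r (ordS t) by rewrite -gwE st.
rewrite !ffunE tpermL tpermR gwE => h.
have -> : (d - t = (d - ordS t).+1)%N by have := le_t t; lia.
by rewrite !mulSn; lia.
Qed.

Variable r0 : word n d.
Hypothesis r0_min : forall t, ~~ wdesc t r0.

(* [reached r h]: [h] is the standard basis element of [H] carrying [r0] to [r]. *)
Inductive reached : word n d -> H -> Prop :=
| reached0 : reached r0 1
| reachedS r h t of reached r h & wasc t r : reached (stepw t r) (h * tau t).

(* The exchange property; it replaces Matsumoto's theorem. *)
Lemma reached_desc r h t : reached r h -> wdesc t r ->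
  exists2 h', reached (stepw t r) h' & h = h' * tau t.
Proof.
have [m] := ubnP (height r); elim: m r h t => // m IH r h t hm rh.
case: r h / rh hm => [_ dt|r1 h1 s rh1 as1]; first by have := r0_min t; rewrite dt.
set r := stepw s r1 => hm dt; have ds : wdesc s r by rewrite wdesc_step.
have r1E : r1 = stepw s r by rewrite stepwK.
have IH' u k : (height u < height r)%N -> reached u k -> forall p, wdesc p u ->
    exists2 h', reached (stepw p u) h' & k = h' * tau p.
  by move=> ur uk p dp; apply: IH dp => //; lia.
have [st|st] := eqVneq s t; first by subst t; exists h1 => //; rewrite -r1E.
have hr1 : (height r1 < height r)%N by rewrite r1E height_step.
(* Both [s] and [t] are descents of [r]. The induction hypothesis at [r1], and once more below it in
   the braid case, exhibits one side of the relation between [tau s] and [tau t] as a right factor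
   of the element; the other side ends in [tau t]. *)
have [[c1 c2 /andP[d1 d2]]|[c1 c2 /andP[d1 d2] /andP[d3 d4]]] := two_descents st ds dt.
  rewrite -r1E in d1 c2.
  have [h2 rh2 ->] := IH' _ _ hr1 rh1 _ d1.
  exists (h2 * tau s); last by rewrite -!mulrA c1.
  rewrite -[stepw t r](stepwK s) c2; apply: reachedS rh2 _.
  by rewrite -c2 wasc_step.
rewrite -r1E in d1 d2 c2.
have [h2 rh2 ->] := IH' _ _ hr1 rh1 _ d1.
have hr2 : (height (stepw t r1) < height r)%N by apply: ltn_trans hr1; apply: height_step.
have [h3 rh3 ->] := IH' _ _ hr2 rh2 _ d2.
exists (h3 * tau t * tau s); last by have := congr1 (fun x => h3 * x) c1; rewrite !mulrA.
have e1 : stepw t (stepw s (stepw t r1)) = stepw s (stepw t r) by rewrite c2 stepwK.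
rewrite -[stepw t r](stepwK s) -e1; apply: reachedS.
  by apply: reachedS rh3 _; rewrite c2 wasc_step.
by rewrite e1 wasc_step.
Qed.

(** The last generator of one derivation is a descent of the word, so [reached_desc] splits it off
    from the other element too, and induction applies to what remains. *)
Lemma reached_uniq r h h' : reached r h -> reached r h' -> h = h'.
Proof.
move=> rh; elim: rh h' => [h'|r1 h1 t rh1 IH at1 h' rh'].
  move eqr: {1}r0 => q rq; case: q h' / rq eqr => // q1 k1 t1 _ ar e1.
  by have := r0_min t1; rewrite e1 wdesc_step ar.
have dt : wdesc t (stepw t r1) by rewrite wdesc_step.
by have [h2] := reached_desc rh' dt; rewrite stepwK => /IH-> ->.
Qed.

Lemma lev_stepw t r : exists a b, a != b /\ forall j, lev (stepw t r j) = lev (r (tperm a b j)).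
Proof.
have := le_t t; rewrite leq_eqVlt => /orP[/eqP te|te]; rewrite /stepw eqSS.
  rewrite te eqxx; have pt : ord_pred t != t.
    by apply/eqP => h; have := @ord_pred_val _ t; rewrite h te; lia.
  exists (ord_pred t), t; split=> // j; rewrite ffunE.
  case: tpermP => [->|->|/eqP jp /eqP jt]; rewrite ?eqxx ?lev_rev //.
    by rewrite eq_sym (negPf pt) lev_rev.
  by rewrite (negPf jp) (negPf jt).
rewrite (ltn_eqF te); exists t, (ordS t); split=> [|j]; last by rewrite ffunE.
by apply/eqP => /(congr1 (@nat_of_ord _)); rewrite ordS_val //; lia.
Qed.

(** Distinct levels mean that no reflection fixes the word, so every generator is either an ascent
    or a descent. *)
Definition regular r := injective (fun j => lev (r j)).

Lemma regular_step t r : regular r -> regular (stepw t r).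
Proof.
have [a [b [ab ht]]] := lev_stepw t r.
by move=> h i j; rewrite !ht => /h; apply: perm_inj.
Qed.

Lemma no_tie t r : regular r -> ~~ wasc t r -> wdesc t r.
Proof.
move=> h; rewrite /wasc /wdesc /ascn /descn; have := le_t t => lt.
case: (t =P e.+1 :> nat) => te; rewrite -leqNgt leq_eqVlt => /orP[/eqP eq|//].
  have pt : ord_pred t = e :> nat by have := @ord_pred_val _ t; lia.
  have e1 : gw r e = r (ord_pred t) by rewrite -gwE pt.
  have e2 : gw r e.+1 = r t by rewrite -gwE te.
  suff /h tt : lev (r (ord_pred t)) = lev (r t) by move: pt; rewrite tt te; lia.
  by rewrite /lev -e1 -e2; have := gw_le r e; have := gw_le r e.+1; lia.
have st : ordS t = t.+1 :> nat by apply: ordS_val; lia.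
have e1 : gw r t.+1 = r (ordS t) by rewrite -gwE st.
suff /h tt : lev (r (ordS t)) = lev (r t) by move: st; rewrite tt; lia.
by rewrite /lev -e1 eq gwE.
Qed.

Hypothesis r0_reg : regular r0.

Lemma reached_regular r h : reached r h -> regular r.
Proof. by elim=> // r1 h1 t _ IH _; apply: regular_step. Qed.

(** The standard basis element of the group element taking [r0] to [r]. Words that are not reached
    get 0, so that linear combinations may run over all words. *)
Definition std r : H := if pselect (exists h, reached r h) is left ex then sval (cid ex) else 0.

Lemma stdE r h : reached r h -> std r = h.
Proof.
move=> rh; rewrite /std; case: pselect => [ex|[]]; last by exists h.
exact: reached_uniq (svalP (cid ex)) rh.
Qed.

Lemma std_tau t r h : reached r h -> exists c : word n d -> K, h * tau t = \sum_(q : word n d) c q *: std q.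
Proof.
move=> rh; have single q k : reached q k -> k = \sum_u (u == q)%:R *: std u.
  move=> sk; rewrite (bigD1 q) //= big1 ?addr0 => [|u us].
    by rewrite eqxx scale1r (stdE sk).
  by rewrite (negPf us) scale0r.
have [at_|na] := boolP (wasc t r).
  by eexists; apply: single; apply: reachedS rh at_.
have [dt|nd] := boolP (wdesc t r).
  (* At a descent [h] ends in [tau t], so the quadratic relation expresses [h * tau t] by [h] and
     [h']. *)
  have [h' rh' hE] := reached_desc rh dt.
  exists (fun q => (v ^+ 2 - 1) * (q == r)%:R + v ^+ 2 * (q == stepw t r)%:R).
  rewrite (eq_bigr (fun q => (v ^+ 2 - 1) *: ((q == r)%:R *: std q) + v ^+ 2 *: ((q == stepw t r)%:R *: std q))).
    rewrite big_split -!scaler_sumr /= -(single _ _ rh) -(single _ _ rh').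
    by rewrite {1}hE -mulrA tau_quad mulrDr -!scalerAr mulr1 -hE.
  by move=> q _; rewrite scalerDl !scalerA.
by have := no_tie (reached_regular rh) na; rewrite (negPf nd).
Qed.

(** The span of the standard elements contains 1 and is stable under right multiplication by the
    generators. *)
Lemma std_span h : exists c : word n d -> K, h = \sum_(q : word n d) c q *: std q.
Proof.
pose S (x : H) := exists c : word n d -> K, x = \sum_(q : word n d) c q *: std q.
have SD x y : S x -> S y -> S (x + y).
  move=> [c ->] [c' ->]; exists (fun q => c q + c' q); rewrite -big_split.
  by apply: eq_bigr => q _; rewrite scalerDl.
have SZ a x : S x -> S (a *: x).
  move=> [c ->]; exists (fun q => a * c q); rewrite scaler_sumr.
  by apply: eq_bigr => q _; rewrite scalerA.
have S0 : S 0 by exists (fun=> 0); rewrite big1 // => q _; rewrite scale0r.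
have Stau x t : S x -> S (x * tau t).
  move=> [c ->]; rewrite mulr_suml; apply: (big_ind S) => // q _.
  rewrite -scalerAl; apply: SZ; have [[k sk]|nsk] := pselect (exists k, reached q k).
    by rewrite (stdE sk); apply: std_tau sk.
  by rewrite /std; case: pselect => // _; rewrite mul0r.
suff h1 x : S x -> S (x * h).
  rewrite -[h]mul1r; apply: h1; exists (fun q => (q == r0)%:R); rewrite (bigD1 r0) //= big1 ?addr0.
    by rewrite eqxx scale1r (stdE reached0).
  by move=> q sr; rewrite (negPf sr) scale0r.
move: h x; apply: pres_ind => [x|h h' Sh Sh' x|a h Sh x|g h Sh x].
- by rewrite mulr1.
- by rewrite mulrDr => Sx; apply: SD; [apply: Sh|apply: Sh'].
- by rewrite -scalerAr => Sx; apply/SZ/Sh.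
- by rewrite mulrA => Sx; apply/Sh/Stau.
Qed.

End HeckeWords.

(** * Levels and weights *)

Section Letters.
Variables (n d : nat).
Local Notation L := 'I_n.*2.+1.
Implicit Types (x y : L) (r s : word n d) (j : 'I_d).

(** The effect of E on a single letter: one step towards the middle from either side, so the level
    grows. [dn] is the corresponding step for F. *)
Definition up x : L := if (x < n)%N then inord x.+1 else inord x.-1.
Definition dn x : L := if (x < n)%N then inord x.-1 else inord x.+1.

Lemma lev_up x : (lev x < n)%N -> lev (up x) = (lev x).+1.
Proof.
rewrite /lev /up; have := ltn_ord x.
by case: ifP => xn xb ln; rewrite inordK; lia.
Qed.
Lemma lev_dn x : (0 < lev x)%N -> lev (dn x) = (lev x).-1.
Proof.
rewrite /lev /dn; have := ltn_ord x.
by case: ifP => xn xb ln; rewrite inordK; lia.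
Qed.
Lemma up_val x : (x < n)%N -> up x = x.+1 :> nat.
Proof. by move=> xn; rewrite /up xn inordK; lia. Qed.
Lemma dn_val x : dn x = (if (x < n)%N then x.-1 else inord x.+1 : L) :> nat.
Proof. by rewrite /dn; have := ltn_ord x; case: ifP => // xn xb; rewrite inordK; lia. Qed.
Lemma half_up x : (lev x).+1 != n -> x != n :> nat -> (n <= up x)%N = (n <= x)%N.
Proof.
rewrite /lev /up; have := ltn_ord x.
by case: ifP => xn xb ln xm; rewrite inordK; lia.
Qed.
Lemma half_dn x : (0 < lev x)%N -> x != n :> nat -> (n <= dn x)%N = (n <= x)%N.
Proof.
rewrite /lev /dn; have := ltn_ord x.
by case: ifP => xn xb ln xm; rewrite inordK; lia.
Qed.

Lemma dn_up x : ((lev x).+1 < n)%N -> dn (up x) = x.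
Proof.
move=> l0; apply: ord_inj; have := ltn_ord x; move: l0; rewrite /lev /up /dn.
case: (ltnP x n) => xn l0 xb.
  by rewrite [in X in (X < n)%N]inordK ?ifT ?inordK; lia.
by rewrite [in X in (X < n)%N]inordK ?ifF ?inordK; lia.
Qed.

Lemma no_midE r : no_mid r = [forall j, (lev (r j) < n)%N].
Proof. by apply: eq_forallb => j; rewrite /lev; have := ltn_ord (r j); lia. Qed.

Lemma mult_lev a r : (a < n)%N -> mult_at a r = (\sum_j (lev (r j) == a))%N.
Proof.
move=> an; apply: eq_bigr => j _; have := ltn_ord (r j); rewrite /lev; lia.
Qed.

Lemma sum_upd (g : L -> nat) r j y :
  (\sum_i g (upd r j y i) + g (r j) = \sum_i g (r i) + g y)%N.
Proof.
rewrite (bigD1 j) // [in RHS](bigD1 j) //= ffunE eqxx.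
rewrite (eq_bigr (fun i => g (r i))) => [|i ij]; last by rewrite ffunE (negPf ij).
by rewrite -addnA addnC [(_ + g (r j))%N]addnC.
Qed.

Lemma mult_upd a r j y : (a < n)%N ->
  (mult_at a (upd r j y) + (lev (r j) == a) = mult_at a r + (lev y == a))%N.
Proof. by move=> an; rewrite !mult_lev // (sum_upd (fun x => lev x == a : nat)). Qed.

Lemma mult_gt0 a r j : (a < n)%N -> lev (r j) = a -> (0 < mult_at a r)%N.
Proof. by move=> an ja; rewrite mult_lev // (bigD1 j) //= ja eqxx. Qed.
Lemma mult_eq0 a r j : (a < n)%N -> mult_at a r = 0%N -> lev (r j) != a.
Proof. by move=> an m0; apply/eqP => ja; have := mult_gt0 an ja; rewrite m0. Qed.
Lemma mult_mem a r : (a < n)%N -> (0 < mult_at a r)%N -> exists j, lev (r j) = a.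
Proof.
move=> an; rewrite mult_lev // lt0n sum_nat_eq0 negb_forall => /existsP[j].
by rewrite /= eqb0 negbK => /eqP ja; exists j.
Qed.
Lemma mult1_uniq a r i j : (a < n)%N -> mult_at a r = 1%N -> lev (r i) = a -> lev (r j) = a -> i = j.
Proof.
move=> an m1 ia ja; apply/eqP; apply: contraT => ij; move: m1; rewrite mult_lev //.
by rewrite (bigD1 i) //= (bigD1 j) 1?eq_sym //= ia ja !eqxx.
Qed.
Lemma mult_le a r : (a < n)%N -> (mult_at a r <= d)%N.
Proof.
move=> an; rewrite mult_lev // (@leq_trans (\sum_(j < d) 1)%N) //; last by rewrite sum1_card card_ord.
by apply: leq_sum => j _; case: (_ == _).
Qed.

Lemma npar_sum r : npar r = (\sum_j (n <= r j))%N.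
Proof.
by rewrite /npar -sum1dep_card big_mkcond; apply: eq_bigr => j _; rewrite ltnS; case: leqP.
Qed.
Lemma npar_upd r j y : (npar (upd r j y) + (n <= r j) = npar r + (n <= y))%N.
Proof. by rewrite !npar_sum (sum_upd (fun x : L => (n <= x) : nat)). Qed.

(** Equality of the joint eigenvalues of the H_a and of J_+, J_-; the classes index the weight
    spaces of W. *)
Definition same s r := [forall a : 'I_n, mult_at a r == mult_at a s] && (odd (npar r) == odd (npar s)).

Lemma sameP s r : reflect ((forall a, (a < n)%N -> mult_at a r = mult_at a s) /\
  odd (npar r) = odd (npar s)) (same s r).
Proof.
apply: (iffP andP) => [[/forallP h /eqP p]|[h p]]; split=> //; last 1 first.
- by rewrite p.
- by move=> a an; have /eqP := h (Ordinal an).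
by apply/forallP => a; apply/eqP/h.
Qed.
Lemma no_mid_upd r j y : no_mid r -> (lev y < n)%N -> no_mid (upd r j y).
Proof.
rewrite !no_midE => /forallP hr hy; apply/forallP => i; rewrite ffunE.
by case: ifP.
Qed.
Lemma no_mid_lev r j : no_mid r -> (lev (r j) < n)%N.
Proof. by rewrite no_midE => /forallP. Qed.
Lemma same_refl s : same s s. Proof. exact/sameP. Qed.
Lemma same_eq s s' : same s s' -> same s =1 same s'.
Proof.
move=> /sameP[ms ps] r; by apply/sameP/sameP => -[mr pr]; split=> [a an|]; rewrite ?pr ?ps // mr // ms.
Qed.
Lemma same_sym s r : same s r = same r s.
Proof. by apply/sameP/sameP => -[mr pr]; split=> // a an; rewrite mr. Qed.

Lemma same_upd s r i j y y' : same s r -> lev (s i) = lev (r j) -> lev y = lev y' ->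
  (n <= y)%N (+) (n <= s i)%N = (n <= y')%N (+) (n <= r j)%N ->
  same (upd s i y) (upd r j y').
Proof.
move=> /sameP[ms ps] ij yy hp; apply/sameP; split=> [a an|].
  by have := mult_upd s i y an; have := mult_upd r j y' an; rewrite ij yy ms // => <- /addIn.
have /(congr1 odd) := npar_upd s i y; have /(congr1 odd) := npar_upd r j y'.
rewrite !oddD ps !oddb => h1 h2.
by rewrite -[LHS](addbK (n <= r j)%N) h1 -[RHS](addbK (n <= s i)%N) h2 -!addbA hp.
Qed.

Definition below b r : nat := (\sum_j (lev (r j) < b))%N.

Lemma below_mono r : {homo below^~ r : b c / (b <= c)%N}.
Proof. by move=> b c bc; apply: leq_sum => j _; case: ltnP => // lb; rewrite (leq_trans lb). Qed.
Lemma below0 r : below 0 r = 0%N. Proof. by rewrite /below big1. Qed.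
Lemma below_n r : no_mid r -> below n r = d.
Proof.
move=> hr; rewrite /below (eq_bigr (fun=> 1%N)) ?sum1_card ?card_ord // => j _.
by rewrite no_mid_lev.
Qed.
Lemma belowS b r : (b < n)%N -> below b.+1 r = (below b r + mult_at b r)%N.
Proof.
move=> bn; rewrite mult_lev // /below -big_split; apply: eq_bigr => j _ /=.
by rewrite ltnS leq_eqVlt; case: ltngtP.
Qed.
Lemma below_upd b r j y : (below b (upd r j y) + (lev (r j) < b) = below b r + (lev y < b))%N.
Proof. exact: (sum_upd (fun x => (lev x < b)%N : nat)). Qed.

End Letters.

Lemma ltn_sum_at n (f g : nat -> nat) k : (k < n)%N -> (forall b, b != k -> f b = g b) ->
  (f k < g k)%N -> (\sum_(b < n) f b < \sum_(b < n) g b)%N.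
Proof.
move=> kn fg fk; rewrite (bigD1 (Ordinal kn)) //= [X in (_ < X)%N](bigD1 (Ordinal kn)) //=.
by rewrite (eq_bigr (fun b : 'I_n => g b)) ?ltn_add2r // => i ik; apply: fg.
Qed.

(** * The double centralizer property *)

(* [N b] counts the letters of level less than [b], [t] is its value for the
   target word. *)
Section Moves.
Variables (N t : nat -> nat) (n : nat).
Hypotheses (Nmono : {homo N : a b / (a <= b)%N}) (N0 : N 0 = 0%N).
Hypotheses (tmono : {homo t : a b / (a <= b)%N}) (tstep : forall b, (t b.+1 <= (t b).+1)%N).
Hypothesis (Nn : N n = t n).

(** Take the last [m] with a surplus. As [t] grows by at most 1 per step, [N] is constant from [m]
    to [m.+1]; the beginning of this plateau is [b'.+1]. Level [b'] is then occupied and level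
    [b'.+1] empty, so a letter can be raised, which reduces the surplus at [b'.+1]. *)
Lemma surplus_move b : (b <= n)%N -> (t b < N b)%N ->
  exists b', [/\ (b'.+1 < n)%N, (t b'.+1 < N b'.+1)%N, (N b' < N b'.+1)%N & N b'.+2 = N b'.+1].
Proof.
move=> bn hb; pose P k := (k <= n)%N && (t k < N k)%N.
have exP : exists k, P k by exists b; rewrite /P bn.
case: (ex_maxnP exP (m := n)) => [k /andP[]//|m /andP[mn hm] mmax].
have {}mn : (m < n)%N.
  by move: mn; rewrite leq_eqVlt => /orP[/eqP mE|//]; move: hm; rewrite mE Nn ltnn.
have e1 : N m.+1 = N m.
  apply/eqP; rewrite eqn_leq [X in _ && X]Nmono // andbT leqNgt; apply/negP => lt.
  have : P m.+1 by rewrite /P mn (leq_ltn_trans _ lt) //; have := tstep m; lia.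
  by move/mmax; rewrite ltnn.
have exQ : exists k, N k == N m by exists m.
case: (ex_minnP exQ) => k /eqP hk kmin.
have km : (k <= m)%N by apply: kmin.
case: k hk kmin km => [|k] hk kmin km; first by move: hm; rewrite -hk N0.
exists k; split; rewrite ?hk.
- exact: leq_ltn_trans km mn.
- by apply: leq_ltn_trans hm; apply: tmono.
- rewrite ltn_neqAle -{2}hk Nmono // andbT; apply/negP => /kmin; rewrite ltnn //.
- by apply/eqP; rewrite eqn_leq -{2}hk [X in _ && X]Nmono // andbT -e1 Nmono.
Qed.

(** The mirror argument: from the first deficit follow the plateau of [N] to its end. There an empty
    level lies just below an occupied one, so a letter can be lowered. *)
Lemma deficit_move b : (b <= n)%N -> t 0 = 0%N -> (N b < t b)%N ->
  exists b', [/\ (b'.+1 < n)%N, (N b'.+1 < t b'.+1)%N, (N b'.+1 < N b'.+2)%N & N b'.+1 = N b'].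
Proof.
move=> bn t0 hb; pose P k := (N k < t k)%N.
have exP : exists k, P k by exists b.
case: (ex_minnP exP) => -[|m] hm mmin; first by move: hm; rewrite /P t0.
have mn : (m.+1 < n)%N.
  have := leq_trans (mmin _ hb) bn; rewrite leq_eqVlt => /orP[/eqP mE|//].
  by move: hm; rewrite /P mE Nn ltnn.
have e1 : N m.+1 = N m.
  apply/eqP; rewrite eqn_leq [X in _ && X]Nmono // andbT leqNgt; apply/negP => lt.
  by have := tstep m; have : ~~ P m by [apply/negP => /mmin; rewrite ltnn]; rewrite /P in hm *; lia.
pose Q k := (m.+1 <= k)%N && (N k == N m.+1).
have exQ : exists k, Q k by exists m.+1; rewrite /Q leqnn eqxx.
have Qb k : Q k -> (k <= n)%N.
  case/andP=> _ /eqP hk; rewrite leqNgt; apply/negP => nk.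
  have := Nmono (ltnW nk); rewrite hk Nn; have := tmono (ltnW mn); rewrite /P in hm; lia.
case: (ex_maxnP exQ Qb) => k /andP[mk /eqP hk] kmax.
case: k mk hk kmax => // k mk hk kmax; exists k.
have tk : (N k.+1 < t k.+1)%N by rewrite hk; apply: leq_trans hm _; apply: tmono.
split=> //.
- have := Qb k.+1; rewrite /Q mk hk eqxx => /(_ isT); rewrite leq_eqVlt => /orP[/eqP kn|//].
  by move: tk; rewrite kn Nn ltnn.
- rewrite ltn_neqAle Nmono // andbT; apply/eqP => h; have := kmax k.+2.
  by rewrite /Q -h hk eqxx ltnn (leq_trans mk) // => /(_ isT).
- move: mk; rewrite ltnS leq_eqVlt => /orP[/eqP <-//|mk].
  by apply/eqP; rewrite eqn_leq [X in _ && X]Nmono // hk Nmono.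
Qed.

End Moves.

(** * The two commutants on a module with a basis of words *)

Section DoubleCentralizer.
Variables (K : fieldType) (v : K) (n e : nat) (M : vectType K).
Local Notation d := e.+2.
Hypotheses (v0 : v != 0) (v2 : v - v^-1 != 0) (vroot : forall k, (0 < k)%N -> v ^+ k != 1).
Hypothesis ledn : (d <= n)%N.
Local Notation L := 'I_n.*2.+1.
Local Notation word := (word n d).
Implicit Types (r s : word) (j : 'I_d) (a b : nat) (f g : 'End(M)) (h : Hd v d).

Variable ev : word -> M.
Hypothesis ev_span : forall m, exists c : word -> K, m = \sum_(r | no_mid r) c r *: ev r.
Hypothesis ev_free : forall c : word -> K,
  \sum_(r | no_mid r) c r *: ev r = 0 -> forall r, no_mid r -> c r = 0.

Variables (E F H Hi : nat -> 'End(M)) (T : 'End(M)) (J : 'End(M)).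
Hypothesis E_ev : forall a r, (a.+1 < n)%N -> no_mid r -> exists c : 'I_d -> K,
  (forall j, c j != 0) /\
  E a (ev r) = \sum_(j | lev (r j) == a) c j *: ev (upd r j (up (r j))).
Hypothesis F_ev : forall a r, (a.+1 < n)%N -> no_mid r -> exists c : 'I_d -> K,
  (forall j, c j != 0) /\
  F a (ev r) = \sum_(j | lev (r j) == a.+1) c j *: ev (upd r j (dn (r j))).
Hypothesis H_ev : forall a r, (a < n)%N -> no_mid r -> H a (ev r) = v ^- mult_at a r *: ev r.
Hypothesis Hi_ev : forall a r, (a < n)%N -> no_mid r -> Hi a (ev r) = v ^+ mult_at a r *: ev r.
Hypothesis J_ev : forall r, no_mid r -> J (ev r) = (~~ odd (npar r))%:R *: ev r.
Hypothesis T_ev : forall r j, no_mid r -> mult_at n.-1 r = 1%N -> lev (r j) = n.-1 ->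
  T (ev r) = ev (upd r j (rev_ord (r j))).
Hypothesis EF_rel : forall a m, (a.+1 < n)%N ->
  E a (F a m) - F a (E a m) = (v - v^-1)^-1 *: (H a (Hi a.+1 m) - Hi a (H a.+1 m)).

Variable inU : 'End(M) -> Prop.
Hypothesis inU1 : inU \1%VF.
Hypothesis inU_comp : forall f g, inU f -> inU g -> inU (f \o g)%VF.
Hypothesis inU_add : forall f g, inU f -> inU g -> inU (f + g).
Hypothesis inU_scale : forall k f, inU f -> inU (k *: f).
Hypothesis inU_E : forall a, (a.+1 < n)%N -> inU (E a).
Hypothesis inU_F : forall a, (a.+1 < n)%N -> inU (F a).
Hypothesis inU_Hi : forall a, (a < n)%N -> inU (Hi a).
Hypothesis inU_T : inU T.
Hypothesis inU_J : inU J.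

Variable sigma : Hd v d -> 'End(M).
Hypothesis sigma_act : right_action sigma.
Hypothesis sigma_ev : forall t r, no_mid r ->
  sigma (hd v t) (ev r) = if wasc t r then ev (stepw t r)
    else if wdesc t r then (v ^+ 2 - 1) *: ev r + v ^+ 2 *: ev (stepw t r)
    else v ^+ 2 *: ev r.
Hypothesis inU_comm : forall f h m, inU f -> sigma h (f m) = f (sigma h m).

Lemma inU0 : inU 0. Proof. by rewrite -(scale0r \1%VF); apply: inU_scale. Qed.
Lemma inU_sub f g : inU f -> inU g -> inU (f - g).
Proof. by move=> hf hg; rewrite -scaleN1r; apply: inU_add => //; apply: inU_scale. Qed.

Lemma sigmaM h h' m : sigma (h * h') m = sigma h' (sigma h m).
Proof. by case: sigma_act => _ _ ->; rewrite comp_lfunE. Qed.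
Lemma sigma1 m : sigma 1 m = m.
Proof. by case: sigma_act => _ -> _; rewrite id_lfunE. Qed.
Lemma sigmaP k h h' : sigma (k *: h + h') = k *: sigma h + sigma h'.
Proof. by case: sigma_act => l _ _; rewrite l. Qed.
Lemma sigma0 : sigma 0 = 0.
Proof. by have := sigmaP (-1) 0 0; rewrite scaler0 addr0 scaleN1r addNr. Qed.
Lemma sigmaD h h' : sigma (h + h') = sigma h + sigma h'.
Proof. by rewrite -{1}[h]scale1r sigmaP scale1r. Qed.
Lemma sigmaZ k h : sigma (k *: h) = k *: sigma h.
Proof. by rewrite -[k *: h]addr0 sigmaP sigma0 addr0. Qed.

Lemma ev_ext f g : (forall r, no_mid r -> f (ev r) = g (ev r)) -> f = g.
Proof.
move=> h; apply/lfunP => m; have [c ->] := ev_span m; rewrite !linear_sum.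
by apply: eq_bigr => r hr; rewrite !linearZ /= h.
Qed.

Definition diag (c : word -> K) :=
  exists2 f, inU f & forall r, no_mid r -> f (ev r) = c r *: ev r.

Lemma diag_ext c c' : (forall r, no_mid r -> c r = c' r) -> diag c -> diag c'.
Proof. by move=> h [f hf fE]; exists f => // r hr; rewrite fE // h. Qed.
Lemma diag1 : diag (fun=> 1).
Proof. by exists \1%VF => // r hr; rewrite id_lfunE scale1r. Qed.
Lemma diagM c c' : diag c -> diag c' -> diag (fun r => c r * c' r).
Proof.
move=> [f hf fE] [g hg gE]; exists (f \o g)%VF => [|r hr]; first exact: inU_comp.
by rewrite comp_lfunE gE // linearZ /= fE // scalerA mulrC.
Qed.
Lemma diagP k c l c' : diag c -> diag c' -> diag (fun r => k * c r + l * c' r).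
Proof.
move=> [f hf fE] [g hg gE]; exists (k *: f + l *: g) => [|r hr].
  by apply: inU_add; apply: inU_scale.
by rewrite add_lfunE !scale_lfunE fE // gE // !scalerA -scalerDl.
Qed.
Lemma diag_prod (I : Type) (l : seq I) (P : pred I) (c : I -> word -> K) :
  (forall i, P i -> diag (c i)) -> diag (fun r => \prod_(i <- l | P i) c i r).
Proof.
move=> hc; elim: l => [|i l IH].
  by apply: diag_ext diag1 => r _; rewrite big_nil.
case Pi: (P i); last by apply: diag_ext IH => r _; rewrite big_cons Pi.
by apply: diag_ext (diagM (hc _ Pi) IH) => r _; rewrite big_cons Pi.
Qed.

Lemma vpow_inj k m : v ^+ k = v ^+ m -> k = m.
Proof.
wlog km : k m / (k <= m)%N => [hw|].
  by have [?|/ltnW ?] := leqP k m; [apply: hw|move/esym/hw => ->].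
move=> h; apply/eqP; rewrite eqn_leq km /= -subn_eq0 eqn0Ngt; apply/negP => /vroot/eqP; apply.
by apply: (mulfI (expf_neq0 k v0)); rewrite -exprD subnKC // mulr1.
Qed.

Lemma diag_mult a k : (a < n)%N -> diag (fun r => (mult_at a r == k)%:R).
Proof.
(* [c m] is the Lagrange factor (x - v^m)/(v^k - v^m) at x = v^(mult_at a r), in the affine form
   that [diagP] expects; the multiplicities 0, ..., d give the nodes. *)
move=> an; pose c m r := (v ^+ k - v ^+ m)^-1 * v ^+ mult_at a r + - (v ^+ m / (v ^+ k - v ^+ m)) * 1.
have cE m r : c m r = (v ^+ mult_at a r - v ^+ m) / (v ^+ k - v ^+ m).
  by rewrite /c mulr1 mulrC mulrBl.
have dc m : diag (c m).
  by apply: diagP; [exists (Hi a); [apply: inU_Hi|move=> r; apply: Hi_ev]|exact: diag1].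
apply: diag_ext (diag_prod (iota 0 d.+1) (P := fun m => m != k) (fun m _ => dc m)) => r hr.
case: eqP => [mk|/eqP mk].
  rewrite big1 // => m mk'; rewrite cE mk divff // subr_eq0.
  by apply: contra mk' => /eqP/vpow_inj->.
have im : mult_at a r \in iota 0 d.+1 by rewrite mem_iota /= add0n ltnS mult_le.
by rewrite (big_rem _ im) mk /= cE subrr !mul0r.
Qed.

Definition proj s f := forall r, no_mid r -> f (ev r) = (same s r)%:R *: ev r.

Lemma proj_ex s : exists2 p, inU p & proj s p.
Proof.
have dJ (x : bool) : diag (fun r => (odd (npar r) == x)%:R).
  case: x; last by exists J => // r hr; rewrite J_ev //; case: odd.
  exists (\1%VF - J) => [|r hr]; first exact: inU_sub.
  rewrite add_lfunE opp_lfunE id_lfunE J_ev //; case: odd; rewrite ?scale0r ?subr0 ?scale1r ?subrr //.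
have dM := diag_prod (index_enum 'I_n) (P := xpredT)
  (fun (i : 'I_n) _ => diag_mult (mult_at i s) (ltn_ord i)).
have [f hf fE] := diagM dM (dJ (odd (npar s))); exists f => // r hr; rewrite fE //; congr (_ *: _).
rewrite /same; case: forallP => [h|h] /=.
  by rewrite big1 ?mul1r // => a _; rewrite h.
have [a ha] : exists a : 'I_n, mult_at a r != mult_at a s.
  by apply/existsP; rewrite -negb_forall; apply/forallP.
by rewrite (bigD1 a) //= (negPf ha) !mul0r.
Qed.

(** E_a raises the only letter of level a; then F_a may lower either of the two letters of level
    a+1. So F_a E_a maps [ev r] to a combination of itself and the exchanged word, with a nonzero
    coefficient at the latter, which can be solved for. *)
Lemma swap_ex a r (i j : 'I_d) : (a.+1 < n)%N -> no_mid r ->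
  mult_at a r = 1%N -> mult_at a.+1 r = 1%N -> lev (r i) = a -> lev (r j) = a.+1 ->
  exists2 f, inU f & f (ev r) = ev (upd (upd r i (up (r i))) j (dn (r j))).
Proof.
move=> an hr m0 m1 ia ja.
have ij : i != j by apply/eqP => ij; move: ja; rewrite -ij ia; lia.
set r1 := upd r i (up (r i)).
have li : lev (up (r i)) = a.+1 by rewrite lev_up ?ia //; lia.
have hr1 : no_mid r1 by apply: no_mid_upd => //; rewrite li.
have r1j : r1 j = r j by rewrite ffunE eq_sym (negPf ij).
have r1i : r1 i = up (r i) by rewrite ffunE eqxx.
have [c [c0 Er]] := E_ev an hr; have [c' [c'0 Fr]] := F_ev an hr1.
have {}Er : E a (ev r) = c i *: ev r1.
  rewrite Er (big_pred1 i) // => k; apply/eqP/eqP => [ka|->//].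
  exact: mult1_uniq (ltnW an) m0 ka ia.
have {}Fr : F a (ev r1) = c' i *: ev r + c' j *: ev (upd r1 j (dn (r j))).
  rewrite Fr (bigD1 i) /=; last by rewrite r1i li.
  rewrite (big_pred1 j) => [|k] /=.
    rewrite r1j r1i dn_up ?ia //; congr (_ *: ev _ + _).
    by apply/ffunP => k; rewrite !ffunE; case: eqP => // ->.
  have [->|kj] := eqVneq k j; first by rewrite r1j ja eqxx eq_sym ij.
  have [->|ki] := eqVneq k i; first by rewrite andbF.
  apply/negbTE; rewrite andbT ffunE (negPf ki); apply/eqP => ka; move/eqP: kj; apply.
  exact: mult1_uniq an m1 ka ja.
exists ((c i * c' j)^-1 *: ((F a \o E a)%VF - (c i * c' i) *: \1%VF)).
  apply/inU_scale/inU_sub; last exact: inU_scale.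
  by apply: inU_comp; [apply: inU_F|apply: inU_E].
rewrite scale_lfunE add_lfunE opp_lfunE scale_lfunE id_lfunE comp_lfunE Er linearZ /= Fr.
by rewrite [c i *: _]scalerDr !scalerA addrAC subrr add0r scalerA mulVf ?scale1r // mulf_neq0.
Qed.

Definition r0 : word := [ffun j : 'I_d => inord (n - d + j)].

Lemma r0E j : r0 j = (n - d + j)%N :> nat.
Proof. by rewrite ffunE inordK //; have := ltn_ord j; lia. Qed.
Lemma lev_r0 j : lev (r0 j) = (n - d + j)%N.
Proof. by rewrite /lev r0E; have := ltn_ord j; lia. Qed.
Lemma no_mid_r0 : no_mid r0.
Proof. by rewrite no_midE; apply/forallP => j; rewrite lev_r0; have := ltn_ord j; lia. Qed.
Lemma gw_r0 k : (k < d)%N -> gw r0 k = (n - d + k)%N.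
Proof. by move=> kd; rewrite /gw kd r0E inordK. Qed.
Lemma wasc_r0 t : wasc t r0.
Proof.
have := ltn_ord t; rewrite /wasc /ascn => td; case: eqP => te.
  by rewrite !gw_r0 //; lia.
by rewrite !gw_r0 //; lia.
Qed.
Lemma r0_min t : ~~ wdesc t r0.
Proof.
have := wasc_r0 t; rewrite /wasc /wdesc /ascn /descn; case: eqP => _; rewrite -leqNgt; lia.
Qed.
Lemma r0_reg : regular r0.
Proof. by move=> i j; rewrite !lev_r0 => h; apply: ord_inj; lia. Qed.
Lemma mult_r0 a : (a < n)%N -> mult_at a r0 = (n - d <= a)%N.
Proof.
move=> an; rewrite mult_lev //; case: leqP => da.
  have jd : (a - (n - d) < d)%N by lia.
  rewrite (bigD1 (Ordinal jd)) //= lev_r0 big1 /= => [|i].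
    by rewrite (_ : (_ == _) = true) //; lia.
  by rewrite -val_eqE /= lev_r0 => h; apply/eqP; rewrite eqb0; lia.
by rewrite big1 // => i _; apply/eqP; rewrite lev_r0 eqb0; lia.
Qed.
Lemma npar_r0 : npar r0 = 0%N.
Proof. by rewrite npar_sum big1 // => j _; rewrite r0E; have := ltn_ord j; lia. Qed.

Lemma no_mid_stepw t r : no_mid r -> no_mid (stepw t r).
Proof.
have [i [j [_ h]]] := lev_stepw t r.
by rewrite !no_midE => /forallP hr; apply/forallP => k; rewrite h.
Qed.

Lemma mult_stepw t r a : (a < n)%N -> mult_at a (stepw t r) = mult_at a r.
Proof.
move=> an; have [i [j [_ h]]] := lev_stepw t r; rewrite !mult_lev //.
by rewrite [RHS](reindex_inj (@perm_inj _ (tperm i j))) /=; apply: eq_bigr => k _; rewrite h.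
Qed.

Lemma reached_ev r h : reached r0 r h -> no_mid r /\ sigma h (ev r0) = ev r.
Proof.
elim=> [|r1 h1 t _ [hr1 hE] at1]; first by rewrite sigma1; split=> //; apply: no_mid_r0.
by rewrite sigmaM hE sigma_ev // at1; split=> //; apply: no_mid_stepw.
Qed.

(** The standard elements span and carry [ev r0] to distinct basis vectors, so an element killing
    [ev r0] has zero coefficients on the reached words. *)
Lemma sigma_inj : injective sigma.
Proof.
suff h0 h : sigma h = 0 -> h = 0.
  move=> h h' e1; apply/eqP; rewrite -subr_eq0; apply/eqP/h0.
  by rewrite -scaleN1r addrC sigmaP e1 scaleN1r addNr.
have [c hE] := std_span r0_min r0_reg h => s0.
(* The coefficients at words that are not reached are arbitrary, since [std] is 0 there; they are
   reset to 0 before freeness is applied. *)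
pose c' (q : word) : K := if pselect (exists k : Hd v d, reached r0 q k) then c q else 0.
have := congr1 (fun f : 'End(M) => f (ev r0)) s0; rewrite zero_lfunE hE.
have sum (P : pred word) : sigma (\sum_(q | P q) c q *: std v r0 q) = \sum_(q | P q) c q *: sigma (std v r0 q).
  rewrite (big_morph sigma sigmaD sigma0); apply: eq_bigr => q _; exact: sigmaZ.
rewrite sum sum_lfunE.
rewrite (eq_bigr (fun q => c' q *: ev q)) => [|q _]; last first.
  rewrite scale_lfunE /c'; case: pselect => [[k rk]|nk] /=.
    by rewrite (stdE r0_min rk); have [_ ->] := reached_ev rk.
  by rewrite /std; case: pselect => // _; rewrite sigma0 zero_lfunE scaler0 scale0r.
have c'0 q : ~~ no_mid q -> c' q = 0.
  rewrite /c'; case: pselect => // -[k rk] /=.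
  by have [-> _] := reached_ev rk.
rewrite (bigID (@no_mid n d)) /= [X in _ + X]big1 ?addr0 => [/ev_free c0|q /c'0->]; last exact: scale0r.
apply: big1 => q _; have [hq|/c'0] := boolP (no_mid q); first have := c0 _ hq.
  by rewrite /c' /std; case: pselect => [ex /= ->|_ _]; rewrite ?scale0r ?scaler0.
by rewrite /c' /std; case: pselect => [ex /= ->|_ _]; rewrite ?scale0r ?scaler0.
Qed.

(** The weight of [r0] makes the levels of [s] distinct and at least n-d. Without descents the
    letters therefore increase strictly and all but the last lie below the middle; even parity puts
    the last one there as well. Then d increasing letters in an interval of d values leave no
    choice. *)
Lemma sorted_r0 s : no_mid s -> same r0 s -> (forall t, ~~ wdesc t s) -> s = r0.
Proof.
move=> hs /sameP[ms ps] nd.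
have uniq i j : lev (s i) = lev (s j) -> i = j.
  move=> ij; have li := no_mid_lev i hs; have m1 : mult_at (lev (s i)) s = 1%N.
    by have := mult_gt0 li erefl; rewrite ms // mult_r0 //; case: (n - d <= _)%N.
  exact: mult1_uniq li m1 erefl (esym ij).
have low j : (n - d <= lev (s j))%N.
  have lj := no_mid_lev j hs; rewrite leqNgt; apply/negP => lt.
  have := mult_gt0 lj erefl; rewrite ms // mult_r0 //; lia.
pose g := gw s; have gE j : g j = s j := gwE s j.
have gl j : (n - d <= minn (g j) (n.*2 - g j) < n)%N by rewrite gE; have := low j; have := no_mid_lev j hs; rewrite /lev; lia.
have gl' k : (k < d)%N -> (n - d <= minn (g k) (n.*2 - g k) < n)%N by move=> kd; have := gl (Ordinal kd).
have gu k l : (k < d)%N -> (l < d)%N -> minn (g k) (n.*2 - g k) = minn (g l) (n.*2 - g l) -> k = l.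
  move=> kd ld; have := uniq (Ordinal kd) (Ordinal ld); rewrite /lev -!gE /= => h /h.
  by move/(congr1 val).
have g_le k : (k <= e)%N -> (g k <= g k.+1)%N.
  move=> ke; have kd : (k < d)%N by lia.
  by have := nd (Ordinal kd); rewrite /wdesc /descn /= (_ : (k == e.+1) = false) -?leqNgt //; lia.
have g_last : (g e + g e.+1 <= n.*2)%N.
  by have := nd (Ordinal (ltnSn e.+1)); rewrite /wdesc /descn /= eqxx -leqNgt.
have g_lt k : (k <= e)%N -> (g k < g k.+1)%N.
  move=> ke; rewrite ltn_neqAle g_le // andbT; apply/eqP => h.
  by have := gu k k.+1; rewrite -h; lia.
have ge : (g e < n)%N by have := g_le e; have := gl' e; lia.
have g_add k l : (k + l <= e.+1)%N -> (g k + l <= g (k + l))%N.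
  elim: l => [|l IH] kl; first by rewrite !addn0.
  by have := IH; have := g_lt (k + l)%N; rewrite !addnS; lia.
(* Otherwise the last letter would be the only one beyond the middle, and the parity would be
   odd. *)
have g_top : (g e.+1 < n)%N.
  rewrite ltnNge; apply/negP => ng; move: ps; rewrite npar_r0 npar_sum (bigD1 ord_max) //= -gE ng.
  rewrite big1 // => j; rewrite -val_eqE /= -gE => je; apply/eqP; rewrite eqb0 -ltnNge.
  by have jd := ltn_ord j; have := g_add j (e - j)%N; rewrite subnKC; lia.
apply/ffunP => j; apply: ord_inj; rewrite r0E -gE.
have h1 := g_add 0%N j; have h2 := g_add j (e.+1 - j)%N; have jd := ltn_ord j.
have h3 := gl' 0%N isT; rewrite subnKC in h2; last by lia.
rewrite add0n in h1; lia.
Qed.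

Lemma ev_neq0 r : no_mid r -> ev r != 0.
Proof.
move=> hr; apply/eqP => r0; have := @ev_free (fun q => (q == r)%:R) _ r hr.
rewrite eqxx (bigD1 r) //= big1 ?eqxx ?r0 ?scaler0 ?addr0 => [/(_ erefl)/eqP|q /andP[_ /negPf->]].
  by rewrite oner_eq0.
by rewrite scale0r.
Qed.

(* The parity is preserved because [J] commutes with the Hecke algebra. *)
Lemma npar_stepw t r : no_mid r -> wdesc t r -> odd (npar (stepw t r)) = odd (npar r).
Proof.
move=> hr dt; have hr' := no_mid_stepw t hr.
have := inU_comm (hd v t) (ev (stepw t r)) inU_J; rewrite !sigma_ev // wasc_step dt stepwK.
rewrite J_ev // linearZ /= sigma_ev // wasc_step dt stepwK J_ev // => /eqP.
rewrite -subr_eq0 -scalerBl scaler_eq0 (negPf (ev_neq0 hr)) orbF.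
case: odd; case: odd; rewrite //= ?subr0 ?sub0r ?oppr_eq0 oner_eq0 //.
Qed.

Lemma weight_r0 s : no_mid s -> same r0 s -> exists h, sigma h (ev r0) = ev s.
Proof.
have [m] := ubnP (height s); elim: m s => // m IH s hm hs ss.
have [[t dt]|nd] := pselect (exists t, wdesc t s); last first.
  exists 1; rewrite sigma1 -(sorted_r0 hs ss) // => t; apply/negP => dt; apply: nd; by exists t.
have [|||h hE] := IH (stepw t s).
- exact: leq_trans (height_step dt) _.
- exact: no_mid_stepw.
- case/sameP: ss => ms ps; apply/sameP; split=> [a an|]; first by rewrite mult_stepw // ms.
  by rewrite npar_stepw.
exists (h * hd v t); rewrite sigmaM hE sigma_ev ?wasc_step ?dt ?stepwK //.
exact: no_mid_stepw.
Qed.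

Lemma cyclic_init (t : 'I_d) : t.+1 != d -> exists2 f, inU f & f (ev r0) = ev (stepw t r0).
Proof.
move=> td; have lt := ltn_ord t; have st : ordS t = t.+1 :> nat by rewrite ordS_val //; lia.
have [||||||f hf fE] := @swap_ex (n - d + t)%N r0 t (ordS t).
- lia.
- exact: no_mid_r0.
- by rewrite mult_r0; lia.
- by rewrite mult_r0; lia.
- exact: lev_r0.
- by rewrite lev_r0 st addnS.
exists f => //; rewrite fE; congr ev; move: (r0) r0E => r rE; apply/ffunP => q; apply: ord_inj.
rewrite /stepw (negPf td) !ffunE; case: tpermP => [->|->|/eqP qt /eqP qs].
- rewrite eqxx (_ : (t == _) = false); last by apply/eqP => ts; move: st; rewrite -ts; lia.
  by rewrite up_val rE ?rE; lia.
- by rewrite eqxx dn_val !rE ifT; lia.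
- by rewrite (negPf qt) (negPf qs).
Qed.

(** The last reflection exchanges the last two letters and changes both signs. T flips the unique
    letter of level n-1 only, so the operator is composed of a flip, the exchange of levels n-2 and
    n-1, and a second flip, which meets the other letter. *)
Lemma cyclic_last (t : 'I_d) : t.+1 = d -> exists2 f, inU f & f (ev r0) = ev (stepw t r0).
Proof.
move=> td; set p := ord_pred t; have pt : p = e :> nat by rewrite /p; have := @ord_pred_val _ t; lia.
have te : t = e.+1 :> nat by lia.
have ptE : (p == t) = false by apply/eqP => h; move: pt; rewrite h te; lia.
have lp := lev_r0 p; have lt := lev_r0 t; have vp := r0E p; have vt := r0E t.
have n1 : (n.-1 < n)%N by lia.
have n2 : (n.-2.+1 < n)%N by lia.
set w1 := upd r0 t (rev_ord (r0 t)).
have m1 a : (a < n)%N -> mult_at a w1 = mult_at a r0.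
  by move=> an; have := mult_upd r0 t (rev_ord (r0 t)) an; rewrite lev_rev => /addIn.
have hw1 : no_mid w1 by apply: no_mid_upd no_mid_r0 _; rewrite lev_rev lt; lia.
have T1 : T (ev r0) = ev w1 by apply: T_ev; [exact: no_mid_r0|rewrite mult_r0 // -ltnS; lia|lia].
have w1q q : q != t -> w1 q = r0 q by move=> qt; rewrite ffunE (negPf qt).
have w1p : w1 p = r0 p by rewrite w1q ?ptE.
have w1t : w1 t = rev_ord (r0 t) by rewrite ffunE eqxx.
clearbody w1.
have l1 : lev (w1 p) = n.-2 by rewrite w1p lp; lia.
have l2 : lev (w1 t) = n.-1 by rewrite w1t lev_rev lt; lia.
have l3 : lev (up (w1 p)) = n.-1 by rewrite lev_up ?l1; lia.
have l4 : lev (dn (w1 t)) = n.-2 by rewrite lev_dn ?l2; lia.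
have [||||||f hf fE] := @swap_ex n.-2 w1 p t => //.
- by rewrite m1 ?mult_r0; lia.
- by rewrite m1 ?mult_r0; lia.
- by rewrite l2; lia.
set w2 := upd _ _ _ in fE.
have w2p : w2 p = n.-1 :> nat by rewrite !ffunE ptE eqxx up_val w1p vp; lia.
have w2t : w2 t = (n.+2) :> nat.
  rewrite ffunE eqxx dn_val w1t /= vt ifF ?inordK //; lia.
have hw2 : no_mid w2.
  apply: no_mid_upd; last by rewrite l4; lia.
  by apply: no_mid_upd => //; rewrite l3.
have m2 : mult_at n.-1 w2 = 1%N.
  have := mult_upd (upd w1 p (up (w1 p))) t (dn (w1 t)) n1.
  have := mult_upd w1 p (up (w1 p)) n1; rewrite -/w2 ffunE (eq_sym t) ptE.
  by rewrite l1 l2 l3 l4 m1 // mult_r0 // eqxx; lia.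
exists (T \o (f \o T))%VF; first by apply: inU_comp => //; apply: inU_comp.
rewrite !comp_lfunE T1 fE (@T_ev _ p) //; last by rewrite /lev w2p; lia.
congr ev; apply/ffunP => q; apply: ord_inj; rewrite /stepw td eqxx [in LHS]ffunE [in RHS]ffunE -/p.
have [_|qp] := eqVneq q p; first by rewrite /= w2p vt; lia.
have [->|qt] := eqVneq q t; first by rewrite w2t /= vp; lia.
by rewrite /w2 ffunE (negPf qt) ffunE (negPf qp) w1q.
Qed.

Lemma cyclic h : exists2 f, inU f & f (ev r0) = sigma h (ev r0).
Proof.
elim/pres_ind: h => [|h h' [f hf fE] [g hg gE]|k h [f hf fE]|t h [f hf fE]].
- by exists \1%VF => //; rewrite sigma1 id_lfunE.
- by exists (f + g); [exact: inU_add|rewrite sigmaD !add_lfunE fE gE].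
- by exists (k *: f); [exact: inU_scale|rewrite sigmaZ !scale_lfunE fE].
have [g hg gE] : exists2 g, inU g & g (ev r0) = sigma (hd v t) (ev r0).
  by rewrite sigma_ev ?wasc_r0 ?no_mid_r0 //; have [/cyclic_last|/cyclic_init] := eqVneq t.+1 d.
exists (g \o f)%VF; first exact: inU_comp.
by rewrite sigmaM comp_lfunE fE -gE inU_comm.
Qed.

(* The idempotent of the weight of [s] factors through that of [s']. *)
Definition link s s' := exists x y, [/\ inU x, inU y &
  forall p, proj s' p -> proj s (x \o p \o y)%VF].

Lemma link_same s s' : same s s' -> link s s'.
Proof.
move=> ss; exists \1%VF, \1%VF; split=> // p hp r hr.
by rewrite comp_lfun1l comp_lfun1r hp // (same_eq ss).
Qed.

Lemma link_trans s s' s'' : link s s' -> link s' s'' -> link s s''.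
Proof.
move=> [x [y [hx hy h]]] [x' [y' [hx' hy' h']]].
exists (x \o x')%VF, (y' \o y)%VF; split; try exact: inU_comp.
by move=> p hp r hr; rewrite -(h _ (h' _ hp)) // !comp_lfunE.
Qed.

(** If g maps the weight space of [s] into that of [s'] and f undoes it, then p_s = f p_{s'} (g
    p_s). *)
Lemma link_move s s' f g : inU f -> inU g ->
  (forall r, no_mid r -> same s r -> f (g (ev r)) = ev r /\
    forall p, proj s' p -> p (g (ev r)) = g (ev r)) -> link s s'.
Proof.
move=> hf hg h; have [q hq qE] := proj_ex s.
exists f, (g \o q)%VF; split=> // [|p hp r hr]; first exact: inU_comp.
rewrite !comp_lfunE qE //; case sr: (same s r); last by rewrite !scale0r !linear0.
by have [e1 e2] := h r hr sr; rewrite !scale1r e2 ?e1.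
Qed.

(** The quantum integer [m] is nonzero, since v^m = v^-m would give v^(2m) = 1. *)
Lemma vpow_neq m : (0 < m)%N -> (v ^+ m - v ^- m) / (v - v^-1) != 0.
Proof.
move=> m0; rewrite mulf_neq0 ?invr_eq0 // subr_eq0; apply/eqP => h.
have /vroot/eqP : (0 < m + m)%N by lia.
by apply; rewrite exprD {1}h mulVf // expf_neq0.
Qed.

Lemma half_lev a (x : L) : lev x = a -> (a < n)%N -> x != n :> nat.
Proof. by rewrite /lev; have := ltn_ord x; lia. Qed.

(** With level a+1 empty, F_a kills the weight space, so by the commutator relation F_a E_a acts on
    it as the nonzero scalar [m], with m the multiplicity of level a. Thus E_a is inverted by a
    multiple of F_a. *)
Lemma link_up s j a : (a.+1 < n)%N -> no_mid s -> lev (s j) = a -> mult_at a.+1 s = 0%N ->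
  link s (upd s j (up (s j))).
Proof.
move=> an hs ja m0; have an' := ltnW an; set m := mult_at a s.
have mp : (0 < m)%N by apply: mult_gt0 ja.
apply: (@link_move _ _ (((v ^+ m - v ^- m) / (v - v^-1))^-1 *: F a) (E a)).
- exact/inU_scale/inU_F.
- exact: inU_E.
move=> r hr sr; have [ms _] := sameP _ _ sr; split=> [|p hp].
  have F0 : F a (ev r) = 0.
    have [c [_ ->]] := F_ev an hr; rewrite big_pred0 // => k.
    by apply/negbTE; apply: mult_eq0; rewrite ?ms.
  have := EF_rel (ev r) an; rewrite F0 linear0 sub0r Hi_ev // H_ev // !linearZ /= Hi_ev // H_ev //.
  rewrite !ms // m0 -/m expr0 invr1 !scale1r -scalerBl scalerA => /(congr1 -%R).
  rewrite opprK -scaleNr -mulrN opprB mulrC scale_lfunE => ->.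
  by rewrite scalerA mulVf ?scale1r // vpow_neq.
have [c [_ ->]] := E_ev an hr; rewrite linear_sum; apply: eq_bigr => k /eqP ka.
rewrite linearZ /= hp.
  rewrite same_upd ?scale1r //; first by rewrite ja.
    by rewrite !lev_up ?ja ?ka.
  have hu (x : L) : lev x = a -> (n <= up x)%N = (n <= x)%N.
    by move=> xa; apply: half_up (half_lev xa an'); rewrite xa; lia.
  by rewrite !hu // !addbb.
by apply: no_mid_upd => //; rewrite lev_up ka.
Qed.

(** With level a empty it is E_a that vanishes, and E_a F_a acts as [m], with m the multiplicity of
    level a+1. *)
Lemma link_dn s j a : (a.+1 < n)%N -> no_mid s -> lev (s j) = a.+1 -> mult_at a s = 0%N ->
  link s (upd s j (dn (s j))).
Proof.
move=> an hs ja m0; have an' := ltnW an; set m := mult_at a.+1 s.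
have mp : (0 < m)%N by apply: mult_gt0 ja.
apply: (@link_move _ _ (((v ^+ m - v ^- m) / (v - v^-1))^-1 *: E a) (F a)).
- exact/inU_scale/inU_E.
- exact: inU_F.
move=> r hr sr; have [ms _] := sameP _ _ sr; split=> [|p hp].
  have E0 : E a (ev r) = 0.
    have [c [_ ->]] := E_ev an hr; rewrite big_pred0 // => k.
    by apply/negbTE; apply: mult_eq0; rewrite ?ms.
  have := EF_rel (ev r) an; rewrite E0 linear0 subr0 Hi_ev // H_ev // !linearZ /= Hi_ev // H_ev //.
  rewrite !ms // m0 -/m expr0 invr1 !scale1r scalerN -scalerBl scalerA scale_lfunE => ->.
  by rewrite scalerA [(v - v^-1)^-1 * _]mulrC mulVf ?scale1r // vpow_neq.
have [c [_ ->]] := F_ev an hr; rewrite linear_sum; apply: eq_bigr => k /eqP ka.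
rewrite linearZ /= hp.
  rewrite same_upd ?scale1r //; first by rewrite ja.
    by rewrite !lev_dn ?ja ?ka.
  have hd (x : L) : lev x = a.+1 -> (n <= dn x)%N = (n <= x)%N.
    by move=> xa; apply: half_dn (half_lev xa an); rewrite xa.
  by rewrite !hd // !addbb.
by apply: no_mid_upd => //; rewrite lev_dn ka.
Qed.

(** On words with a single letter of level n-1, T flips the sign of this letter and hence is its own
    inverse. *)
Lemma link_flip s j : no_mid s -> lev (s j) = n.-1 -> mult_at n.-1 s = 1%N ->
  link s (upd s j (rev_ord (s j))).
Proof.
move=> hs ja m1; have n1 : (n.-1 < n)%N by lia.
apply: (@link_move _ _ T T) => // r hr sr; have [ms _] := sameP _ _ sr.
have mr : mult_at n.-1 r = 1%N by rewrite ms.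
have [k ka] : exists k, lev (r k) = n.-1 by apply: mult_mem; rewrite ?mr.
set r' := upd r k (rev_ord (r k)); have r'k : r' k = rev_ord (r k) by rewrite ffunE eqxx.
have hr' : no_mid r' by apply: no_mid_upd; rewrite // lev_rev ka.
have mr' : mult_at n.-1 r' = 1%N.
  by have := mult_upd r k (rev_ord (r k)) n1; rewrite lev_rev mr => /addIn.
have Tr : T (ev r) = ev r' by apply: T_ev.
split=> [|p hp].
  rewrite Tr (@T_ev _ k) // ?r'k ?lev_rev // rev_ordK; congr ev.
  by apply/ffunP => i; rewrite !ffunE; case: eqP => // ->.
rewrite Tr hp // same_upd ?scale1r ?lev_rev ?ja ?ka //.
have flip (x : L) : lev x = n.-1 -> (n <= rev_ord x)%N = ~~ (n <= x)%N.
  by move=> xa; have := half_lev xa n1; rewrite /= -ltnNge; have := ltn_ord x; lia.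
by rewrite !flip // !addNb !addbb.
Qed.

Local Notation target b := (b - (n - d))%N.
(** The absolute difference, written with truncated subtractions; for b <= n, [target b] is the
    number of letters of [r0] of level less than b. *)
Definition excess s b : nat := ((below b s - target b) + (target b - below b s))%N.

(** The cumulative counts determine all multiplicities, so [s] differs from [r0] at most by its
    parity, which flipping the one letter of level n-1 corrects. *)
Lemma link_r0_aligned s : no_mid s -> (forall b, (b <= n)%N -> below b s = target b) -> link s r0.
Proof.
move=> hs hb.
have ms a : (a < n)%N -> mult_at a s = (n - d <= a)%N.
  by move=> an; have := belowS s an; rewrite !hb //; [lia|exact: ltnW].
have [ps|ps] := boolP (odd (npar s)); last first.
  apply: link_same; apply/sameP; split=> [a an|]; first by rewrite mult_r0 ?ms.
  by rewrite npar_r0 (negPf ps).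
have n1 : (n.-1 < n)%N by lia.
have m1 : mult_at n.-1 s = 1%N by rewrite ms //; lia.
have [j ja] : exists j, lev (s j) = n.-1 by apply: mult_mem; rewrite ?m1.
apply: link_trans (link_flip hs ja m1) _; apply: link_same; apply/sameP; split=> [a an|].
  rewrite mult_r0 // -ms //; apply/esym.
  by have := mult_upd s j (rev_ord (s j)) an; rewrite lev_rev => /addIn.
have /(congr1 odd) := npar_upd s j (rev_ord (s j)); rewrite npar_r0 !oddD ps !oddb.
have -> : (n <= rev_ord (s j))%N = ~~ (n <= s j)%N.
  by have := half_lev ja n1; rewrite /= -ltnNge; have := ltn_ord (s j); lia.
by case: odd; case: (n <= s j)%N.
Qed.

Lemma link_r0 s : no_mid s -> link s r0.
Proof.
have [m] := ubnP (\sum_(b < n) excess s b)%N; elim: m s => // m IH s hm hs.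
have tm : {homo (fun b => target b) : a b / (a <= b)%N} by move=> a b; lia.
have ts b : (target b.+1 <= (target b).+1)%N by lia.
have en : below n s = target n by rewrite below_n //; lia.
have [[b [bn hb]]|ns] := pselect (exists b, (b <= n)%N /\ (target b < below b s)%N).
  (* Raising a letter from level a to a+1 changes [below] at a+1 only, so the total excess drops by
     one. *)
  have [a [an ta la ea]] := surplus_move (below_mono s) (below0 s) tm ts en bn hb.
  have [j ja] : exists j, lev (s j) = a.
    by apply: mult_mem; [lia|have := belowS s (ltnW an); lia].
  have m0 : mult_at a.+1 s = 0%N by have := belowS s an; lia.
  have lu : lev (up (s j)) = a.+1 by rewrite lev_up ja; lia.
  apply: link_trans (link_up an hs ja m0) _; apply: IH; last by apply: no_mid_upd => //; rewrite lu.
  rewrite -ltnS; apply: leq_trans hm; rewrite !ltnS; apply: (@ltn_sum_at n (excess _) (excess s) a.+1) => // [c ca|]; rewrite /excess.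
    by have := below_upd c s j (up (s j)); rewrite ja lu => h; congr (_ - _ + (_ - _))%N; lia.
  by have := below_upd a.+1 s j (up (s j)); rewrite ja lu; lia.
have [[b [bn hb]]|nd] := pselect (exists b, (b <= n)%N /\ (below b s < target b)%N).
  (* Lowering a letter from level a+1 to a likewise changes only [below a.+1]. *)
  have [a [an ta la ea]] := deficit_move (below_mono s) (below0 s) tm ts en bn (sub0n _) hb.
  have [j ja] : exists j, lev (s j) = a.+1.
    by apply: mult_mem => //; have := belowS s an; lia.
  have m0 : mult_at a s = 0%N by have := belowS s (ltnW an); lia.
  have ld : lev (dn (s j)) = a by rewrite lev_dn ja.
  apply: link_trans (link_dn an hs ja m0) _; apply: IH; last by apply: no_mid_upd => //; rewrite ld ltnW.
  rewrite -ltnS; apply: leq_trans hm; rewrite !ltnS; apply: (@ltn_sum_at n (excess _) (excess s) a.+1) => // [c ca|]; rewrite /excess.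
    by have := below_upd c s j (dn (s j)); rewrite ja ld => h; congr (_ - _ + (_ - _))%N; lia.
  by have := below_upd a.+1 s j (dn (s j)); rewrite ja ld; lia.
apply: link_r0_aligned => // b bn; apply/eqP; rewrite eqn_leq; apply/andP; split; rewrite leqNgt; apply/negP.
  by move=> h; apply: ns; exists b.
by move=> h; apply: nd; exists b.
Qed.

Lemma proj_r0_image p m : proj r0 p -> exists h, p m = sigma h (ev r0).
Proof.
move=> hp; have [c ->] := ev_span m; rewrite linear_sum.
apply: (big_ind (fun x : M => exists h, x = sigma h (ev r0))) => [|x y [h ->] [k ->]|r hr].
- by exists 0; rewrite sigma0 zero_lfunE.
- by exists (h + k); rewrite sigmaD add_lfunE.
rewrite linearZ /= hp //; case sr: (same r0 r).
  have [h hE] := weight_r0 hr sr; exists (c r *: h).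
  by rewrite sigmaZ scale_lfunE hE scale1r.
by exists 0; rewrite sigma0 zero_lfunE scale0r scaler0.
Qed.

Lemma generated m : exists2 f, inU f & f (ev r0) = m.
Proof.
have [c ->] := ev_span m; apply: (big_ind (fun x : M => exists2 f, inU f & f (ev r0) = x)).
- by exists 0; [exact: inU0|rewrite zero_lfunE].
- by move=> x y [f hf <-] [g hg <-]; exists (f + g); [exact: inU_add|rewrite add_lfunE].
move=> s hs; have [x [y [hx hy h]]] := link_r0 hs; have [p _ pE] := proj_ex r0.
have [k kE] := proj_r0_image (y (ev s)) pE; have [f hf fE] := cyclic k.
exists (c s *: (x \o f)%VF); first by apply/inU_scale/inU_comp.
rewrite scale_lfunE comp_lfunE fE -kE; congr (_ *: _).
by have := h p pE s hs; rewrite !comp_lfunE same_refl scale1r.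
Qed.

Lemma commutant_U g : (forall f m, inU f -> g (f m) = f (g m)) -> exists h, sigma h = g.
Proof.
move=> hg; have [p hp pE] := proj_ex r0.
have p0 : p (ev r0) = ev r0 by rewrite pE ?no_mid_r0 // same_refl scale1r.
have [h hE] := proj_r0_image (g (ev r0)) pE; exists h; apply/lfunP => m.
have [f hf <-] := generated m; rewrite hg // inU_comm // -hE -hg // p0 //.
Qed.

Lemma commutant_H g : (forall h m, g (sigma h m) = sigma h (g m)) -> inU g.
Proof.
move=> hg.
have class s : no_mid s -> exists2 f, inU f &
    forall r, no_mid r -> f (ev r) = (same s r)%:R *: g (ev r).
  move=> hs; have [x [y [hx hy h]]] := link_r0 hs; have [p hp pE] := proj_ex r0.
  (* [f] and g x agree at [ev r0] and both commute with H_d, hence they agree on the whole weight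
     space of [r0], the image of p. *)
  have [f hf fE] := generated (g (x (ev r0))).
  exists (f \o (p \o y))%VF => [|r hr]; first by apply: inU_comp => //; apply: inU_comp.
  rewrite !comp_lfunE; have [k kE] := proj_r0_image (y (ev r)) pE.
  rewrite kE -inU_comm // fE -hg inU_comm // -kE.
  by have := h p pE r hr; rewrite !comp_lfunE => ->; rewrite linearZ.
(* The operators obtained per weight have to be summed over classes, not over words: a word whose
   class is already represented in the list adds nothing. *)
have cover (l : seq word) : all (@no_mid n d) l -> exists2 f, inU f &
    forall r, no_mid r -> f (ev r) = (has (fun q => same q r) l)%:R *: g (ev r).
  elim: l => [_|s l IH /= /andP[hs /IH[f hf fE]]].
    by exists 0 => [|r _]; [exact: inU0|rewrite zero_lfunE scale0r].
  have [f' hf' f'E] := class s hs; have [hl|nl] := boolP (has (fun q => same q s) l).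
    exists f => // r hr; rewrite fE //; case sr: (same s r) => //=; rewrite (_ : has _ l = true) //.
    by rewrite -hl; apply: eq_has => q; rewrite /= !(same_sym q) (same_eq sr).
  exists (f + f') => [|r hr]; first exact: inU_add.
  rewrite add_lfunE fE // f'E // -scalerDl; congr (_ *: _); case sr: (same s r) => /=; last exact: addr0.
  rewrite (_ : has _ l = false) ?add0r //; apply/negbTE; apply: contra nl => /hasP[q ql qr].
  by apply/hasP; exists q; rewrite // same_sym (same_eq sr) same_sym.
have [|f hf fE] := cover (enum (@no_mid n d)); first by apply/allP => r; rewrite mem_enum.
suff <- : f = g by [].
apply: ev_ext => r hr; rewrite fE // (_ : has _ _ = true) ?scale1r //.
by apply/hasP; exists r; rewrite ?mem_enum //= same_refl.
Qed.

Theorem double_centralizer :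
  [/\ injective sigma,
      (forall g, (forall f m, inU f -> g (f m) = f (g m)) <-> exists h, sigma h = g)
    & (forall g, (forall h m, g (sigma h m) = sigma h (g m)) <-> inU g)].
Proof.
split; first exact: sigma_inj.
- by move=> g; split=> [/commutant_U//|[h <-] f m hf]; apply: inU_comm.
- by move=> g; split=> [/commutant_H//|hg h m]; rewrite inU_comm.
Qed.

End DoubleCentralizer.

(** * T on words with at most one letter of level n-1 *)

Section FlipOperator.
Variables (K : fieldType) (v : K) (n t : nat).
Hypotheses (v0 : v != 0) (v2 : v - v^-1 != 0) (tn : n = t.+1).
Local Notation L := 'I_n.*2.+1.

Lemma vslice_T_mid d (y : L) (r : word n d.+1) : y = n :> nat -> no_mid r ->
  vslice y (opT v (vec K r)) = 0.
Proof. by move=> yn hr; apply: inW_mid => //; apply: (inW_T v0 v2 tn); apply: inW_vec. Qed.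

Lemma inord_eq (z : L) m : (m <= n.*2)%N -> (inord m == z) = (z == m :> nat).
Proof. by move=> mn; rewrite -val_eqE /= inordK // eq_sym. Qed.

Lemma opT_vec0 d (r : word n d) : no_mid r -> mult_at t r = 0%N -> opT v (vec K r) = 0.
Proof.
elim: d r => [|d IH] r; first by rewrite (opT0 _ _ tn).
rewrite [r]wcons_tail; move: (r ord0) (wtail r) => x s hr.
have := hr; rewrite no_mid_wcons mult_wcons => /andP[xn hs] m0; have ltn_x := ltn_ord x.
apply: vslice_inj => y; have [yn|yn] := eqVneq (y : nat) n.
  by rewrite vslice_T_mid // linear0.
rewrite (slice_opT v0 v2 tn (inW_vec K hr) yn) !vslice_vec !linearZ /= IH //; last by lia.
rewrite !inord_eq; try lia.
have -> : (x == n.+1 :> nat) = false by lia.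
have -> : (x == t :> nat) = false by lia.
by rewrite !scale0r !scaler0 !addr0 linear0.
Qed.

(** The coefficient is exactly 1: in the recursion of T letters of other levels contribute no power
    of v, and H_n is trivial on the letters after the unique one of level t. *)
Lemma opT_vec d (r : word n d) j : no_mid r -> mult_at t r = 1%N -> lev (r j) = t ->
  opT v (vec K r) = vec K (upd r j (rev_ord (r j))).
Proof.
elim: d r j => [|d IH] r j; first by case: j.
rewrite [r]wcons_tail; move: (r ord0) (wtail r) => x s hr.
have := hr; rewrite no_mid_wcons mult_wcons => /andP[xn hs] m1 ja; have ltn_x := ltn_ord x.
apply: vslice_inj => y; have ltn_y := ltn_ord y; have [yn|yn] := eqVneq (y : nat) n.
  rewrite vslice_T_mid //; apply/esym/inW_mid => //; apply/inW_vec/no_mid_upd => //.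
  by rewrite lev_rev ja; lia.
rewrite (slice_opT v0 v2 tn (inW_vec K hr) yn) !vslice_vec !linearZ /= !inord_eq; try lia.
have Hn : mult_at t s = 0%N -> opH v n (vec K s) = vec K s.
  by move=> m0; have := opH_vec v t s; rewrite -tn m0 expr0 invr1 scale1r.
have Hin : mult_at t s = 0%N -> opHinv v n (vec K s) = vec K s.
  by move=> m0; have := opHinv_vec v t s; rewrite -tn m0 expr0 scale1r.
case: (unliftP ord0 j) ja => [k|] -> ja; last first.
  rewrite wcons0 in ja *; have m0 : mult_at t s = 0%N by move: ja m1; rewrite /lev; lia.
  rewrite upd0 vslice_vec opT_vec0 // Hn // Hin // !scaler0 add0r !scalerA -scalerDl -!natrM -natrD.
  congr (_%:R *: _); rewrite -val_eqE /= subSS.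
  have [xt|xt] : x = t :> nat \/ x = n.+1 :> nat by move: ja; rewrite /lev; lia.
    by rewrite xt (_ : (t == n.+1) = false) ?muln0 ?eqxx ?muln1 //; lia.
  by rewrite xt (_ : (n.+1 == t) = false) ?muln0 ?eqxx ?muln1 //; lia.
rewrite wconsS in ja *; have mp : (0 < mult_at t s)%N by apply: mult_gt0 ja; lia.
rewrite updS vslice_vec (IH s k) //; last by lia.
have -> : (x == n.+1 :> nat) = false by lia.
have -> : (x == t :> nat) = false by lia.
rewrite !scale0r ?scaler0 !addr0; have [->|] := eqVneq y x; last by rewrite !scale0r ?scaler0.
have -> : (x == t :> nat) = false by lia.
have -> : (x + t == n.*2)%N = false by lia.
by rewrite expr0 invr1 mulr1 !scale1r.
Qed.

End FlipOperator.

Lemma um_EF (K : fieldType) (v : K) n (i : 'I_n.-1) (a b : 'I_n) : a = i :> nat -> b = i.+1 :> nat ->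
  um v (UE i) * um v (UF i) - um v (UF i) * um v (UE i) =
  (v - v^-1)^-1 *: (um v (UH a) * um v (UHinv b) - um v (UHinv a) * um v (UH b)).
Proof.
apply: (Um_EF_descent (phi := pres_pi (@Um_proper K v n)) (g := @free_gen K (Um_gen n))).
exact: pres_rel.
Qed.

(** * Transfer of the double centralizer property to W *)

Section Restriction.
Variables (K : fieldType) (v : K) (n e : nat).
Local Notation d := e.+2.
Hypotheses (v0 : v != 0) (v2 : v - v^-1 != 0) (vroot : forall k, (0 < k)%N -> v ^+ k != 1).
Variables (M : vectType K) (val : {linear M -> Vd K n d}).
Hypotheses (val_inj : injective val) (val_inW : forall m, inW (val m)).
Hypothesis val_onto : forall w, inW w -> exists m, val m = w.
Variables (rho : Um v n -> 'End(M)) (sigma : Hd v d -> 'End(M)).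
Hypotheses (rho_act : left_action rho) (sigma_act : right_action sigma).
Hypothesis rhoE : forall g m, val (rho (um v g) m) = match g with
  | UE i => opE v i.+1 (val m) | UF i => opF v i.+1 (val m)
  | UH a => opH v a.+1 (val m) | UHinv a => opHinv v a.+1 (val m)
  | UT => opT v (val m) | UJ x => opJ x (val m) end.
Hypothesis sigmaE : forall t m, val (sigma (hd v t) m) = opTau v t (val m).
Hypothesis comm : forall u h m, sigma h (rho u m) = rho u (sigma h m).
Implicit Types (r s : word n d) (a : nat).

Definition base r : M :=
  if pselect (exists m, val m = vec K r) is left ex then sval (cid ex) else 0.

Lemma val_base r : no_mid r -> val (base r) = vec K r.
Proof.
move=> hr; rewrite /base; case: pselect => [ex|[]]; first exact: svalP (cid ex).
by apply: val_onto; apply: inW_vec.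
Qed.

Lemma base_span m : exists c : word n d -> K, m = \sum_(r | no_mid r) c r *: base r.
Proof.
exists (val m); apply: val_inj; rewrite linear_sum {1}[val m]Vd_sum.
rewrite (bigID (@no_mid n d)) /= [X in _ + X]big1 ?addr0 => [|r /(val_inW m)->]; last exact: scale0r.
by apply: eq_bigr => r hr; rewrite linearZ /= val_base.
Qed.

Lemma base_free (c : word n d -> K) : \sum_(r | no_mid r) c r *: base r = 0 ->
  forall r, no_mid r -> c r = 0.
Proof.
move=> /(congr1 val); rewrite linear0 linear_sum => h r hr.
move/ffunP/(_ r): h; rewrite (eq_bigr (fun s => c s *: vec K s)) => [|s hs]; last first.
  by rewrite linearZ /= val_base.
rewrite sum_ffunE (bigD1 r) //= big1 => [|s /andP[_ sr]]; rewrite !ffunE; last first.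
  by rewrite eq_sym (negPf sr) [_ *: _]mulr0.
by rewrite eqxx addr0 [_ *: _]mulr1.
Qed.

Definition genE a : 'End(M) := if insub a is Some i then rho (um v (UE i)) else 0.
Definition genF a : 'End(M) := if insub a is Some i then rho (um v (UF i)) else 0.
Definition genH a : 'End(M) := if insub a is Some i then rho (um v (UH i)) else 0.
Definition genHi a : 'End(M) := if insub a is Some i then rho (um v (UHinv i)) else 0.

Lemma genEE a (an : (a < n.-1)%N) : genE a = rho (um v (UE (Ordinal an))).
Proof. by rewrite /genE insubT. Qed.
Lemma genFE a (an : (a < n.-1)%N) : genF a = rho (um v (UF (Ordinal an))).
Proof. by rewrite /genF insubT. Qed.
Lemma genHE a (an : (a < n)%N) : genH a = rho (um v (UH (Ordinal an))).
Proof. by rewrite /genH insubT. Qed.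
Lemma genHiE a (an : (a < n)%N) : genHi a = rho (um v (UHinv (Ordinal an))).
Proof. by rewrite /genHi insubT. Qed.
Let pred_lt a : (a.+1 < n)%N -> (a < n.-1)%N. Proof. lia. Qed.

Lemma cE_neq0 x a r j : cE v x a r j != 0.
Proof. by rewrite mulf_neq0 ?invr_eq0 // expf_neq0. Qed.
Lemma cF_neq0 x a r j : cF v x a r j != 0.
Proof. by rewrite mulf_neq0 ?invr_eq0 // expf_neq0. Qed.

Lemma genE_base a r : (a.+1 < n)%N -> no_mid r -> exists c : 'I_d -> K,
  (forall j, c j != 0) /\
  genE a (base r) = \sum_(j | lev (r j) == a) c j *: base (upd r j (up (r j))).
Proof.
(* A letter below the middle is changed through its own position, a letter beyond it through its
   mirror image, so the half is decided by [r j < n]. *)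
move=> an hr; exists (fun j => cE v (r j < n)%N a r j); split=> [j|]; first exact: cE_neq0.
apply: val_inj; rewrite (genEE (pred_lt an)) rhoE val_base // opE_vec linear_sum.
rewrite big_mkcond [X in _ + X]big_mkcond -big_split [RHS]big_mkcond; apply: eq_bigr => j _ /=.
have ltn_r := ltn_ord (r j); rewrite linearZ /= /up.
have [ra|ra] := eqVneq (r j : nat) a.
  have -> : (r j + a == n.*2)%N = false by lia.
  have -> : lev (r j) == a by rewrite /lev; lia.
  have rn : (r j < n)%N by lia.
  rewrite rn addr0 val_base //; apply: no_mid_upd => //.
  by rewrite /lev inordK; lia.
have [ra'|ra'] := eqVneq (r j + a)%N n.*2.
  have -> : lev (r j) == a by rewrite /lev; lia.
  have -> : (r j < n)%N = false by lia.
  rewrite add0r val_base //; apply: no_mid_upd => //.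
  by rewrite /lev inordK; lia.
by rewrite addr0 ifF //; apply/eqP; rewrite /lev; lia.
Qed.

Lemma genF_base a r : (a.+1 < n)%N -> no_mid r -> exists c : 'I_d -> K,
  (forall j, c j != 0) /\
  genF a (base r) = \sum_(j | lev (r j) == a.+1) c j *: base (upd r j (dn (r j))).
Proof.
move=> an hr; exists (fun j => cF v (r j < n)%N a r j); split=> [j|]; first exact: cF_neq0.
apply: val_inj; rewrite (genFE (pred_lt an)) rhoE val_base // opF_vec linear_sum.
rewrite big_mkcond [X in _ + X]big_mkcond -big_split [RHS]big_mkcond; apply: eq_bigr => j _ /=.
have ltn_r := ltn_ord (r j); rewrite linearZ /= /dn.
have [ra|ra] := eqVneq (r j : nat) a.+1.
  have -> : (r j + a.+1 == n.*2)%N = false by lia.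
  have -> : lev (r j) == a.+1 by rewrite /lev; lia.
  have rn : (r j < n)%N by lia.
  rewrite rn addr0 val_base //; apply: no_mid_upd => //.
  by rewrite /lev inordK; lia.
have [ra'|ra'] := eqVneq (r j + a.+1)%N n.*2.
  have -> : lev (r j) == a.+1 by rewrite /lev; lia.
  have -> : (r j < n)%N = false by lia.
  rewrite add0r val_base //; apply: no_mid_upd => //.
  by rewrite /lev inordK; lia.
by rewrite addr0 ifF //; apply/eqP; rewrite /lev; lia.
Qed.

Lemma genH_base a r : (a < n)%N -> no_mid r -> genH a (base r) = v ^- mult_at a r *: base r.
Proof.
by move=> an hr; apply: val_inj; rewrite (genHE an) rhoE linearZ /= val_base // opH_vec.
Qed.
Lemma genHi_base a r : (a < n)%N -> no_mid r -> genHi a (base r) = v ^+ mult_at a r *: base r.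
Proof.
by move=> an hr; apply: val_inj; rewrite (genHiE an) rhoE linearZ /= val_base // opHinv_vec.
Qed.
Lemma genJ_base r : no_mid r ->
  rho (um v (UJ true)) (base r) = (~~ odd (npar r))%:R *: base r.
Proof.
move=> hr; apply: val_inj; rewrite rhoE linearZ /= val_base // /opJ extend_vec hr -/(npar r).
by case: odd; rewrite ?scale1r ?scale0r.
Qed.
Lemma genT_base r j : no_mid r -> mult_at n.-1 r = 1%N -> lev (r j) = n.-1 ->
  rho (um v UT) (base r) = base (upd r j (rev_ord (r j))).
Proof.
move=> hr m1 ja; have n0 : n = n.-1.+1 by have := no_mid_lev j hr; lia.
apply: val_inj; rewrite rhoE !val_base ?(opT_vec v0 v2 n0 hr m1 ja) //.
by apply: no_mid_upd; rewrite // lev_rev no_mid_lev.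
Qed.

Lemma sigma_base t r : no_mid r -> sigma (hd v t) (base r) =
  if wasc t r then base (stepw t r)
  else if wdesc t r then (v ^+ 2 - 1) *: base r + v ^+ 2 *: base (stepw t r)
  else v ^+ 2 *: base r.
Proof.
move=> hr; have hs := no_mid_stepw t hr.
apply: val_inj; rewrite sigmaE val_base // /opTau extend_vec.
have -> (b c : bool) x y z : val (if b then x else if c then y else z) =
    if b then val x else if c then val y else val z by case: b; case: c.
rewrite !linearD !linearZ /= !val_base // /wasc /wdesc /ascn /descn /stepw.
have lt := ltn_ord t; case: (t.+1 =P d) => td.
  have te : t = e.+1 :> nat by lia.
  have pt : ord_pred t = e :> nat by have := @ord_pred_val _ t; lia.
  have -> : gw r e = r (ord_pred t) by rewrite -gwE pt.
  have -> : gw r e.+1 = r t by rewrite -gwE te.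
  by rewrite te eqxx /tau_rule addnS addSn !ltnS !eqSS; case: ltngtP.
have st : ordS t = t.+1 :> nat by apply: ordS_val; lia.
have -> : (t == e.+1 :> nat) = false by lia.
have -> : gw r t.+1 = r (ordS t) by rewrite -gwE st.
by rewrite /tau_rule gwE; case: ltngtP.
Qed.

Lemma EF_pointwise a m : (a.+1 < n)%N ->
  genE a (genF a m) - genF a (genE a m) =
  (v - v^-1)^-1 *: (genH a (genHi a.+1 m) - genHi a (genH a.+1 m)).
Proof.
move=> an; rewrite (genEE (pred_lt an)) (genFE (pred_lt an)) (genHE an) (genHiE an).
rewrite (genHE (ltnW an)) (genHiE (ltnW an)).
have [lin _ mul] := rho_act.
have rhoM x y w : rho (x * y) w = rho x (rho y w) by rewrite mul comp_lfunE.
have rho0 : rho 0 = 0 by have := lin (-1) 0 0; rewrite scaler0 addr0 scaleN1r addNr.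
have rhoZ k x : rho (k *: x) = k *: rho x by have := lin k x 0; rewrite !addr0 rho0 addr0.
have rhoB x y : rho (x - y) = rho x - rho y by have := lin (-1) y x; rewrite !scaleN1r ![- _ + _]addrC.
have := @um_EF K v n (Ordinal (pred_lt an)) (Ordinal (ltnW an)) (Ordinal an) erefl erefl.
by move=> /(congr1 (fun x => rho x m)); rewrite rhoZ !rhoB scale_lfunE !add_lfunE !opp_lfunE !rhoM.
Qed.

Theorem restricted_double_centralizer : (d <= n)%N ->
  [/\ injective sigma,
      (forall f, equivariant rho f <-> exists h, sigma h = f)
    & (forall f, equivariant sigma f <-> exists u, rho u = f)].
Proof.
move=> ledn; have [lin one mul] := rho_act.
have rho0 : rho 0 = 0 by have := lin (-1) 0 0; rewrite scaler0 addr0 scaleN1r addNr.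
pose inU f := exists u, rho u = f.
have inU1 : inU \1%VF by exists 1.
have inUM f g : inU f -> inU g -> inU (f \o g)%VF by move=> [x <-] [y <-]; exists (x * y).
have inUD f g : inU f -> inU g -> inU (f + g).
  by move=> [x <-] [y <-]; exists (1 *: x + y); rewrite lin scale1r.
have inUZ k f : inU f -> inU (k *: f).
  by move=> [x <-]; exists (k *: x + 0); rewrite lin rho0 addr0.
have inUE a : (a.+1 < n)%N -> inU (genE a) by move=> an; rewrite (genEE (pred_lt an)); eexists.
have inUF a : (a.+1 < n)%N -> inU (genF a) by move=> an; rewrite (genFE (pred_lt an)); eexists.
have inUHi a : (a < n)%N -> inU (genHi a) by move=> an; rewrite (genHiE an); eexists.
have inUT : inU (rho (um v UT)) by eexists.
have inUJ : inU (rho (um v (UJ true))) by eexists.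
have inUC f h m : inU f -> sigma h (f m) = f (sigma h m) by move=> [u <-].
have [inj cU cH] := double_centralizer v0 v2 vroot ledn base_span base_free genE_base genF_base
  genH_base genHi_base genJ_base genT_base EF_pointwise inU1 inUM inUD inUZ inUE inUF inUHi inUT
  inUJ sigma_act sigma_base inUC.
split=> // f; first rewrite -cU.
by split=> [h g m [u <-]|h u m]; [apply: h|apply: h; exists u].
Qed.

End Restriction.

(** * The field Q(v) and the conclusion *)

Lemma qv_neq0 : qv != 0.
Proof. by rewrite /qv tofrac_eq0 polyX_eq0. Qed.

Lemma qvX_neq1 k : (0 < k)%N -> qv ^+ k != 1.
Proof.
move=> k0; rewrite /qv -tofracXn -tofrac1 tofrac_eq.
apply/eqP => /(congr1 (fun p : {poly rat} => size p)); rewrite size_polyXn size_poly1; lia.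
Qed.

Lemma qv_sub_neq0 : qv - qv^-1 != 0.
Proof.
rewrite subr_eq0; apply: contra (qvX_neq1 (ltn0Sn 1)) => /eqP h.
by rewrite expr2 {1}h mulVf // qv_neq0.
Qed.

Lemma actions_commute (K : fieldType) (v : K) n d (M : vectType K)
    (rho : Um v n -> 'End(M)) (sigma : Hd v d -> 'End(M)) :
  left_action rho -> right_action sigma ->
  (forall g t w, sigma (hd v t) (rho (um v g) w) = rho (um v g) (sigma (hd v t) w)) ->
  forall u h w, sigma h (rho u w) = rho u (sigma h w).
Proof.
move=> [rl r1 rM] [sl s1 sM] gen.
have rho0 : rho 0 = 0 by have := rl (-1) 0 0; rewrite scaler0 addr0 scaleN1r addNr.
have rhoZ k x : rho (k *: x) = k *: rho x by have := rl k x 0; rewrite !addr0 rho0 addr0.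
have rhoD x y : rho (x + y) = rho x + rho y by have := rl 1 x y; rewrite !scale1r.
have sigma0 : sigma 0 = 0 by have := sl (-1) 0 0; rewrite scaler0 addr0 scaleN1r addNr.
have sigmaZ k x : sigma (k *: x) = k *: sigma x by have := sl k x 0; rewrite !addr0 sigma0 addr0.
have sigmaD x y : sigma (x + y) = sigma x + sigma y by have := sl 1 x y; rewrite !scale1r.
have genU t u w : sigma (hd v t) (rho u w) = rho u (sigma (hd v t) w).
  elim/pres_ind: u w => [w|x y hx hy w|k x hx w|g x hx w].
  - by rewrite r1 !id_lfunE.
  - by rewrite rhoD !add_lfunE linearD /= hx hy.
  - by rewrite rhoZ !scale_lfunE linearZ /= hx.
  - by rewrite rM !comp_lfunE gen hx.
move=> u h; elim/pres_ind: h => [w|x y hx hy w|k x hx w|t x hx w].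
- by rewrite s1 !id_lfunE.
- by rewrite sigmaD !add_lfunE linearD /= hx hy.
- by rewrite sigmaZ !scale_lfunE linearZ /= hx.
- by rewrite sM !comp_lfunE genU hx.
Qed.

Theorem proposition2p2p2 (n d : nat) (hn : (1 <= n)%N) (hd : (2 <= d)%N) :
  exists (rho : Um qv n -> 'End(subvs_of (Wd Qv n d)))
         (sigma : Hd qv d -> 'End(subvs_of (Wd Qv n d))),
  [/\ is_Um_action rho, is_Hd_action sigma,
      (forall u h w, sigma h (rho u w) = rho u (sigma h w))
    & (d <= n)%N ->
      [/\ injective sigma,
          (forall f, equivariant rho f <-> exists h, sigma h = f)
        & (forall f, equivariant sigma f <-> exists u, rho u = f)]].
Proof.
have q0 := qv_neq0; have q2 := qv_sub_neq0.
case: d hd => [|[|e]] // hd.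
have M0 := @dimW_gt0 Qv n e.+2 hn.
have PU := Phi_U q0 q2 hn hd; have PH := Phi_H q0 q2 hn hd.
have [rho [rho_act rhoE]] := Um_action_ex
  (Um_relations (M0 := M0) q0 q2 hn hd (@PhiD Qv n e.+2) (@PhiZ Qv n e.+2) (@Phi_inj Qv n e.+2) PU).
have [sigma [sigma_act sigmaE]] := Hd_action_ex
  (Hd_relations (M0 := M0) q0 q2 hn hd (@PhiD Qv n e.+2) (@PhiZ Qv n e.+2) (@Phi_inj Qv n e.+2) PH).
have rhoV g w : vsval (rho (um qv g) w) = match g with
  | UE i => opE qv i.+1 (vsval w) | UF i => opF qv i.+1 (vsval w)
  | UH a => opH qv a.+1 (vsval w) | UHinv a => opHinv qv a.+1 (vsval w)
  | UT => opT qv (vsval w) | UJ x => opJ x (vsval w) end by rewrite rhoE; apply: hUE.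
have sigmaV t w : vsval (sigma (Defs.hd qv t) w) = opTau qv t (vsval w) by rewrite sigmaE; apply: hHE.
have comm := actions_commute rho_act sigma_act.
have {}comm u h w : sigma h (rho u w) = rho u (sigma h w).
  apply: comm => g t m; rewrite rhoE sigmaE.
  exact (commute_generators q0 q2 hn hd M0 (@Phi_inj Qv n e.+2) PU PH g t m).
exists rho, sigma; split=> //.
- split=> //; split=> [i|a|x|]; try split; move=> w; exact: rhoV.
apply: (@restricted_double_centralizer Qv qv n e q0 q2 qvX_neq1 _
  (vsval : {linear subvs_of (Wd Qv n e.+2) -> Vd Qv n e.+2})) => //.
- exact: subvs_inj.
- exact: inW_val.
- by move=> w /memWd hw; exists (Subvs hw).
Qed.
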